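(* Let $N,M$ be nonnegative integers, and let $w_{\mathfrak{so}(N)}$, $w_{\mathfrak{sp}(2M)}$, $w_{\mathfrak{osp}(N|2M)}$ be the functions on permutations with values in $U\mathfrak{so}(N)$, $U\mathfrak{sp}(2M)$, $U\mathfrak{osp}(N|2M)$, respectively, defined in the context. Then each of these functions takes values in the center of the corresponding universal enveloping algebra, and satisfies the $\mathfrak{so}$-relations (A1)–(A4) listed in the context, where $C_k$, $k\ge1$, is specialized to the standard Casimir element of the corresponding Lie (super)algebra, and where $C_0=N$ for $\mathfrak{so}(N)$, $C_0=-2M$ for $\mathfrak{sp}(2M)$, and $C_0=N-2M$ for $\mathfrak{osp}(N|2M)$.
   Context: **Permutations.** $S(m)$ is the symmetric group on $\{1,\dots,m\}$ ($S(0)$ has one element, the empty permutation). A permutation of a finite totally ordered set $X$ is identified with an element of $S(|X|)$ via the order-preserving bijection. A cycle $(x_1\,x_2\dots x_\ell)$ means $x_1\mapsto x_2\mapsto\dots\mapsto x_\ell\mapsto x_1$. The concatenation of $s\in S(m)$ and $t\in S(n)$ is the permutation in $S(m+n)$ acting as $s$ on $\{1,\dots,m\}$ and as $t$ (shifted by $m$) on $\{m+1,\dots,m+n\}$. For a finite word $Q$ in distinct letters, $|Q|$ is its length and $\overline{Q}$ is the reversed word; juxtaposition of words is concatenation; words may be empty. **The $\mathfrak{so}$-relations.** A function $w$ on all permutations with values in a commutative ring with given elements $C_0,C_2,C_4,\dots$ satisfies the $\mathfrak{so}$-relations if: (A1) $w$ is multiplicative with respect to concatenation, and $w=1$ on the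 empty permutation. (A2) If $s'$ is obtained from $s$ by inverting one of its cycles, of length $\ell$, then $w(s')=(-1)^{\ell}w(s)$. (A3) For even $m\ge2$, the value of $w$ on the standard cycle $1\mapsto2\mapsto\dots\mapsto m\mapsto1$ is $C_m$. (A4) (Recurrence Rule) Let $s\in S(m)$, $1\le r<m$. Let $s'$ be the conjugate of $s$ by the transposition $(r\ r{+}1)$. Let $V$ be a new letter, and order $(\{1,\dots,m\}\setminus\{r,r+1\})\cup\{V\}$ so that $V$ occupies the place of $r,r+1$. For a collection $c$ of cycles in the letters of the cycles of $s$ through $r$ and $r+1$, with $r,r+1$ deleted and $V$ added, let $w[c]$ be the value of $w$ on the permutation of this ordered set whose cycles are those in $c$ together with all cycles of $s$ containing neither $r$ nor $r+1$. (a) If $r,r+1$ lie in different cycles $(r\,P)$ and $(r{+}1\;Q)$ of $s$ ($P,Q$ possibly empty), and $a=|Q|$, then $$w(s)=w(s')+w[(V\,Q\,P)]-w[(V\,P\,Q)]+(-1)^{a}\bigl(w[(V\,P\,\overline{Q})]-w[(V\,\overline{Q}\,P)]\bigr).$$ (b) If $r,r+1$ lie in the same cycle $(r\,P\;r{+}1\;Q)$ with $Q$ nonempty and $a=|Q|$, then $$w(s)=w(s')+w[(P)(V\,Q)]-w[(V\,P)(Q)]+(-1)^{a}\bigl(w[(V\,P\,\overline{Q})]+w[(V\,\overline{Q}\,P)]\bigr),$$ where, if $P$ is empty, the empty cycle $(P)$ is interpreted as a factor $C_0$. (c) If $s(r+1)=r$, i.e. the cycle is $(r\,P\;r{+}1)$,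 then $w(s)=w(s')+(2-C_0)\,w[(V\,P)]$. **The Lie (super)algebras (over $\mathbb{C}$).** $E_{ij}$ are the matrix units, $U$ denotes the universal enveloping (super)algebra. *$\mathfrak{so}(N)$*: the Lie subalgebra of $\mathfrak{gl}(N)$ spanned by $X_{ij}=E_{ij}-E_{\bar j\bar i}$, $1\le i,j\le N$, where $\bar i=N+1-i$. For $s\in S(m)$, $$w_{\mathfrak{so}(N)}(s)=\sum_{i_1,\dots,i_m=1}^{N}X_{i_1i_{s(1)}}\cdots X_{i_mi_{s(m)}},\qquad C_k=\sum_{i_1,\dots,i_k=1}^{N}X_{i_1i_2}X_{i_2i_3}\cdots X_{i_ki_1}\ (k\ge1).$$ *$\mathfrak{sp}(2M)$*: the Lie subalgebra of $\mathfrak{gl}(2M)$ spanned by $X_{ij}=E_{ij}-\epsilon_i\epsilon_jE_{\bar j\bar i}$, $1\le i,j\le 2M$, where $\bar i=2M+1-i$, $\epsilon_i=1$ for $i\le M$ and $\epsilon_i=-1$ for $i>M$. For $s\in S(m)$ with $q$ cycles (fixed points included), $$w_{\mathfrak{sp}(2M)}(s)=(-1)^{m+q}\sum_{i_1,\dots,i_m=1}^{2M}X_{i_1i_{s(1)}}\cdots X_{i_mi_{s(m)}},\qquad C_k=(-1)^{k+1}\sum_{i_1,\dots,i_k=1}^{2M}X_{i_1i_2}\cdots X_{i_ki_1}\ (k\ge1).$$ *$\mathfrak{osp}(N|2M)$*: for $i\in\{1,\dots,N+2M\}$ put $\bar i=N+2M+1-i$; $\eta_i=0$ if $M+1\le i\le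 M+N$ and $\eta_i=1$ otherwise; $\epsilon_i=1$ if $i\le M+N$ and $\epsilon_i=-1$ if $i\ge N+M+1$. In $\mathfrak{gl}(N|2M)$ (matrices of size $N+2M$, $E_{ij}$ of parity $\eta_i+\eta_j$, with the supercommutator $[E_{ij},E_{kl}]=\delta_{kj}E_{il}-(-1)^{(\eta_i+\eta_j)(\eta_k+\eta_l)}\delta_{il}E_{kj}$), $\mathfrak{osp}(N|2M)$ is the Lie sub-superalgebra spanned by $X_{ij}=E_{ij}-(-1)^{\eta_i\eta_j}\epsilon_{\bar i}\epsilon_jE_{\bar j\bar i}$. For $s\in S(m)$ let $P_1=\{i: s(i)>i\}$ and let $P_2$ be the set of unordered pairs $\{i,j\}$, $i\neq j$, such that the pairs of real numbers $(i+\tfrac13,s(i)-\tfrac13)$ and $(j+\tfrac13,s(j)-\tfrac13)$ alternate on the real line. Put $$f_s(\tau_1,\dots,\tau_m)=\sum_{i\in P_1}\tau_{s(i)}+\sum_{\{i,j\}\in P_2}\tau_{s(i)}\tau_{s(j)},$$ $$w_{\mathfrak{osp}(N|2M)}(s)=\sum_{i_1,\dots,i_m=1}^{N+2M}(-1)^{f_s(\eta_{i_1},\dots,\eta_{i_m})}X_{i_1i_{s(1)}}\cdots X_{i_mi_{s(m)}},$$ $$C_k=\sum_{i_1,\dots,i_k=1}^{N+2M}(-1)^{\eta_{i_2}+\dots+\eta_{i_k}}X_{i_1i_2}X_{i_2i_3}\cdots X_{i_ki_1}\ (k\ge1).$$ *)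

(* Defs.v *)
From HB Require Import structures.
From mathcomp Require Import all_boot all_order all_fingroup all_algebra.
From mathcomp Require Import generic_quotient ring_quotient.
From mathcomp Require Import zify.
From mathcomp Require Import boolp reals complex.
From mathcomp.multinomials Require Import monalg.

Set Implicit Arguments.
Unset Strict Implicit.
Unset Printing Implicit Defensive.

Import GRing.Theory Num.Theory.

Local Open Scope ring_scope.
Local Open Scope quotient_scope.

(** Universal enveloping algebra [uea eta g] of a matrix Lie superalgebra:
    [eta] grades the standard basis of [F^n] ([true] = odd), so ['M[F]_n] is
    [gl(p|q)], and [g] is a subspace closed under the supercommutator.  For
    [eta] constantly [false] it is the ordinary enveloping algebra of a matrix
    Lie algebra.  It is the free algebra on the underlying set of [g] modulo
    the two-sided ideal [uea_ideal], which imposes linearity of the generators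
    and [x y - (-1)^(p q) y x = [x, y]] for [x], [y] homogeneous of parities
    [p], [q].  The zero matrix is homogeneous of both parities. *)

Section Enveloping.
Variables (F : fieldType) (n : nat) (eta : 'I_n -> bool) (g : {vspace 'M[F]_n}).

Definition mx_parity (p : bool) (x : 'M[F]_n) : Prop :=
  forall i j, x i j != 0 -> eta i (+) eta j = p.

Definition supercomm (p q : bool) (x y : 'M[F]_n) : 'M[F]_n :=
  x *m y - (-1) ^+ (p && q) *: (y *m x).

Notation free_alg := {malg F[{fmonom (subvs_of g)}]}.

Definition free_gen (x : subvs_of g) : free_alg := << fmu x >>.

Inductive uea_ideal : free_alg -> Prop :=
| UeaLin a x y :
    uea_ideal (free_gen (a *: x + y) - (a *: free_gen x + free_gen y))
| UeaBracket p q x y z :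
    mx_parity p (vsval x) -> mx_parity q (vsval y) ->
    vsval z = supercomm p q (vsval x) (vsval y) ->
    uea_ideal (free_gen x * free_gen y
               - (-1) ^+ (p && q) * (free_gen y * free_gen x) - free_gen z)
| UeaZero : uea_ideal 0
| UeaAdd u v : uea_ideal u -> uea_ideal v -> uea_ideal (u + v)
| UeaMull a u : uea_ideal u -> uea_ideal (a * u)
| UeaMulr a u : uea_ideal u -> uea_ideal (u * a).

Definition uea_idealb : {pred free_alg} := fun u => `[< uea_ideal u >].

Lemma uea_idealP u : reflect (uea_ideal u) (u \in uea_idealb).
Proof. exact: asboolP. Qed.

Lemma uea_ideal_zmod_closed : zmod_closed uea_idealb.
Proof.
split=> [|u v /uea_idealP Iu /uea_idealP Iv]; apply/uea_idealP.
  exact: UeaZero.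
by apply: UeaAdd => //; rewrite -mulN1r; apply: UeaMull.
Qed.

HB.instance Definition _ :=
  GRing.isZmodClosed.Build free_alg uea_idealb uea_ideal_zmod_closed.

Canonical uea_zmodClosed : zmodClosed free_alg :=
  GRing.ZmodClosed.clone _ uea_idealb _.

Definition uea : Type := Quotient.quot uea_zmodClosed.
HB.instance Definition _ := GRing.Zmodule.on uea.

Definition uea_pi (u : free_alg) : uea := \pi_(Quotient.quot uea_zmodClosed) u.

Lemma uea_piE u v : uea_pi u = uea_pi v <-> uea_ideal (u - v).
Proof.
rewrite (rwP (uea_idealP _)) (rwP eqP) -[_ \in _]/(u - v \in uea_zmodClosed).
by rewrite Quotient.idealrBE.
Qed.

Definition uea_repr (x : uea) : free_alg := repr (x : Quotient.quot uea_zmodClosed).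

Lemma uea_reprK : cancel uea_repr uea_pi. Proof. exact: reprK. Qed.

Lemma uea_pi_repr u : uea_ideal (uea_repr (uea_pi u) - u).
Proof. by apply/uea_piE; rewrite uea_reprK. Qed.

Lemma uea_piD u v : uea_pi (u + v) = uea_pi u + uea_pi v.
Proof. by rewrite /uea_pi [LHS]raddfD. Qed.

Definition uea_one : uea := uea_pi 1.
Definition uea_mul (x y : uea) : uea := uea_pi (uea_repr x * uea_repr y).
Definition uea_scale (a : F) (x : uea) : uea := uea_pi (a *: uea_repr x).

Lemma uea_piM u v : uea_pi (u * v) = uea_mul (uea_pi u) (uea_pi v).
Proof.
apply/esym/uea_piE; set u' := uea_repr _; set v' := uea_repr _.
have -> : u' * v' - u * v = (u' - u) * v' + u * (v' - v).
  by rewrite mulrBl mulrBr addrA subrK.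
by apply: UeaAdd; [apply: UeaMulr | apply: UeaMull]; apply: uea_pi_repr.
Qed.

Lemma uea_piZ a u : uea_pi (a *: u) = uea_scale a (uea_pi u).
Proof.
apply/esym/uea_piE; rewrite -scalerBr -[_ - _]mul1r scalerAl.
exact/UeaMull/uea_pi_repr.
Qed.

Lemma uea_ind (P : uea -> Prop) : (forall u, P (uea_pi u)) -> forall x, P x.
Proof. by move=> Ppi x; rewrite -(uea_reprK x). Qed.

Lemma uea_mulA : associative uea_mul.
Proof. by do 3!elim/uea_ind=> ?; rewrite -!uea_piM mulrA. Qed.

Lemma uea_mul1 : left_id uea_one uea_mul.
Proof. by elim/uea_ind=> u; rewrite -uea_piM mul1r. Qed.

Lemma uea_mulr1 : right_id uea_one uea_mul.
Proof. by elim/uea_ind=> u; rewrite -uea_piM mulr1. Qed.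

Lemma uea_mulDl : left_distributive uea_mul +%R.
Proof.
by do 3!elim/uea_ind=> ?; rewrite -uea_piD -!uea_piM mulrDl uea_piD.
Qed.

Lemma uea_mulDr : right_distributive uea_mul +%R.
Proof.
by do 3!elim/uea_ind=> ?; rewrite -uea_piD -!uea_piM mulrDr uea_piD.
Qed.

Lemma uea_ideal_coef1 u : uea_ideal u -> u@_(@mone {fmonom (subvs_of g)}) = 0.
Proof.
have gen0 x : (free_gen x)@_(@mone {fmonom (subvs_of g)}) = 0.
  by rewrite mcoeffU1; case: eqP => // /(congr1 (@fdeg _)); rewrite fdegU fdeg1.
elim=> {u} [a x y|p q x y z _ _ _||u v _ Iu _ Iv|a u _ Iu|a u _ Iu].
- by rewrite mcoeffB mcoeffD mcoeffZ !gen0 mulr0 addr0 subr0.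
- by rewrite !mcoeffB !rmorphM /= !gen0 !mulr0 !subr0.
- by rewrite mcoeff0.
- by rewrite mcoeffD Iu Iv addr0.
- by rewrite rmorphM /= Iu mulr0.
- by rewrite rmorphM /= Iu mul0r.
Qed.

Lemma uea_oner_neq0 : uea_one != 0.
Proof.
apply/eqP=> one0; have /uea_piE : uea_one = uea_pi 0 by rewrite one0 /uea_pi [RHS]raddf0.
by rewrite subr0 => /uea_ideal_coef1/eqP; rewrite rmorph1 oner_eq0.
Qed.

HB.instance Definition _ := GRing.Zmodule_isNzRing.Build uea
  uea_mulA uea_mul1 uea_mulr1 uea_mulDl uea_mulDr uea_oner_neq0.

Lemma uea_scaleA a b x : uea_scale a (uea_scale b x) = uea_scale (a * b) x.
Proof. by elim/uea_ind: x => u; rewrite -!uea_piZ scalerA. Qed.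

Lemma uea_scale1 : left_id 1 uea_scale.
Proof. by elim/uea_ind=> u; rewrite -uea_piZ scale1r. Qed.

Lemma uea_scaleDr : right_distributive uea_scale +%R.
Proof.
move=> a; do 2!elim/uea_ind=> ?.
by rewrite -uea_piD -!uea_piZ scalerDr uea_piD.
Qed.

Lemma uea_scaleDl x : {morph uea_scale^~ x : a b / a + b}.
Proof. by elim/uea_ind: x => u a b; rewrite -!uea_piZ scalerDl uea_piD. Qed.

HB.instance Definition _ := GRing.Zmodule_isLmodule.Build F uea
  uea_scaleA uea_scale1 uea_scaleDr uea_scaleDl.

Lemma uea_scaleAl a (x y : uea) : a *: (x * y) = (a *: x) * y.
Proof.
elim/uea_ind: x y => u; elim/uea_ind => v; rewrite -[_ * _]uea_piM.
rewrite -[LHS]uea_piZ -[a *: _]uea_piZ -[RHS]uea_piM.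
by rewrite scalerAl.
Qed.

HB.instance Definition _ := GRing.Lmodule_isLalgebra.Build F uea uea_scaleAl.

Lemma free_scaleAr a (u v : free_alg) : a *: (u * v) = u * (a *: v).
Proof.
rewrite -mul_malgC mulrA -[in RHS]mul_malgC mulrA; congr (_ * v).
rewrite mul_malgC malgM_def [RHS]fgmulgU malgZ_def; apply: eq_bigr => k _.
by rewrite mulm1 mulrC.
Qed.

Lemma uea_scaleAr a (x y : uea) : a *: (x * y) = x * (a *: y).
Proof.
elim/uea_ind: x y => u; elim/uea_ind => v; rewrite -[_ * _]uea_piM.
rewrite -[LHS]uea_piZ -[a *: _]uea_piZ -[RHS]uea_piM.
by rewrite free_scaleAr.
Qed.

HB.instance Definition _ := GRing.Lalgebra_isAlgebra.Build F uea uea_scaleAr.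

Definition uea_gen (x : subvs_of g) : uea := uea_pi (free_gen x).

(* The Z/2-grading of [uea] inherited from [g]; [false] is the even part. *)
Inductive uea_parity : bool -> uea -> Prop :=
| UeaParityGen p x : mx_parity p (vsval x) -> uea_parity p (uea_gen x)
| UeaParity1 : uea_parity false 1
| UeaParityZ p a u : uea_parity p u -> uea_parity p (a *: u)
| UeaParityD p u v : uea_parity p u -> uea_parity p v -> uea_parity p (u + v)
| UeaParityM p q u v :
    uea_parity p u -> uea_parity q v -> uea_parity (p (+) q) (u * v).

End Enveloping.

(** The symmetric group on [m] letters is ['S_m], acting on [0, ..., m - 1];
    all the indices below are accordingly 0-based. *)

Section Permutations.

Definition concat_fun m n (s : 'S_m) (t : 'S_n) (k : 'I_(m + n)) : 'I_(m + n) :=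
  match split k with
  | inl i => lshift n (s i)
  | inr j => rshift m (t j)
  end.

Lemma concat_fun_inj m n (s : 'S_m) (t : 'S_n) : injective (concat_fun s t).
Proof.
have E k : concat_fun s t k = unsplit (match split k with
    inl i => inl (s i) | inr j => inr (t j) end).
  by rewrite /concat_fun; case: (split k).
move=> k l; rewrite !E => /(can_inj (@unsplitK _ _)) eq_kl.
apply: (can_inj (@splitK m n)).
by case: (split k) (split l) eq_kl => [i|i] [j|j] // [] /perm_inj ->.
Qed.

Definition concat_perm m n (s : 'S_m) (t : 'S_n) : 'S_(m + n) :=
  perm (@concat_fun_inj m n s t).

Definition std_cycle m : 'S_m := perm (@ordS_inj m).

(* For [q = x1 ... xl], [(x1 x2 ... xl)] is a cycle of [s]. *)
Definition is_cycle (T : finType) (s : {perm T}) (q : seq T) : Prop :=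
  ufcycle s q.

Variable n : nat.
Implicit Types (s : 'S_n.+2) (r : 'I_n.+1) (k : 'I_n.+2).

Definition fst_letter r : 'I_n.+2 := widen_ord (leqnSn n.+1) r.
Definition snd_letter r : 'I_n.+2 := lift ord0 r.

(* The ordered set [({0, ..., n + 1} \ {r, r + 1}) U {V}] is identified with
   ['I_n.+1]: the new letter [V] is [r], letters below [r] are unchanged and
   letters above [r + 1] go down by one; [r] and [r + 1] are sent to [V]. *)
Definition collapse r k : 'I_n.+1 := inord (unbump r k).

Definition contract_fun s r (cs : seq (seq 'I_n.+1)) (x : 'I_n.+1) : 'I_n.+1 :=
  foldr (fun c y => if x \in c then next c x else y)
        (collapse r (s (lift (snd_letter r) x))) cs.

(* The permutation whose cycles are the words in [cs], together with the
   cycles of [s] containing neither [r] nor [r + 1].  The default value is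
   irrelevant when [cs] is made of pairwise disjoint words without repetition
   in [V] and the letters of the cycles of [s] through [r] and [r + 1]. *)
Definition contract s r (cs : seq (seq 'I_n.+1)) : 'S_n.+1 :=
  insubd (1%g : 'S_n.+1) (finfun (contract_fun s r cs)).

Lemma val_collapse r k : collapse r k = unbump r k :> nat.
Proof.
have rn := ltn_ord r; have kn := ltn_ord k.
by rewrite inordK //; rewrite /unbump; case: ltnP => /=; lia.
Qed.

Lemma collapse_inj r k l : k != snd_letter r -> l != snd_letter r ->
  collapse r k = collapse r l -> k = l.
Proof.
rewrite -!val_eqE /= => kr lr /(congr1 val) /=; rewrite !val_collapse => E.
apply: val_inj; move: kr lr E; rewrite /= /unbump /bump /= add1n.
by case: (ltngtP r k) => rk; case: (ltngtP r l) => rl; lia.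
Qed.

Lemma collapse_lift r x : collapse r (lift (snd_letter r) x) = x.
Proof.
apply: val_inj; rewrite /= val_collapse /= /unbump /bump /= add1n.
by move: (nat_of_ord x) => {x} x; case: (ltnP r x) => rx; case: ltnP => /=; lia.
Qed.

Lemma lift_collapse r k : k != snd_letter r ->
  lift (snd_letter r) (collapse r k) = k.
Proof.
move=> kr; apply: (@collapse_inj r) => //; last exact: collapse_lift.
by rewrite eq_sym neq_lift.
Qed.

Lemma contract_fun_out s r cs x : x \notin flatten cs ->
  contract_fun s r cs x = collapse r (s (lift (snd_letter r) x)).
Proof.
rewrite /contract_fun; elim: cs => //= c cs IH.
by rewrite mem_cat negb_or => /andP[/negPf-> /IH].
Qed.

Lemma contract_fun_in s r cs x : x \in flatten cs ->
  exists c, [/\ c \in cs, x \in c & contract_fun s r cs x = next c x].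
Proof.
rewrite /contract_fun; elim: cs => //= c cs IH; rewrite mem_cat.
case: ifP => [xc _|_ /IH[d [dcs xd ->]]].
  by exists c; rewrite mem_head.
by exists d; rewrite inE dcs orbT.
Qed.

Lemma uniq_flatten_inj (T : eqType) (cs : seq (seq T)) c d x :
  uniq (flatten cs) -> c \in cs -> d \in cs -> x \in c -> x \in d -> c = d.
Proof.
elim: cs => //= a cs IH; rewrite cat_uniq => /and3P[_ /hasPn disj uf].
have out e : e \in cs -> x \in e -> x \notin a.
  by move=> ecs xe; apply/disj/flattenP; exists e.
rewrite !inE => /predU1P[->|ccs] /predU1P[->|dcs] // xc xd.
- by have := out _ dcs xd; rewrite xc.
- by have := out _ ccs xc; rewrite xd.
- exact: IH.
Qed.

Lemma contractE s r cs :
    uniq (flatten cs) ->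
    (forall k, (collapse r k \in flatten cs) =
       (k \in porbit s (fst_letter r)) || (k \in porbit s (snd_letter r))) ->
  contract s r cs =1 contract_fun s r cs.
Proof.
move=> ucs csE; set f := contract_fun s r cs.
have sE k : (collapse r (s k) \in flatten cs) = (collapse r k \in flatten cs).
  have sk : porbit s (s k) = porbit s k by rewrite -[RHS](porbit_perm s 1 k).
  by rewrite !csE -!eq_porbit_mem sk.
have fE x : (f x \in flatten cs) = (x \in flatten cs).
  case: (boolP (x \in flatten cs)) => [xcs|xcs].
    have [c [ccs xc fx]] := contract_fun_in s r xcs.
    by rewrite /f fx; apply/flattenP; exists c; rewrite ?mem_next.
  by rewrite /f contract_fun_out // sE collapse_lift (negPf xcs).
suff f_inj : injective f.
  have fP : injectiveb (finfun f).
    by apply/injectiveP=> x y; rewrite !ffunE => /f_inj.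
  by move=> x; rewrite /contract -pvalE val_insubd fP ffunE.
move=> x y fxy; have := fE x; rewrite fxy fE => xycs.
case: (boolP (x \in flatten cs)) => xcs; last first.
  have out z : z \notin flatten cs -> s (lift (snd_letter r) z) != snd_letter r.
    apply: contraNneq => sz; rewrite -(collapse_lift r z) -sE sz csE porbit_id.
    by rewrite orbT.
  have ycs : y \notin flatten cs by rewrite xycs.
  move: fxy; rewrite /f !contract_fun_out // => /collapse_inj.
  by move=> /(_ (out _ xcs) (out _ ycs))/perm_inj/lift_inj.
have ycs : y \in flatten cs by rewrite xycs.
have [c [ccs xc fx]] := contract_fun_in s r xcs.
have [d [dcs yd fy]] := contract_fun_in s r ycs.
rewrite /f fx fy in fxy.
have cd : c = d.
  apply: (uniq_flatten_inj ucs ccs dcs (x := next c x)).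
    by rewrite mem_next.
  by rewrite fxy mem_next.
subst d; have uc : uniq c.
  elim: cs ucs ccs {csE f sE fE fx fy dcs xcs ycs xycs fxy} => //= a l IH; rewrite cat_uniq inE.
  by case/and3P=> ua _ ul /predU1P[->|/IH->].
exact: (can_inj (prev_next uc)) fxy.
Qed.

End Permutations.

Section SoRelations.
Variables (R : nzRingType) (w : forall m, 'S_m -> R) (C : nat -> R).

(* [R] need not be commutative: the values of interest are central elements
   of an enveloping algebra. *)
Record so_relations : Prop := SoRelations {
  so_empty : w (1%g : 'S_0) = 1;
  so_concat m n (s : 'S_m) (t : 'S_n) : w (concat_perm s t) = w s * w t;
  so_invert m (s s' : 'S_m) (a : 'I_m) :
    (forall k, s' k = if k \in porbit s a then (s^-1)%g k else s k) ->
    w s' = (-1) ^+ #|porbit s a| * w s;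
  so_std_cycle m : (2 <= m)%N -> ~~ odd m -> w (std_cycle m) = C m;
  so_rec_distinct n (s : 'S_n.+2) (r : 'I_n.+1) (P Q : seq 'I_n.+2) :
    let r1 := fst_letter r in
    let r2 := snd_letter r in
    is_cycle s (r1 :: P) -> is_cycle s (r2 :: Q) -> r2 \notin r1 :: P ->
    let p := map (collapse r) P in
    let q := map (collapse r) Q in
    let w_ cs := w (contract s r cs) in
    w s = w (s ^ tperm r1 r2)%g
          + w_ [:: r :: q ++ p] - w_ [:: r :: p ++ q]
          + (-1) ^+ size Q *
              (w_ [:: r :: p ++ rev q] - w_ [:: r :: rev q ++ p]);
  so_rec_same n (s : 'S_n.+2) (r : 'I_n.+1) (P Q : seq 'I_n.+2) :
    let r1 := fst_letter r in
    let r2 := snd_letter r in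
    is_cycle s (r1 :: P ++ r2 :: Q) -> Q != [::] ->
    let p := map (collapse r) P in
    let q := map (collapse r) Q in
    let w_ cs := w (contract s r cs) in
    w s = w (s ^ tperm r1 r2)%g
          + (if P is [::] then C 0 * w_ [:: r :: q] else w_ [:: p; r :: q])
          - w_ [:: r :: p; q]
          + (-1) ^+ size Q *
              (w_ [:: r :: p ++ rev q] + w_ [:: r :: rev q ++ p]);
  so_rec_adjacent n (s : 'S_n.+2) (r : 'I_n.+1) (P : seq 'I_n.+2) :
    let r1 := fst_letter r in
    let r2 := snd_letter r in
    is_cycle s (r1 :: P ++ [:: r2]) ->
    let p := map (collapse r) P in
    w s = w (s ^ tperm r1 r2)%g
          + (2%:R - C 0) * w (contract s r [:: r :: p])
}.

End SoRelations.

Section MatrixSpan.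
Variables (F : fieldType) (n : nat) (X : 'I_n -> 'I_n -> 'M[F]_n).

Definition mx_span : {vspace 'M[F]_n} :=
  <<codom (fun ij : 'I_n * 'I_n => X ij.1 ij.2)>>%VS.

Lemma mem_mx_span i j : X i j \in mx_span.
Proof. exact/memv_span/(codom_f _ (i, j)). Qed.

Definition span_gen i j : subvs_of mx_span := Subvs (mem_mx_span i j).

End MatrixSpan.

Section Families.
Variable F : fieldType.

Section So.
Variable N : nat.

(* With 0-based indices the bar involution is [rev_ord]. *)
Definition so_mx (i j : 'I_N) : 'M[F]_N :=
  delta_mx i j - delta_mx (rev_ord j) (rev_ord i).

Definition so_eta (i : 'I_N) : bool := false.

Definition Uso := uea so_eta (mx_span so_mx).
HB.instance Definition _ := GRing.Algebra.on Uso.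

Definition so_gen (i j : 'I_N) : Uso := uea_gen so_eta (span_gen so_mx i j).

Definition w_so m (s : 'S_m) : Uso :=
  \sum_(i : {ffun 'I_m -> 'I_N}) \prod_(k < m) so_gen (i k) (i (s k)).

Definition casimir_so (k : nat) : Uso :=
  if k is 0 then N%:R else
  \sum_(i : {ffun 'I_k -> 'I_N}) \prod_(l < k) so_gen (i l) (i (ordS l)).

End So.

Section Sp.
Variable M : nat.

Definition sp_eps (i : 'I_(2 * M)) : F := if (i < M)%N then 1 else -1.

Definition sp_mx (i j : 'I_(2 * M)) : 'M[F]_(2 * M) :=
  delta_mx i j - (sp_eps i * sp_eps j) *: delta_mx (rev_ord j) (rev_ord i).

Definition sp_eta (i : 'I_(2 * M)) : bool := false.

Definition Usp := uea sp_eta (mx_span sp_mx).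
HB.instance Definition _ := GRing.Algebra.on Usp.

Definition sp_gen (i j : 'I_(2 * M)) : Usp :=
  uea_gen sp_eta (span_gen sp_mx i j).

Definition w_sp m (s : 'S_m) : Usp :=
  (-1) ^+ (m + #|porbits s|) *
  \sum_(i : {ffun 'I_m -> 'I_(2 * M)}) \prod_(k < m) sp_gen (i k) (i (s k)).

Definition casimir_sp (k : nat) : Usp :=
  if k is 0 then - (2 * M)%:R else
  (-1) ^+ k.+1 *
  \sum_(i : {ffun 'I_k -> 'I_(2 * M)}) \prod_(l < k) sp_gen (i l) (i (ordS l)).

End Sp.

(* The endpoints of two different chords never coincide. *)
Definition strictly_between (ab : rat * rat) (x : rat) : bool :=
  (Order.min ab.1 ab.2 < x) && (x < Order.max ab.1 ab.2).

Definition alternate (ab cd : rat * rat) : bool :=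
  strictly_between ab cd.1 (+) strictly_between ab cd.2.

Definition chord m (s : 'S_m) (i : 'I_m) : rat * rat :=
  (i%:R + 1 / 3%:R, (s i)%:R - 1 / 3%:R).

(* The 0-based numbering shifts all chords by [-1], which does not affect
   alternation.  An unordered pair is represented by [i < j]. *)
Definition sign_exp m (s : 'S_m) (tau : 'I_m -> nat) : nat :=
  (\sum_(i < m | i < s i) tau (s i) +
   \sum_(ij : 'I_m * 'I_m | (ij.1 < ij.2) &&
                            alternate (chord s ij.1) (chord s ij.2))
      tau (s ij.1) * tau (s ij.2))%N.

Section Osp.
Variables N M : nat.

Definition osp_eta (i : 'I_(N + 2 * M)) : bool := ~~ ((M <= i) && (i < M + N))%N.

Definition osp_eps (i : 'I_(N + 2 * M)) : F := if (i < M + N)%N then 1 else -1.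

Definition osp_mx (i j : 'I_(N + 2 * M)) : 'M[F]_(N + 2 * M) :=
  delta_mx i j -
  ((-1) ^+ (osp_eta i * osp_eta j) * osp_eps (rev_ord i) * osp_eps j) *:
    delta_mx (rev_ord j) (rev_ord i).

Definition Uosp := uea osp_eta (mx_span osp_mx).
HB.instance Definition _ := GRing.Algebra.on Uosp.

Definition osp_gen (i j : 'I_(N + 2 * M)) : Uosp :=
  uea_gen osp_eta (span_gen osp_mx i j).

Definition w_osp m (s : 'S_m) : Uosp :=
  \sum_(i : {ffun 'I_m -> 'I_(N + 2 * M)})
    (-1) ^+ sign_exp s (fun k => osp_eta (i k)) *
    \prod_(k < m) osp_gen (i k) (i (s k)).

Definition casimir_osp (k : nat) : Uosp :=
  if k is 0 then N%:R - (2 * M)%:R else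
  \sum_(i : {ffun 'I_k -> 'I_(N + 2 * M)})
    (-1) ^+ (\sum_(l < k | 0 < l) osp_eta (i l))%N *
    \prod_(l < k) osp_gen (i l) (i (ordS l)).

End Osp.
End Families.

Definition central (R : nzRingType) (z : R) : Prop := forall x, z * x = x * z.

(* Main.v *)
Require Import Defs.
From mathcomp Require Import all_boot all_order all_fingroup all_algebra.
From mathcomp Require Import boolp reals complex.
From mathcomp Require Import zify ring lra.
From mathcomp.multinomials Require Import monalg.

(** A permutation [s] is the perfect matching of the half-edges of its letters
that joins the right half-edge of [k] to the left half-edge of [s k].  If the
second index of the generators is raised by the invariant form, [X] becomes
super-antisymmetric, and each [w(s)] is a sum over the labellings of the
half-edges, matched half-edges carrying dual labels; its sign counts the
crossings of wires with odd labels.  Such a sum makes sense for any matching of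
the half-edges, not only for those coming from permutations.

Exchanging the two half-edges of a letter multiplies the sum by [-1] by
antisymmetry, which gives (A2).  Exchanging the letters [r] and [r + 1] produces
the supercommutator of two generators, a sum of four terms that differ by flips
of [r] and [r + 1]; in each of them the inner half-edges of the two letters are
glued, which merges the letters into one.  Because the crossing parity is
additive in each wire, gluing is compatible with the signs, a closed loop
contributes [C_0], and reading off the four matchings gives (A4).

For centrality, commuting a generator through the sum relabels one half-edge at
a time, and the terms for the two ends of a wire cancel.

[osp(N|2M)] is the general case; [so(N)] and [sp(2M)] are the cases where all
indices are even, respectively all indices count as odd.  In the latter case the
crossing sign of [s] is the sign of the permutation, that is,
[(-1)^(m + number of cycles)]. *)

Set Implicit Arguments.
Unset Strict Implicit.
Unset Printing Implicit Defensive.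

Import GRing.Theory.

(** * Wires and their signs *)

(** The form that raises the second index is skew on odd labels, so the sign of an odd wire depends
    on its direction. All wires are therefore read from left to right, and this convention is the
    source of the linear part of f_s: after raising, the signs of the form cancel except on the
    wires with k < s(k). The signs stay manageable because any rearrangement of the half-edges
    changes the sign of a matching by the Koszul sign of the odd labels that it inverts. For the
    exchange of two letters this is the sign in the supercommutator; for the exchange of the two
    half-edges of one letter it is the sign in the antisymmetry of the generators. The constant 2 -
    C_0 of (A4)(c) comes from the same four terms as the rest of (A4): each single flip contributes
    1, the double flip closes a loop, and the unflipped term carries a letter whose two half-edges
    are joined to each other. That term is its own opposite and vanishes because 2 is invertible. *)

Section Wires.

Variables (T : eqType) (pos : T -> nat).
Implicit Types (x y z : T) (v w : T * T) (ws : seq (T * T)).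

Definition ends ws : seq T := flatten [seq [:: w.1; w.2] | w <- ws].

Definition swap_ends w : T * T := (w.2, w.1).

Definition orient w : T * T := if pos w.1 <= pos w.2 then w else swap_ends w.

(** Equality of matchings: neither the order of the list nor the direction of a wire is part of the
    data. *)
Definition eqw ws ws' := perm_eq (map orient ws) (map orient ws').

Definition map_wire (S S' : Type) (f : S -> S') (w : S * S) := (f w.1, f w.2).

(* For disjoint wires: whether the four endpoints alternate.  In this form it is
   additive when two wires are joined end to end. *)
Definition alt v w : bool :=
  (pos v.1 < pos w.1) (+) (pos v.1 < pos w.2) (+)
  ((pos v.2 < pos w.1) (+) (pos v.2 < pos w.2)).

Lemma ends_cat ws ws' : ends (ws ++ ws') = ends ws ++ ends ws'.
Proof. by rewrite /ends map_cat flatten_cat. Qed.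

Lemma eqw_refl ws : eqw ws ws. Proof. exact: perm_refl. Qed.

Lemma eqw_sym ws ws' : eqw ws ws' = eqw ws' ws. Proof. exact: perm_sym. Qed.

Lemma eqw_trans ws2 ws1 ws3 : eqw ws1 ws2 -> eqw ws2 ws3 -> eqw ws1 ws3.
Proof. exact: perm_trans. Qed.

Lemma perm_eqw ws ws' : perm_eq ws ws' -> eqw ws ws'.
Proof. exact: perm_map. Qed.

Lemma eqw_cat ws1 ws2 ws1' ws2' :
  eqw ws1 ws1' -> eqw ws2 ws2' -> eqw (ws1 ++ ws2) (ws1' ++ ws2').
Proof. by rewrite /eqw !map_cat; apply: perm_cat. Qed.

Hypothesis pos_inj : injective pos.

Lemma orient_swap w : orient (swap_ends w) = orient w.
Proof.
rewrite /orient /swap_ends; case: w => x y /=.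
case: (ltngtP (pos x) (pos y)) => //= /pos_inj-> //.
Qed.

Lemma eqw_swap w ws : eqw (w :: ws) (swap_ends w :: ws).
Proof. by rewrite /eqw /= orient_swap. Qed.

Lemma perm_ends_orient ws : perm_eq (ends (map orient ws)) (ends ws).
Proof.
elim: ws => //= w ws IH.
rewrite -[ends (_ :: _)]/([:: _; _] ++ ends _) -[ends (w :: _)]/([:: _; _] ++ ends _).
apply: perm_cat IH; rewrite /orient; case: ifP => // _.
by rewrite (perm_catC [:: w.2] [:: w.1]).
Qed.

Lemma perm_ends ws ws' : perm_eq ws ws' -> perm_eq (ends ws) (ends ws').
Proof. by move=> eq_ws; apply/perm_flatten/perm_map. Qed.

Lemma eqw_ends ws ws' : eqw ws ws' -> perm_eq (ends ws) (ends ws').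
Proof.
move=> /perm_ends; rewrite (permPl (perm_ends_orient _)).
by rewrite perm_sym (permPl (perm_ends_orient _)) perm_sym.
Qed.

Lemma alt_sym v w : uniq [:: v.1; v.2; w.1; w.2] -> alt v w = alt w v.
Proof.
case: v w => a b [x y] /=; rewrite !inE !negb_or /alt /=.
case/and4P=> /and3P[ab ax ay] /andP[bx by_] xy _.
have neg u t : u != t -> (pos u < pos t) = ~~ (pos t < pos u).
  by move=> ut; rewrite -leqNgt ltn_neqAle (inj_eq pos_inj) ut.
rewrite (neg a x ax) (neg a y ay) (neg b x bx) (neg b y by_).
by do 4!case: (pos _ < pos _).
Qed.

End Wires.

Section MapWires.
Variables (S T : eqType) (posS : S -> nat) (posT : T -> nat) (f : S -> T).

Lemma ends_map ws : ends (map (map_wire f) ws) = map f (ends ws).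
Proof. by elim: ws => //= w ws IH; rewrite -[LHS]/[:: _, _ & ends _] IH. Qed.

Lemma eqw_map ws ws' : injective posT ->
  eqw posS ws ws' -> eqw posT (map (map_wire f) ws) (map (map_wire f) ws').
Proof.
move=> posT_inj /(perm_map (orient posT \o map_wire f)); rewrite /eqw.
suff E us : [seq (orient posT \o map_wire f) i | i <- map (orient posS) us] =
    map (orient posT) (map (map_wire f) us) by rewrite !E.
rewrite -!map_comp; apply: eq_map => w /=; rewrite {2}/orient.
by case: ifP => //= _; rewrite -[map_wire f _]/(swap_ends (map_wire f w)) orient_swap.
Qed.

End MapWires.

(** * Signs of labelled matchings *)

Section Signs.
Variables (I : finType) (bar : I -> I) (eta e : I -> bool).
Hypotheses (barK : involutive bar) (eta_bar : forall a, eta (bar a) = eta a).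
Hypothesis e_bar : forall a, e (bar a) = e a (+) eta a.

Section Fixed.
Variables (T : eqType) (pos : T -> nat).
Implicit Types (c : T -> I) (x y z : T) (v w : T * T) (ws : seq (T * T)).

Definition paired c w := c w.2 == bar (c w.1).

Definition admissible c ws := all (paired c) ws.

Definition wire_sg c w := e (c (orient pos w).1).

(** Matched labels have the same parity, so the label at one end decides whether a wire is odd. *)
Definition cross c v w := alt pos v w && (eta (c v.1) && eta (c w.1)).

Definition crosses c w ws := \big[addb/false]_(v <- ws) cross c w v.

Fixpoint wires_sign c ws : bool :=
  if ws is w :: ws' then wire_sg c w (+) crosses c w ws' (+) wires_sign c ws' else false.

Lemma paired_sym c w : paired c (swap_ends w) = paired c w.
Proof. by rewrite /paired /=; apply/eqP/eqP=> ->; rewrite barK. Qed.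

Lemma paired_eta c w : paired c w -> eta (c w.2) = eta (c w.1).
Proof. by move/eqP->. Qed.

Lemma paired_orient c w : paired c (orient pos w) = paired c w.
Proof. by rewrite /orient; case: ifP => // _; apply: paired_sym. Qed.

Lemma admissible_orient c ws : admissible c (map (orient pos) ws) = admissible c ws.
Proof. by rewrite /admissible all_map; apply: eq_all => w /=; rewrite paired_orient. Qed.

Lemma admissible_eqw c ws ws' : eqw pos ws ws' -> admissible c ws = admissible c ws'.
Proof. by move/perm_all=> E;
  rewrite -admissible_orient -[RHS]admissible_orient /admissible E. Qed.

Lemma eq_wires_sign c c' ws : {in ends ws, c =1 c'} -> wires_sign c ws = wires_sign c' ws.
Proof.
elim: ws => //= w ws IH cc'.
have c1 : c w.1 = c' w.1 by apply: cc'; rewrite !inE eqxx.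
have c2 : c w.2 = c' w.2 by apply: cc'; rewrite !inE eqxx orbT.
rewrite IH; last by move=> x xws; apply: cc'; rewrite !inE xws !orbT.
congr (_ (+) _ (+) _); first by rewrite /wire_sg /orient; case: ifP; rewrite /= ?c1 ?c2.
apply: eq_big_seq => v vws; rewrite /cross c1 cc' // !inE.
by apply/orP; right; apply/orP; right; apply/flatten_mapP; exists v; rewrite // inE eqxx.
Qed.

Lemma eq_admissible c c' ws : {in ends ws, c =1 c'} -> admissible c ws = admissible c' ws.
Proof.
elim: ws => //= w ws IH cc'; rewrite IH => [|x xws]; last first.
  by apply: cc'; rewrite !inE xws !orbT.
by rewrite /paired !cc' // !inE eqxx ?orbT.
Qed.

Hypothesis pos_inj : injective pos.

Lemma wire_sg_orient c w : wire_sg c (orient pos w) = wire_sg c w.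
Proof.
rewrite /wire_sg {2}/orient; case: ifP => ww; last by rewrite orient_swap.
by [].
Qed.

Lemma cross_orientl c v w : paired c v -> cross c (orient pos v) w = cross c v w.
Proof.
rewrite /cross /orient => /paired_eta; case: ifP => //= _ ->.
rewrite /alt /=; congr (_ && _).
by do 4!case: (pos _ < pos _).
Qed.

Lemma cross_orientr c v w : paired c w -> cross c v (orient pos w) = cross c v w.
Proof.
rewrite /cross /orient => /paired_eta; case: ifP => //= _ ->.
rewrite /alt /=; congr (_ && _).
by do 4!case: (pos _ < pos _).
Qed.

Lemma wires_sign_orient c ws : admissible c ws -> wires_sign c (map (orient pos) ws) =
  wires_sign c ws.
Proof.
elim: ws => //= w ws IH /andP[cw cws]; rewrite IH // wire_sg_orient.
congr (_ (+) _ (+) _); rewrite /crosses big_map; apply: eq_big_seq => v vws.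
by rewrite cross_orientl // cross_orientr // (allP cws).
Qed.

Lemma crosses_cons c w v ws : crosses c w (v :: ws) = cross c w v (+) crosses c w ws.
Proof. by rewrite /crosses big_cons. Qed.

Lemma perm_crosses c w ws ws' :
  perm_eq ws ws' -> crosses c w ws = crosses c w ws'.
Proof. by move=> eq_ws; apply: perm_big. Qed.

Lemma uniq_ends_pair v w ws : uniq (ends (v :: ws)) -> w \in ws ->
  uniq [:: v.1; v.2; w.1; w.2].
Proof.
move=> uv /perm_to_rem pw.
have: uniq (ends (v :: w :: rem w ws)).
  by rewrite -(perm_uniq (perm_ends (_ : perm_eq (v :: ws) _))) // perm_cons.
by rewrite -[ends _]/([:: v.1; v.2; w.1; w.2] ++ _) cat_uniq => /andP[].
Qed.

Lemma cross_sym c v w : uniq [:: v.1; v.2; w.1; w.2] -> cross c v w = cross c w v.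
Proof. by move=> u4; rewrite /cross alt_sym // [eta _ && _]andbC. Qed.

Lemma wires_sign_rem c w ws : uniq (ends ws) -> w \in ws ->
  wires_sign c ws = wires_sign c (w :: rem w ws).
Proof.
elim: ws => // v ws IH uv; rewrite inE => /predU1P[<-|wws]; first by rewrite /= eqxx.
have u4 := uniq_ends_pair uv wws.
have /negPf vw : v != w.
  by apply/eqP=> vw; move: u4; rewrite vw /= !inE eqxx !orbT.
have uws : uniq (ends ws) by move: uv => /= /and3P[].
rewrite [wires_sign c (v :: ws)]/= (IH uws wws) [rem w (v :: ws)]/= vw [in RHS]/=.
rewrite (perm_crosses c v (perm_to_rem wws)) !crosses_cons (cross_sym c u4).
rewrite [wires_sign c (w :: _)]/=.
move: (crosses c v _) (crosses c w _) (wire_sg c v) (wire_sg c w) (cross c w v) (wires_sign c _).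
by do 6!case.
Qed.

Lemma wires_sign_perm c ws ws' : uniq (ends ws) -> perm_eq ws ws' -> wires_sign c ws =
  wires_sign c ws'.
Proof.
elim: ws ws' => [|w ws IH] ws' uws eq_ws.
  by move: eq_ws; rewrite perm_sym => /perm_nilP->.
have wws' : w \in ws' by rewrite -(perm_mem eq_ws) mem_head.
have eq_rem : perm_eq ws (rem w ws').
  by rewrite -(perm_cons w) (permPl eq_ws) perm_to_rem.
rewrite (wires_sign_rem c _ wws') -?(perm_uniq (perm_ends eq_ws)) //.
rewrite /= (perm_crosses c w eq_rem) (IH (rem w ws')) //.
by move: uws => /= /and3P[].
Qed.

Lemma wires_sign_eqw c ws ws' :
  uniq (ends ws) -> admissible c ws -> eqw pos ws ws' -> wires_sign c ws = wires_sign c ws'.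
Proof.
move=> uws okws eq_ws; have okws' : admissible c ws' by rewrite -(admissible_eqw c eq_ws).
rewrite -wires_sign_orient // -[RHS]wires_sign_orient //; apply: wires_sign_perm => //.
by rewrite (perm_uniq (perm_ends_orient _ _)).
Qed.

End Fixed.
End Signs.

(** * Koszul signs of rearrangements *)

Section Koszul.
Variables (S : eqType) (g : S -> S -> bool) (p : S -> bool).

(** The Koszul sign of a rearrangement: [g] tells which pairs it inverts, [p] which elements are
    odd, and only inverted pairs of odd elements count. *)
Fixpoint koszul (xs : seq S) : bool :=
  if xs is x :: xs' then
    \big[addb/false]_(y <- xs') (g x y && (p x && p y)) (+) koszul xs'
  else false.

Lemma koszul_rem xs x : symmetric g -> x \in xs -> koszul xs = koszul (x :: rem x xs).
Proof.
move=> gC; elim: xs => // y xs IH; rewrite inE => /predU1P[<-|xxs]; first by rewrite /= eqxx.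
have [-> | /negPf yx] := eqVneq y x; first by rewrite /= eqxx.
rewrite [LHS]/= (IH xxs) /= yx /= (perm_big _ (perm_to_rem xxs)) !big_cons (gC y) (andbC (p y)).
move: (koszul _) (g x y && _) (\big[_/_]_(_ <- rem x xs) _) (\big[_/_]_(_ <- rem x xs) _).
by do 4!case.
Qed.

Lemma perm_koszul xs ys : symmetric g -> perm_eq xs ys -> koszul xs = koszul ys.
Proof.
move=> gC; elim: xs ys => [|x xs IH] ys eq_xs.
  by move: eq_xs; rewrite perm_sym => /perm_nilP->.
have xys : x \in ys by rewrite -(perm_mem eq_xs) mem_head.
have eq_rem : perm_eq xs (rem x ys).
  by rewrite -(perm_cons x) (permPl eq_xs) perm_to_rem.
by rewrite (koszul_rem gC xys) /= (IH _ eq_rem) (perm_big _ eq_rem).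
Qed.

Lemma koszul0 xs : {in xs &, forall x y, g x y = false} -> koszul xs = false.
Proof.
elim: xs => //= x xs IH g0; rewrite IH => [|y z yxs zxs]; last first.
  by apply: g0; rewrite inE ?yxs ?zxs orbT.
by rewrite addbF big1_seq // => y /andP[_ yxs]; rewrite g0 ?inE ?eqxx ?yxs ?orbT.
Qed.

Lemma koszul_sum0 x xs : {in xs, forall y, g x y = false} ->
  \big[addb/false]_(y <- xs) (g x y && (p x && p y)) = false.
Proof. by move=> g0; rewrite big1_seq // => y /andP[_ yxs]; rewrite g0. Qed.

End Koszul.

Section SignMap.
Variables (I : finType) (bar : I -> I) (eta e : I -> bool).
Hypotheses (barK : involutive bar) (eta_bar : forall a, eta (bar a) = eta a).
Hypothesis e_bar : forall a, e (bar a) = e a (+) eta a.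
Variables (S T : eqType) (posS : S -> nat) (posT : T -> nat) (f : S -> T).
Hypotheses (posS_inj : injective posS) (posT_inj : injective posT).
Hypothesis f_inj : injective f.

Definition inverts (x y : S) : bool := (posS x < posS y) (+) (posT (f x) < posT (f y)).

Lemma inverts_sym : symmetric inverts.
Proof.
move=> x y; rewrite /inverts; have [-> //|xy] := eqVneq x y.
have fxy : f x != f y by rewrite (inj_eq f_inj).
have neg u t : posS u != posS t -> (posS u < posS t) = ~~ (posS t < posS u).
  by move=> ut; rewrite -leqNgt ltn_neqAle ut.
have negT u t : posT u != posT t -> (posT u < posT t) = ~~ (posT t < posT u).
  by move=> ut; rewrite -leqNgt ltn_neqAle ut.
rewrite (neg x y) ?(inj_eq posS_inj) // (negT (f x)) ?(inj_eq posT_inj) //.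
by do 2!case: (_ < _).
Qed.

Lemma admissible_map (c : T -> I) ws : admissible bar c (map (map_wire f) ws) =
  admissible bar (c \o f) ws.
Proof. by rewrite /admissible all_map; apply: eq_all. Qed.

(** If [f] reverses the two ends of a wire, the label at its left end changes from [a] to [bar a],
    and [e_bar] turns this into the parity of [a]. *)
Lemma wire_sg_map (c : T -> I) w : paired bar (c \o f) w ->
  wire_sg e posT c (map_wire f w) =
    wire_sg e posS (c \o f) w (+) (inverts w.1 w.2 && (eta (c (f w.1)) && eta (c (f w.2)))).
Proof.
case: w => x y /eqP /= cy; rewrite /wire_sg /orient /inverts /=.
have [-> //|xy] := eqVneq x y; first by rewrite !ltnn !leqnn /= addbF.
have neq (U : eqType) (pos : U -> nat) u t : injective pos -> u != t ->
    (pos u <= pos t) = (pos u < pos t).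
  by move=> pI ut; rewrite leq_eqVlt (inj_eq pI) (negPf ut).
rewrite !neq ?(inj_eq f_inj) // cy !eta_bar andbb.
by do 2!case: ifP => _; rewrite /= ?cy ?e_bar ?addbF // -?addbA ?addbb ?addbF.
Qed.

(** [alt] is a sum of four comparisons of positions, and a comparison changes exactly when [f]
    inverts that pair. *)
Lemma cross_map (c : T -> I) v w : paired bar (c \o f) v -> paired bar (c \o f) w ->
  let p x := eta (c (f x)) in
  cross eta posT c (map_wire f v) (map_wire f w) =
    cross eta posS (c \o f) v w (+)
    ((inverts v.1 w.1 && (p v.1 && p w.1)) (+) (inverts v.1 w.2 && (p v.1 && p w.2)) (+)
     ((inverts v.2 w.1 && (p v.2 && p w.1)) (+) (inverts v.2 w.2 && (p v.2 && p w.2)))).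
Proof.
case: v w => x y [z t] /eqP /= cy /eqP /= ct; rewrite /cross /alt /inverts /=.
rewrite cy ct !eta_bar; case: (eta (c (f x)) && eta (c (f z))); rewrite ?andbF // !andbT.
move: (posT _ < _) (posT _ < _) (posT _ < _) (posT _ < _).
move: (posS _ < _) (posS _ < _) (posS _ < _) (posS _ < _).
by do 8!case.
Qed.

(** Two half-edges lie either on one wire, where inverting them affects its direction, or on two
    wires, where it affects their crossing. Together these changes run once over all pairs of
    half-edges, which is the Koszul sign. *)
Lemma wires_sign_map (c : T -> I) ws : admissible bar (c \o f) ws ->
  wires_sign eta e posT c (map (map_wire f) ws) =
    wires_sign eta e posS (c \o f) ws (+) koszul inverts (eta \o c \o f) (ends ws).
Proof.
elim: ws => //= w ws IH /andP[cw cws]; rewrite IH // wire_sg_map //.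
set p := eta \o c \o f.
have -> : crosses eta posT c (map_wire f w) (map (map_wire f) ws) =
    crosses eta posS (c \o f) w ws (+)
    (\big[addb/false]_(y <- ends ws) (inverts w.1 y && (p w.1 && p y)) (+)
     \big[addb/false]_(y <- ends ws) (inverts w.2 y && (p w.2 && p y))).
  elim: ws cws {IH} => [|v ws IH] /=; first by rewrite /crosses /ends !big_nil.
  case/andP=> cv cws; rewrite !crosses_cons cross_map // IH // {IH}.
  rewrite !big_cons /p /= -/(ends ws).
  set b1 := inverts _ _ && _; set b2 := inverts _ _ && _.
  set b3 := inverts _ _ && _; set b4 := inverts _ _ && _.
  move: b1 b2 b3 b4 (cross _ _ _ _ _) (crosses _ _ _ _ _).
  move: (\big[_/_]_(_ <- _) _) (\big[_/_]_(_ <- _) _).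
  by do 8!case.
rewrite -/(ends ws) !big_cons.
move: (wire_sg _ _ _ _) (crosses _ _ _ _ _) (wires_sign _ _ _ _ _) (koszul _ _ _).
move: (\big[_/_]_(_ <- _) _) (\big[_/_]_(_ <- _) _).
rewrite /p /=; set b := inverts _ _ && _; move: b.
by do 7!case.
Qed.

End SignMap.

(** * Half-edges of letters *)

Local Open Scope ring_scope.

(* [(k, false)] and [(k, true)] stand for the first and the second index of the
   [k]-th factor; [hpos] lists the half-edges from left to right. *)
Definition half_edge m := ('I_m * bool)%type.

Definition hpos m (x : half_edge m) : nat := (x.1.*2 + x.2)%N.

Definition other_side m (x : half_edge m) : half_edge m := (x.1, ~~ x.2).

Lemma hpos_inj m : injective (@hpos m).
Proof.
move=> [i b] [j d]; rewrite /hpos /= => E.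
have bd : b = d by move: E => /(congr1 odd); rewrite !oddD !odd_double !oddb.
by subst d; congr pair; apply: val_inj; move: E => /addIn/double_inj.
Qed.

Lemma other_sideK m : involutive (@other_side m).
Proof. by case=> i b; rewrite /other_side negbK. Qed.

Definition complete m (ws : seq (half_edge m * half_edge m)) :=
  perm_eq (ends ws) (enum {: half_edge m}).

Lemma complete_uniq m (ws : seq (half_edge m * half_edge m)) : complete ws -> uniq (ends ws).
Proof. by move/perm_uniq->; apply: enum_uniq. Qed.

Lemma complete_eqw m (ws ws' : seq (half_edge m * half_edge m)) :
  eqw (@hpos m) ws ws' -> complete ws -> complete ws'.
Proof. by move=> /eqw_ends; rewrite /complete perm_sym; apply: perm_trans. Qed.

Lemma complete_map m (f : half_edge m -> half_edge m) ws :
  injective f -> complete ws -> complete (map (map_wire f) ws).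
Proof.
move=> f_inj ws_c; rewrite /complete ends_map (perm_trans (perm_map f ws_c)) //.
apply: uniq_perm => [||x]; [by rewrite map_inj_uniq // enum_uniq|exact: enum_uniq|].
by rewrite mem_enum inE -(f_finv f_inj x) mem_map // mem_enum.
Qed.

Lemma enum_half_edge_rem m (xs : seq (half_edge m)) : uniq xs ->
  perm_eq (enum {: half_edge m}) (xs ++ [seq x <- enum {: half_edge m} | x \notin xs]).
Proof.
move=> xs_uniq; apply: uniq_perm => [||x]; first exact: enum_uniq.
  rewrite cat_uniq xs_uniq filter_uniq ?enum_uniq // andbT; apply/hasPn=> x.
  by rewrite mem_filter => /andP[].
by rewrite mem_cat [in RHS]mem_filter !mem_enum !inE andbT orbN.
Qed.

Section Flip.
Variable m : nat.
Implicit Types (k : 'I_m) (x : half_edge m).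

Definition flip k x : half_edge m := if x.1 == k then other_side x else x.

Lemma flipK k : involutive (flip k).
Proof. by move=> x; rewrite /flip; case: (boolP (x.1 == k)) => /= [|/negPf] ->;
  rewrite ?other_sideK. Qed.

Lemma inverts_flip k x y : inverts (@hpos m) (@hpos m) (flip k) x y =
  (x.1 == k) && (y.1 == k) && (x.2 (+) y.2).
Proof.
case: x y => i b [j d]; rewrite /inverts /flip /hpos /=.
have ineq (a : 'I_m) : a != k -> (a < k)%N || (k < a)%N by rewrite neq_ltn.
by have [->|/ineq ik] := eqVneq i k; have [->|/ineq jk] := eqVneq j k;
  move: b d => [] [] /=; lia.
Qed.

Lemma koszul_flip k p : koszul (inverts (@hpos m) (@hpos m) (flip k)) p (enum {: half_edge m}) =
  p (k, false) && p (k, true).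
Proof.
have gC := inverts_sym (@hpos_inj m) (@hpos_inj m) (inv_inj (flipK k)).
have kk : uniq [:: (k, false); (k, true)] by rewrite /= inE xpair_eqE eqxx.
rewrite (perm_koszul _ gC (enum_half_edge_rem kk)).
have rest0 x : x \in [seq x <- enum {: half_edge m} | x \notin [:: (k, false); (k, true)]] ->
    forall y, inverts (@hpos _) (@hpos _) (flip k) y x = false.
  case: x => i b; rewrite mem_filter !inE !xpair_eqE !negb_or.
  case/andP=> H _ y; move: H; rewrite inverts_flip /=.
  by case: (i == k); case: b; rewrite /= ?andbF.
rewrite /= !big_cons !inverts_flip /= !eqxx /= !koszul_sum0 ?koszul0 ?addbF //;
  by move=> *; apply: rest0.
Qed.

End Flip.

Section Blocks.
Variables (n : nat) (r : 'I_n.+1).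
Let r1 := fst_letter r.
Let r2 := snd_letter r.

Definition swap_blocks (x : half_edge n.+2) : half_edge n.+2 := (tperm r1 r2 x.1, x.2).

Lemma swap_blocksK : involutive swap_blocks.
Proof. by case=> i b; rewrite /swap_blocks /= tpermK. Qed.

Lemma fst_snd_neq : r1 != r2.
Proof. by rewrite -val_eqE /= /bump /=; lia. Qed.

Lemma inverts_blocks x y : inverts (@hpos _) (@hpos _) swap_blocks x y =
  (x.1 == r1) && (y.1 == r2) || (x.1 == r2) && (y.1 == r1).
Proof.
have v1 : (r1 : nat) = r by [].
have v2 : (r2 : nat) = r.+1 by rewrite /= /bump.
case: x y => i b [j d]; rewrite /inverts /swap_blocks /hpos /=.
have nE (a c : 'I_n.+2) : (a == c) = (nat_of_ord a == c)%N by [].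
have tE (a : 'I_n.+2) : nat_of_ord (tperm r1 r2 a) =
    if (a == r :> nat) then r.+1 else if (a == r.+1 :> nat) then nat_of_ord r else a.
  rewrite -v1 -v2 -!nE; case: tpermP => [->|->|/eqP/negPf-> /eqP/negPf->] //.
    by rewrite eqxx v2.
  by rewrite eq_sym (negPf fst_snd_neq) eqxx v1.
rewrite !tE !nE v1 v2; move: (nat_of_ord i) (nat_of_ord j) (nat_of_ord r) b d => {}i {}j k b d.
case: (ltngtP i k) => ik; case: (ltngtP j k) => jk; case: (ltngtP i k.+1) => ik';
  case: (ltngtP j k.+1) => jk' //=; move: b d => [] [] /=; lia.
Qed.

(** The inverted pairs are those with one half-edge in each letter, so the sign is governed by the
    product of the parities of the two generators, as in the supercommutator. *)
Lemma koszul_blocks p : koszul (inverts (@hpos _) (@hpos _) swap_blocks) p (enum {: half_edge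
  n.+2}) =
  (p (r1, false) (+) p (r1, true)) && (p (r2, false) (+) p (r2, true)).
Proof.
have r12 := negPf fst_snd_neq.
have r21 : (r2 == r1) = false by rewrite eq_sym.
have gC := inverts_sym (@hpos_inj _) (@hpos_inj _) (inv_inj swap_blocksK).
have rr : uniq [:: (r1, false); (r1, true); (r2, false); (r2, true)].
  by rewrite /= !inE !xpair_eqE r12 !eqxx.
rewrite (perm_koszul _ gC (enum_half_edge_rem rr)).
have rest0 x : x \in [seq x <- enum {: half_edge n.+2}
      | x \notin [:: (r1, false); (r1, true); (r2, false); (r2, true)]] ->
      forall y, inverts (@hpos _) (@hpos _) swap_blocks y x = false.
    case: x => i b; rewrite mem_filter !inE !xpair_eqE !negb_or.
    case/andP=> H _ y; move: H; rewrite inverts_blocks /=.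
    by case: (i == r1); case: (i == r2); case: b; rewrite /= ?andbF.
  rewrite /= !big_cons !inverts_blocks /= !eqxx r12 r21 /=.
  rewrite !koszul_sum0 ?koszul0 => [|||||];
     try by move=> *; apply: rest0.
  by case: (p _); case: (p _); case: (p _); case: (p _).
Qed.

End Blocks.

(** * Sums over labellings *)

Section WireSums.
Variables (I : finType) (bar : I -> I) (eta e : I -> bool).
Hypotheses (barK : involutive bar) (eta_bar : forall a, eta (bar a) = eta a).
Hypothesis e_bar : forall a, e (bar a) = e a (+) eta a.
Variables (U : nzRingType) (Y : I -> I -> U).

Notation sgn b := ((-1) ^+ (nat_of_bool b) : U).

Definition skew :=
  forall a b, Y a b = - (sgn (eta a && eta b) * Y b a).

(** The product of [Y a b] and [Y c d] with the inner indices paired off by the invariant form. *)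
Definition contraction a b c d : U := if c == bar b then sgn (e c) * Y a d else 0.

(* The supercommutation relations of the generators with both indices in upper
   position; [e] holds the signs of the invariant form, which pairs [a] with
   [bar a]. *)
Definition osp_commutation := forall a b c d,
  Y a b * Y c d - sgn ((eta a (+) eta b) && (eta c (+) eta d)) * (Y c d * Y a b) =
    contraction a b c d - sgn (eta a && eta b) * contraction b a c d
    - sgn (eta c && eta d) * contraction a b d c
    + sgn ((eta a && eta b) (+) (eta c && eta d)) * contraction b a d c.

Section Sums.
Variable m : nat.
Implicit Types (ws : seq (half_edge m * half_edge m)) (c : {ffun half_edge m -> I}).

Notation ok := (admissible bar).
Notation sg := (wires_sign eta e (@hpos m)).

(** The summand [F] is left open because the same signed sum is taken of [word_prod] and of
    [glued]. *)
Definition wire_sum ws (F : {ffun half_edge m -> I} -> U) : U :=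
  \sum_(c : {ffun half_edge m -> I} | ok c ws) sgn (sg c ws) * F c.

Definition word_prod c : U := \prod_(k < m) Y (c (k, false)) (c (k, true)).

Definition diagram_sum ws : U := wire_sum ws word_prod.

Lemma wire_sum_eqw ws ws' F : complete ws -> eqw (@hpos m) ws ws' ->
  wire_sum ws F = wire_sum ws' F.
Proof.
move=> ws_c eq_ws; apply: eq_big => c; first exact: admissible_eqw eq_ws.
by move=> okc; rewrite (wires_sign_eqw e barK eta_bar (@hpos_inj m) (complete_uniq ws_c) okc
  eq_ws).
Qed.

Definition precomp (f : half_edge m -> half_edge m) c : {ffun half_edge m -> I} :=
  [ffun x => c (f x)].

Lemma precompK f : involutive f -> involutive (precomp f).
Proof. by move=> fK c; apply/ffunP=> x; rewrite !ffunE fK. Qed.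

Lemma wire_sum_map ws F f : involutive f -> complete ws ->
  wire_sum (map (map_wire f) ws) F =
  wire_sum ws (fun c =>
     sgn (koszul (inverts (@hpos m) (@hpos m) f) (eta \o c) (enum {: half_edge m}))
     * F (precomp f c)).
Proof.
move=> fK ws_c; rewrite /wire_sum (reindex_inj (inv_inj (precompK fK))).
have E c : precomp f c \o f =1 c by move=> x; rewrite /= ffunE fK.
apply: eq_big => c.
  by rewrite admissible_map; apply: eq_admissible => x _; apply: E.
rewrite admissible_map => okc; rewrite mulrA -signr_addb; congr (sgn _ * _).
rewrite (wires_sign_map eta_bar e_bar (@hpos_inj m) (@hpos_inj m) (inv_inj fK) okc).
congr (_ (+) _); first by apply: eq_wires_sign => x _; apply: E.
rewrite (perm_koszul _ _ ws_c); last exact: inverts_sym (@hpos_inj _) (@hpos_inj _) (inv_inj fK).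
elim: (enum _) => //= x xs ->; congr (_ (+) _).
by apply: eq_bigr => y _; rewrite /= !ffunE !fK.
Qed.

Lemma wire_sum_flip ws F k : complete ws ->
  wire_sum (map (map_wire (flip k)) ws) F =
  wire_sum ws (fun c => sgn (eta (c (k, false)) && eta (c (k, true)))
                        * F (precomp (flip k) c)).
Proof.
move=> ws_c; rewrite (wire_sum_map _ (flipK k) ws_c).
by apply: eq_bigr => c _; rewrite koszul_flip.
Qed.

End Sums.

Section Flips.
Variable m : nat.
Implicit Types (ws : seq (half_edge m * half_edge m)).
Hypothesis Y_skew : skew.

Lemma word_prod_flip k c : word_prod (precomp (@flip m k) c) =
  - (sgn (eta (c (k, false)) && eta (c (k, true))) * word_prod c).
Proof.
set s := sgn _.
have sC x : s * x = x * s by apply/esym/commr_sign.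
pose G (i : 'I_m) := if i == k then - s else 1.
have -> : word_prod (precomp (@flip m k) c) =
  \prod_(i < m) (G i * Y (c (i, false)) (c (i, true))).
  apply: eq_bigr => i _; rewrite !ffunE /G /flip /=.
  case: eqP => [->|_]; rewrite ?mul1r // [LHS]Y_skew mulNr.
  by rewrite /other_side /= andbC.
have E (r : seq 'I_m) : uniq r -> \prod_(i <- r) (G i * Y (c (i, false)) (c (i, true))) =
    (if k \in r then - s else 1) * \prod_(i <- r) Y (c (i, false)) (c (i, true)).
  elim: r => [|i r IH] /=; first by rewrite !big_nil mulr1.
  case/andP=> ir ur; rewrite !big_cons (IH ur) inE /G [k == i]eq_sym.
  case: eqP => [E|_] /=; last first.
    by rewrite mul1r; case: ifP; rewrite ?mul1r // !mulNr mulrN !mulrA sC.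
  by rewrite -E (negPf ir) mul1r mulrA.
by rewrite /word_prod E ?index_enum_uniq // mem_index_enum mulNr.
Qed.

(** The Koszul sign of exchanging the two half-edges of [k] cancels the parity sign in [skew], so
    only the bare factor -1 survives. *)
Lemma diagram_sum_flip k ws : complete ws -> diagram_sum (map (map_wire (flip k)) ws) =
  - diagram_sum ws.
Proof.
move=> ws_c; rewrite /diagram_sum wire_sum_flip // -sumrN.
apply: eq_bigr => c _; rewrite word_prod_flip /= mulrN mulrA -signr_addb.
by rewrite addbb mul1r mulrN.
Qed.

Definition flips (ks : seq 'I_m) (x : half_edge m) : half_edge m :=
  if x.1 \in ks then other_side x else x.

Lemma diagram_sum_flips ks ws : uniq ks -> complete ws ->
  diagram_sum (map (map_wire (flips ks)) ws) = (-1) ^+ size ks * diagram_sum ws.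
Proof.
move=> uks ws_c; elim: ks uks => [|k ks IH] /=.
  by rewrite mul1r (eq_map (_ : _ =1 id)) ?map_id // => -[].
case/andP=> kks uks; rewrite exprS mulN1r mulNr -IH // -(diagram_sum_flip k); last first.
  apply: complete_map => // x y; rewrite /flips.
  by case: x y => i b [j d] /=; do 2!case: ifP => //= ?; case=> ?; try subst;
    try congruence; case: b; case: d => //; congruence.
rewrite -map_comp; congr diagram_sum; apply: eq_map => w; rewrite /= /map_wire /=.
suff E x : flips (k :: ks) x = flip k (flips ks x) by rewrite !E.
case: x => i b; rewrite /flips /flip /= inE; case: (eqVneq i k) => [->|ik] /=.
  by rewrite (negPf kks) eqxx.
by case: ifP; rewrite /= (negPf ik).
Qed.

End Flips.

(** * The supercommutator of two neighbouring factors as a sum of glued diagrams *)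

Section Recurrence.
Variables (n : nat) (r : 'I_n.+1).
Let r1 := fst_letter r.
Let r2 := snd_letter r.
Implicit Types (ws : seq (half_edge n.+2 * half_edge n.+2)) (c : {ffun half_edge n.+2 -> I}).
Hypothesis Y_comm : osp_commutation.

(** Indexing by natural numbers lets the ordered product be cut at [r] and [r + 2]. *)
Definition Yat c (i : nat) : U := Y (c (inord i, false)) (c (inord i, true)).

Definition glued c : U :=
  (\prod_(0 <= i < r) Yat c i) *
  contraction (c (r1, false)) (c (r1, true)) (c (r2, false)) (c (r2, true)) *
  (\prod_(r.+2 <= i < n.+2) Yat c i).

Definition glued_sum ws : U := wire_sum ws glued.

Lemma word_prod_split c : word_prod c =
  (\prod_(0 <= i < r) Yat c i) *
  (Y (c (r1, false)) (c (r1, true)) * Y (c (r2, false)) (c (r2, true))) *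
  (\prod_(r.+2 <= i < n.+2) Yat c i).
Proof.
have -> : word_prod c = \prod_(0 <= i < n.+2) Yat c i.
  by rewrite big_mkord; apply: eq_bigr => i _; rewrite /Yat inord_val.
have rn := ltn_ord r.
have i1 : inord r = r1 by apply: val_inj; rewrite /= inordK /bump ?leq0n ?add1n //; lia.
have i2 : inord r.+1 = r2 by apply: val_inj; rewrite /= inordK /bump ?leq0n ?add1n //; lia.
rewrite (@big_cat_nat _ _ _ r) //=; last by lia.
rewrite (@big_ltn _ _ _ r); last by lia.
rewrite (@big_ltn _ _ _ r.+1); last by lia.
by rewrite /Yat i1 i2 !mulrA.
Qed.

(** The Koszul sign of the block exchange is the sign in [osp_commutation], so the two sums combine
    label by label into a supercommutator in the middle of the word. The four contractions differ by
    exchanging the indices of one factor or of both, that is, by flips, and their signs are the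
    Koszul signs of these flips. *)
Lemma diagram_sum_recurrence ws : complete ws ->
  let t k := map (map_wire (flip k)) in
  diagram_sum ws - diagram_sum (map (map_wire (swap_blocks r)) ws) =
    glued_sum ws - glued_sum (t r1 ws) - glued_sum (t r2 ws) + glued_sum (t r1 (t r2 ws)).
Proof.
move=> ws_c t; have ws_c2 : complete (t r2 ws).
  by apply: complete_map => //; apply: inv_inj (flipK _).
have r12 : (r1 == r2) = false by apply/negbTE/fst_snd_neq.
have r21 : (r2 == r1) = false by rewrite eq_sym.
have rn := ltn_ord r.
have v1 : (r1 : nat) = r by [].
have v2 : (r2 : nat) = r.+1 by rewrite /= /bump.
have outer (f : half_edge n.+2 -> half_edge n.+2) c : (forall k b, k != r1 -> k != r2 ->
  f (k, b) = (k, b)) ->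
    (\prod_(0 <= i < r) Yat (precomp f c) i = \prod_(0 <= i < r) Yat c i) *
    (\prod_(r.+2 <= i < n.+2) Yat (precomp f c) i = \prod_(r.+2 <= i < n.+2) Yat c i).
  by move=> fE; split; apply: eq_big_nat => i Hi; rewrite /Yat !ffunE !fE //;
    apply/eqP=> /(congr1 (@nat_of_ord _)); rewrite ?v1 ?v2 inordK; lia.
rewrite /diagram_sum /glued_sum /t !wire_sum_flip // (wire_sum_map _ (swap_blocksK r)) //.
rewrite /wire_sum -!sumrB -big_split /=; apply: eq_bigr => c _.
rewrite koszul_blocks !word_prod_split /glued.
have f1 k b : k != r1 -> k != r2 -> flip r1 (k, b) = (k, b).
  by rewrite /flip /= => /negPf->.
have f2 k b : k != r1 -> k != r2 -> flip r2 (k, b) = (k, b).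
  by rewrite /flip /= => _ /negPf->.
have f3 k b : k != r1 -> k != r2 -> swap_blocks r (k, b) = (k, b).
  by rewrite /swap_blocks /= => k1 k2; rewrite tpermD // eq_sym.
rewrite !(outer _ _ f1) !(outer _ _ f2) !(outer _ _ f3).
rewrite !ffunE /flip /swap_blocks /= !eqxx /other_side /= ?r12 ?r21 /= ?eqxx ?r12 ?r21 ?tpermL
  ?tpermR /=.
rewrite -/r1 -/r2 ?r12 ?r21 /=.
set A := \prod_(0 <= i < r) _; set D := \prod_(r.+2 <= i < n.+2) _.
have pull b X : sgn b * (A * X * D) = A * (sgn b * X) * D.
  by rewrite !mulrA (commr_sign A).
rewrite !pull -mulrBl -mulrBr -mulrBr Y_comm.
by rewrite !(mulrBr, mulrDr, mulrBl, mulrDl) addbC signr_addb -!mulrA.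
Qed.

End Recurrence.
End WireSums.

(** * Merging two adjacent letters *)

Section Embedding.
Variables (n : nat) (r : 'I_n.+1).
Let r1 := fst_letter r.
Let r2 := snd_letter r.

(* The half-edges of the new letter [V] are the outer ones of [r] and [r + 1];
   the inner ones are glued together. *)
Definition emb (x : half_edge n.+1) : half_edge n.+2 :=
  if (x.1 == r) && x.2 then (r2, true) else (lift r2 x.1, x.2).

Definition unemb (z : half_edge n.+2) : half_edge n.+1 := (collapse r z.1, z.2).

Definition inner_l : half_edge n.+2 := (r1, true).
Definition inner_r : half_edge n.+2 := (r2, false).

Lemma lift_fst : lift r2 r = r1.
Proof. by apply: val_inj; rewrite /= /bump; case: ltnP; lia. Qed.

Lemma collapse_fst : collapse r r1 = r.
Proof. by rewrite -lift_fst collapse_lift. Qed.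

Lemma collapse_snd : collapse r r2 = r.
Proof. by apply: val_inj => /=; rewrite val_collapse /= /unbump /bump /=; lia. Qed.

Lemma embK : cancel emb unemb.
Proof.
move=> [k b]; rewrite /emb /unemb /=; case: ifP => /= [/andP[/eqP-> ->]|_].
  by rewrite collapse_snd.
by rewrite collapse_lift.
Qed.

Lemma emb_inj : injective emb. Proof. exact: can_inj embK. Qed.

Lemma unembK z : z != inner_l -> z != inner_r -> emb (unemb z) = z.
Proof.
case: z => k b; rewrite /emb /unemb /inner_l /inner_r !xpair_eqE /=.
have [->|k2] := eqVneq k r2.
  by rewrite collapse_snd eqxx /=; case: b; rewrite /= ?andbT ?eqxx.
rewrite lift_collapse //.
have -> : (collapse r k == r) = (collapse r k == collapse r r1) by rewrite collapse_fst.
have [->|k1] := eqVneq k r1; first by case: b; rewrite //= !andbF.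
case: (collapse r k =P _) => [/(collapse_inj k2 (fst_snd_neq r)) E|//].
by rewrite E eqxx in k1.
Qed.

Lemma emb_inner_l x : emb x != inner_l.
Proof.
case: x => k b; rewrite /emb /inner_l /=; case: ifP => kb /=.
  by rewrite xpair_eqE eq_sym (negPf (fst_snd_neq r)).
rewrite xpair_eqE -lift_fst (inj_eq lift_inj).
by apply/negP=> /andP[E1 E2]; move: kb; rewrite E1 (eqP E2).
Qed.

Lemma emb_inner_r x : emb x != inner_r.
Proof.
case: x => k b; rewrite /emb /inner_r /=; case: ifP => _ /=; first by rewrite xpair_eqE andbF.
by rewrite xpair_eqE eq_sym (negPf (neq_lift _ _)).
Qed.

(** The inner half-edges occupy the positions 2r + 1 and 2r + 2. The image of [emb] skips exactly
    these two, hence [emb] is increasing and costs no sign. *)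
Lemma hpos_emb x : hpos (emb x) = if (hpos x <= r.*2)%N then hpos x else (hpos x).+2.
Proof.
case: x => k b; rewrite /emb /hpos /= -val_eqE /=; case: ifP => /=.
  by case/andP=> /eqP kr ->; rewrite /bump /= kr; case: ifP; lia.
by move=> kr; rewrite /bump leq0n add1n; case: ltnP => rk; case: ifP => /=; case: b kr => /=; lia.
Qed.

Lemma hpos_inner_l : hpos inner_l = r.*2.+1. Proof. by rewrite /hpos /= addn1. Qed.
Lemma hpos_inner_r : hpos inner_r = r.*2.+2. Proof. by rewrite /hpos /= /bump leq0n; lia. Qed.

Lemma inner_l_neq_r : inner_l != inner_r.
Proof. by apply/eqP=> /(congr1 (@hpos _)); rewrite hpos_inner_l hpos_inner_r; lia. Qed.

Lemma inverts_emb x y : inverts (@hpos _) (@hpos _) emb x y = false.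
Proof.
rewrite /inverts !hpos_emb.
move: (hpos x) (hpos y) => i j.
set b := (X in _ (+) X); suff -> : b = (i < j)%N by rewrite addbb.
by rewrite /b; case: (leqP i r.*2); case: (leqP j r.*2) => *; lia.
Qed.

Lemma ltn_emb x y : (hpos (emb x) < hpos (emb y))%N = (hpos x < hpos y)%N.
Proof. by have := inverts_emb x y; rewrite /inverts; do 2!case: (_ < _)%N. Qed.

(** The inner half-edges are neighbours, so no other half-edge separates them. *)
Lemma ltn_inner_emb x : ((hpos inner_l < hpos (emb x)) = (hpos inner_r < hpos (emb x)))%N.
Proof. by rewrite hpos_inner_l hpos_inner_r hpos_emb; case: (leqP (hpos x) r.*2); lia. Qed.

Lemma ltn_emb_inner x : ((hpos (emb x) < hpos inner_l) = ~~ (hpos inner_l < hpos (emb x)))%N *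
  ((hpos (emb x) < hpos inner_r) = ~~ (hpos inner_l < hpos (emb x)))%N.
Proof. by rewrite hpos_inner_l hpos_inner_r hpos_emb; case: (leqP (hpos x) r.*2); split; lia. Qed.

End Embedding.

(** * Compatibility of gluing with the signs *)

Section Gluing.
Variables (I : finType) (bar : I -> I) (eta e : I -> bool).
Hypotheses (barK : involutive bar) (eta_bar : forall a, eta (bar a) = eta a).
Hypothesis e_bar : forall a, e (bar a) = e a (+) eta a.
Variables (U : nzRingType) (Y : I -> I -> U).
Variables (n : nat) (r : 'I_n.+1).
Let r1 := fst_letter r.
Let r2 := snd_letter r.
Let h := emb r.
Let x0 := inner_l r.
Let y0 := inner_r r.

Notation sgn b := ((-1) ^+ (nat_of_bool b) : U).
Notation W := (diagram_sum bar eta e Y).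
Notation B := (glued_sum bar eta e Y r).
Notation glued := (glued bar e Y r).
Notation Yprod := (word_prod Y).

Definition restrict (c : {ffun half_edge n.+2 -> I}) : {ffun half_edge n.+1 -> I} :=
  [ffun x => c (h x)].

Lemma gluedE c : glued c =
  if c y0 == bar (c x0) then sgn (e (c y0)) * Yprod (restrict c) else 0.
Proof.
rewrite /glued /contraction -/x0 -/y0; case: ifP => _; last by rewrite mulr0 mul0r.
rewrite !mulrA (commr_sign (\prod_(0 <= i < r) _)) -!mulrA; congr (_ * _).
have rn := ltn_ord r.
have -> : Yprod (restrict c) = \prod_(0 <= i < n.+1)
    Y (restrict c (inord i, false)) (restrict c (inord i, true)).
  by rewrite big_mkord; apply: eq_bigr => i _; rewrite inord_val.
rewrite [RHS](@big_cat_nat _ _ _ r) //=; last by lia.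
rewrite (@big_ltn _ _ _ r); last by lia.
congr (_ * (_ * _)).
- apply: eq_big_nat => i Hi; rewrite /Yat !ffunE /h /emb /=.
  have iE : lift r2 (inord i) = inord i.
    by apply: val_inj; rewrite /= /bump leq0n add1n !inordK ?ifF; lia.
  rewrite -!iE andbT andbF.
  by case: eqP => [/(congr1 val)|//]; rewrite /= inordK; lia.
- by rewrite inord_val !ffunE /h /emb eqxx /= lift_fst.
rewrite big_add1 /=; apply: eq_big_nat => i Hi; rewrite /Yat !ffunE /h /emb /=.
have iE : lift r2 (inord i) = inord i.+1.
  by apply: val_inj; rewrite /= /bump leq0n add1n !inordK; lia.
rewrite -!iE andbT andbF.
by case: eqP => [/(congr1 val)|//]; rewrite /= inordK; lia.
Qed.

Lemma wire_sgE (T : eqType) (pos : T -> nat) (c : T -> I) w : paired bar c w ->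
  wire_sg e pos c w = e (c w.1) (+) ((pos w.2 < pos w.1)%N && eta (c w.1)).
Proof.
rewrite /wire_sg /orient => /eqP cw; rewrite ltnNge; case: (_ <= _)%N => /=.
  by rewrite addbF.
by rewrite cw e_bar.
Qed.

Lemma wires_sign_emb (c : half_edge n.+2 -> I) Z : admissible bar (c \o h) Z ->
  wires_sign eta e (@hpos _) c (map (map_wire h) Z) = wires_sign eta e (@hpos _) (c \o h) Z.
Proof.
move=> okZ; rewrite (wires_sign_map eta_bar e_bar (@hpos_inj _) (@hpos_inj _) (@emb_inj _ r) okZ).
by rewrite koszul0 ?addbF // => x y _ _; apply: inverts_emb.
Qed.

(** Any other wire compares in the same way with [x0] and with [y0], so these comparisons cancel and
    the crossings of the two wires add up to those of the joined wire. The mutual crossing of the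
    two wires, their own signs and the sign of the contraction combine into the sign of the joined
    wire. *)
Lemma wires_sign_glue (c : half_edge n.+2 -> I) a b Z : a != b ->
    c x0 = bar (c (h a)) -> c y0 = c (h a) -> c (h b) = bar (c (h a)) ->
      admissible bar (c \o h) Z ->
  wires_sign eta e (@hpos _) c ((h a, x0) :: (y0, h b) :: map (map_wire h) Z) (+) e (c y0) =
  wires_sign eta e (@hpos _) (c \o h) ((a, b) :: Z).
Proof.
move=> ab cx cy cb okZ; rewrite /= wires_sign_emb // crosses_cons.
have -> : crosses eta (@hpos _) (c \o h) (a, b) Z =
    crosses eta (@hpos _) c (h a, x0) (map (map_wire h) Z) (+)
    crosses eta (@hpos _) c (y0, h b) (map (map_wire h) Z).
  elim: Z okZ => [|v Z IH] /=; first by rewrite /crosses !big_nil.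
  case/andP=> _ okZ; rewrite !crosses_cons IH // {IH}.
  suff -> : cross eta (@hpos _) (c \o h) (a, b) v =
      cross eta (@hpos _) c (h a, x0) (map_wire h v) (+)
      cross eta (@hpos _) c (y0, h b) (map_wire h v).
    move: (cross _ _ _ _ _) (cross _ _ _ _ _) (crosses _ _ _ _ _) (crosses _ _ _ _ _).
    by do 4!case.
  rewrite /cross /alt /= cy; case: (eta (c (h a)) && eta (c (h v.1))); rewrite ?andbF // !andbT.
  rewrite /h !ltn_emb /x0 /y0 !ltn_inner_emb; rewrite -/h.
  by do 6!case: (_ < _)%N.
rewrite !wire_sgE /paired /= ?cx ?cy ?cb ?barK //.
rewrite /cross /alt /= ?cx ?cy andbb /h !ltn_emb /x0 /y0 !ltn_emb_inner.
have -> : (hpos (inner_l r) < hpos (inner_r r))%N by rewrite hpos_inner_l hpos_inner_r.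
rewrite -/h -/x0.
have -> : (hpos a < hpos b)%N = ~~ (hpos b < hpos a)%N.
  by rewrite -leqNgt [RHS]leq_eqVlt (inj_eq (@hpos_inj _)) (negPf ab).
move: (wires_sign _ _ _ _ _) (crosses _ _ _ _ _) (crosses _ _ _ _ _).
move: (_ < _)%N (_ < _)%N (_ < _)%N (e _) (eta _).
by do 8!case.
Qed.

Definition extend (x : half_edge n.+1 -> I) (l l' : I) : {ffun half_edge n.+2 -> I} :=
  [ffun z => if z == x0 then l else if z == y0 then l' else x (unemb r z)].

Lemma extend_emb x l l' z : extend x l l' (h z) = x z.
Proof. by rewrite ffunE (negPf (emb_inner_l r z)) (negPf (emb_inner_r r z)) embK. Qed.

Lemma extend_inner_l x l l' : extend x l l' x0 = l. Proof. by rewrite ffunE eqxx. Qed.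

Lemma extend_inner_r x l l' : extend x l l' y0 = l'.
Proof. by rewrite ffunE eqxx eq_sym (negPf (inner_l_neq_r r)). Qed.

Lemma restrict_extend x l l' : restrict (extend x l l') = [ffun z => x z].
Proof. by apply/ffunP=> z; rewrite [LHS]ffunE extend_emb ffunE. Qed.

Lemma extend_restrict c : extend (restrict c) (c x0) (c y0) = c.
Proof.
apply/ffunP=> z; rewrite ffunE; case: eqP => [-> //|/eqP zx]; case: eqP => [-> //|/eqP zy].
by rewrite ffunE /h unembK.
Qed.

Lemma ends_emb Z : ends (map (map_wire h) Z) = map h (ends Z).
Proof. exact: ends_map. Qed.

Lemma enum_half_edge_emb : perm_eq (enum {: half_edge n.+2}) (x0 :: y0 :: map h (enum {:
  half_edge n.+1})).
Proof.
apply: uniq_perm => [||z]; first exact: enum_uniq.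
  rewrite /= inE negb_or inner_l_neq_r (map_inj_uniq (@emb_inj _ r)) enum_uniq andbT.
  by apply/andP; split; apply/mapP=> -[x _ /esym/eqP];
    apply/negP; rewrite ?emb_inner_l ?emb_inner_r.
rewrite mem_enum !inE; apply/esym; case: (eqVneq z x0) => //= zx; case: (eqVneq z y0) => //= zy.
by apply/mapP; exists (unemb r z); rewrite ?mem_enum // /h unembK.
Qed.

Lemma perm_enum_emb xs :
  perm_eq (x0 :: y0 :: map h xs) (enum {: half_edge n.+2}) ->
    perm_eq xs (enum {: half_edge n.+1}).
Proof.
rewrite (permPr enum_half_edge_emb) !perm_cons => /perm_map_inj; apply; exact: emb_inj.
Qed.

Lemma glued_sum_glue ws a b Z : complete ws ->
    eqw (@hpos _) ws ((h a, x0) :: (y0, h b) :: map (map_wire h) Z) ->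
  B ws = W ((a, b) :: Z) /\ complete ((a, b) :: Z).
Proof.
move=> ws_c eq_ws; have ws'_c := complete_eqw eq_ws ws_c.
have abZ_c : complete ((a, b) :: Z).
  apply: perm_enum_emb; apply: perm_trans ws'_c; rewrite -ends_emb.
  apply/permPl; exact: (perm_catCA [:: x0; y0] [:: h a]).
split=> //; have ab : a != b.
  by have := complete_uniq abZ_c; rewrite /= !inE negb_or => /andP[/andP[]].
rewrite /B (wire_sum_eqw _ barK eta_bar _ ws_c eq_ws) /wire_sum /W /wire_sum.
transitivity (\sum_(c : {ffun half_edge n.+2 -> I} |
    admissible bar c ((h a, x0) :: (y0, h b) :: map (map_wire h) Z) && (c y0 == bar (c x0)))
  sgn (wires_sign eta e (@hpos _) c ((h a, x0) :: (y0, h b) :: map (map_wire h) Z) (+) e (c y0))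
    * Yprod (restrict c)).
  rewrite [RHS]big_mkcondr; apply: eq_bigr => c _; rewrite gluedE.
  by case: ifP => _; rewrite ?mulr0 // mulrA -signr_addb.
(* The wire from [h a] and the contraction force the inner labels, [bar (c a)] at [x0] and then
   [c a] at [y0]. *)
pose J (c : {ffun half_edge n.+1 -> I}) := extend c (bar (c a)) (c a).
rewrite (reindex_onto J restrict) /=; last first.
  move=> c /andP[/and3P[/eqP/= cx _ _] /eqP cy].
  by rewrite /J !ffunE -cx -[c (h a)]barK -cx -cy extend_restrict.
apply: eq_big => c.
  rewrite restrict_extend /paired /= !extend_emb extend_inner_l extend_inner_r barK !eqxx !andbT.
  rewrite (_ : [ffun z => c z] == c) ?andbT; last by apply/eqP/ffunP=> z; rewrite ffunE.
  by rewrite andTb admissible_map; congr (_ && _); apply: eq_admissible => z _; apply: extend_emb.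
case/andP=> /andP[/and3P[_ /eqP /= cb okZ] _] /eqP rJ.
rewrite wires_sign_glue //; rewrite ?extend_emb ?extend_inner_l ?extend_inner_r //.
- by congr (sgn _ * _); [apply: eq_wires_sign => z _; rewrite /= extend_emb | congr Yprod].
- by move: cb; rewrite extend_emb extend_inner_r.
by rewrite -admissible_map.
Qed.

(** A wire between neighbouring half-edges crosses nothing. Its sign and that of the contraction are
    values of [e] at dual labels, so they differ by the parity of the label. *)
Lemma wires_sign_loop (c : half_edge n.+2 -> I) Z : c y0 = bar (c x0) ->
  admissible bar (c \o h) Z ->
  wires_sign eta e (@hpos _) c ((x0, y0) :: map (map_wire h) Z) (+) e (c y0) =
  wires_sign eta e (@hpos _) (c \o h) Z (+) eta (c x0).
Proof.
move=> cy okZ; rewrite /= wires_sign_emb // wire_sgE /paired ?cy //=.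
have -> : crosses eta (@hpos _) c (x0, y0) (map (map_wire h) Z) = false.
  rewrite /crosses big_map big1 // => v _; rewrite /cross /alt /= !ltn_inner_emb.
  by do 2!case: (_ < _)%N.
rewrite hpos_inner_l hpos_inner_r ltnNge leqnSn /= !addbF e_bar.
by move: (e _) (wires_sign _ _ _ _ _) (eta _); do 3!case.
Qed.

Lemma glued_sum_loop ws Z : complete ws ->
    eqw (@hpos _) ws ((x0, y0) :: map (map_wire h) Z) ->
  B ws = (\sum_l sgn (eta l)) * W Z /\ complete Z.
Proof.
move=> ws_c eq_ws; have ws'_c := complete_eqw eq_ws ws_c.
have Z_c : complete Z.
  by apply: perm_enum_emb; apply: perm_trans ws'_c; rewrite -ends_emb.
split=> //.
rewrite /B (wire_sum_eqw _ barK eta_bar _ ws_c eq_ws) /W /wire_sum.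
transitivity (\sum_(c : {ffun half_edge n.+2 -> I} |
    admissible bar c ((x0, y0) :: map (map_wire h) Z))
  sgn (wires_sign eta e (@hpos _) c ((x0, y0) :: map (map_wire h) Z) (+) e (c y0))
    * Yprod (restrict c)).
  apply: eq_bigr => c /andP[/eqP /= cy _]; rewrite gluedE cy eqxx mulrA.
  by rewrite -signr_addb.
(* The label of the loop is a free summation variable; summing its parity sign produces the
   superdimension. *)
pose J (p : I * {ffun half_edge n.+1 -> I}) := extend p.2 p.1 (bar p.1).
rewrite (reindex_onto J (fun c => (c x0, restrict c))); last first.
  by move=> c /andP[/eqP/= cx _]; rewrite /J /= -cx extend_restrict.
rewrite mulr_suml; under [RHS]eq_bigr do rewrite mulr_sumr.
rewrite pair_big_dep /=; apply: eq_big => -[l c] /=.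
  rewrite restrict_extend /paired extend_inner_l extend_inner_r eqxx andTb /=.
  rewrite (_ : [ffun z => c z] = c); last by apply/ffunP=> z; rewrite ffunE.
  by rewrite eqxx andbT admissible_map; apply: eq_admissible => z _; apply: extend_emb.
case/andP=> /andP[_ okZ] /eqP[_ rJ].
rewrite wires_sign_loop; [|by rewrite extend_inner_l extend_inner_r|by rewrite -admissible_map].
rewrite rJ extend_inner_l addbC signr_addb mulrA; congr (_ * sgn _ * _).
by apply: eq_wires_sign => z _; rewrite /= extend_emb.
Qed.

End Gluing.

(** * Permutations as matchings *)

Section Paths.
Variable m : nat.
Implicit Types (x y z : half_edge m) (P Q : seq (half_edge m)) (ks : seq 'I_m).

(* The letters of a path are given by the half-edge through which it enters. *)
Fixpoint path_wires x P y : seq (half_edge m * half_edge m) :=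
  if P is p :: P' then (x, p) :: path_wires (other_side p) P' y else [:: (x, y)].

Definition word_halves ks : seq (half_edge m) := [seq (k, false) | k <- ks].

Lemma path_wires_cat x P p Q y : path_wires x (P ++ p :: Q) y =
  path_wires x P p ++ path_wires (other_side p) Q y.
Proof. by elim: P x => //= q P IH x; rewrite IH. Qed.

(** Read backwards, a path enters each letter through the half-edge by which it used to leave. *)
Lemma eqw_path_wires_rev x P y :
  eqw (@hpos m) (path_wires x P y) (path_wires y (rev (map (@other_side m) P)) x).
Proof.
elim: P x => /= [|p P IH] x.
  exact: eqw_swap (@hpos_inj m) (x, y) [::].
rewrite rev_cons -cats1 path_wires_cat /= other_sideK.
apply: (@eqw_trans _ _ ((p, x) :: path_wires (other_side p) P y)).
  exact: (eqw_swap (@hpos_inj m) (x, p)).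
apply: (@eqw_trans _ _ ([:: (p, x)] ++ path_wires y (rev (map (@other_side m) P)) (other_side
  p))).
  exact: (@eqw_cat _ _ [:: _]) (eqw_refl _ _) (IH _).
by apply: perm_eqw; rewrite perm_catC.
Qed.

(** The wire [(z, f)] is the junction between the two words. The free ends [w] allow cutting it
    there and attaching the inner half-edges to the two pieces. *)
Lemma path_wires_join x P Q y : exists z f, exists Z Z',
  [/\ forall w, path_wires x P w = rcons Z (z, w), forall w, path_wires w Q y = (w, f) :: Z'
    & path_wires x (P ++ Q) y = Z ++ (z, f) :: Z'].
Proof.
have [z [Z EP]] : exists z Z, forall w, path_wires x P w = rcons Z (z, w).
  case/lastP: P => [|P p]; first by exists x, [::].
  by exists (other_side p), (path_wires x P p) => w; rewrite -cats1 path_wires_cat cats1.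
case: Q => [|q Q] /=.
  by exists z, y, Z, [::]; split=> //; rewrite cats0 EP cats1.
exists z, q, Z, (path_wires (other_side q) Q y); split=> //.
by rewrite path_wires_cat EP cat_rcons.
Qed.

Lemma mem_ends_path_wires x P y z :
  z \in ends (path_wires x P y) -> [\/ z = x, z = y | exists2 p, p \in P & z = p \/ z =
    other_side p].
Proof.
elim: P x => [|p P IH] x /=; rewrite !inE.
  by case/orP=> /eqP->; [apply: Or31 | apply: Or32].
case/or3P=> [/eqP->|/eqP->|/IH]; first exact: Or31.
  by apply: Or33; exists p; rewrite ?mem_head //; left.
case=> [->|->|[q qP zq]]; [|exact: Or32|]; last by apply: Or33; exists q; rewrite ?inE ?qP ?orbT.
by apply: Or33; exists p; rewrite ?mem_head //; right.
Qed.

Lemma flips_other_side ks x : flips ks (other_side x) = other_side (flips ks x).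
Proof. by rewrite /flips /=; case: ifP. Qed.

Lemma flip_flips (k : 'I_m) : flip k =1 flips [:: k].
Proof. by move=> x; rewrite /flip /flips inE. Qed.

Lemma flipsK ks : involutive (flips ks).
Proof. by move=> x; rewrite /flips; case: (boolP (x.1 \in ks)) => [|/negPf] /= ->;
  rewrite ?other_sideK. Qed.

Lemma map_flips_path_wires ks x P y : map (map_wire (flips ks)) (path_wires x P y) =
  path_wires (flips ks x) (map (flips ks) P) (flips ks y).
Proof. by elim: P x => //= p P IH x; rewrite IH flips_other_side. Qed.

Lemma flips_out ks P : {in P, forall p, p.1 \notin ks} -> map (flips ks) P = P.
Proof.
by move=> Pks; rewrite -[RHS]map_id; apply/eq_in_map => p /Pks/negPf pk; rewrite /flips pk.
Qed.

Lemma flips_in ks P : {in P, forall p, p.1 \in ks} -> map (flips ks) P = map (@other_side m) P.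
Proof. by move=> Pks; apply/eq_in_map => p /Pks pk; rewrite /flips pk. Qed.

Lemma flips_wires_out ks Z : {in ends Z, forall p, p.1 \notin ks} ->
  map (map_wire (flips ks)) Z = Z.
Proof.
elim: Z => //= -[x y] Z IH Zks; rewrite IH => [|z zZ]; last first.
  by apply: Zks; rewrite !inE zZ !orbT.
by congr (_ :: _); rewrite /map_wire /flips !ifN ?Zks ?inE ?eqxx ?orbT.
Qed.

End Paths.

Lemma map_path_wires (m n : nat) (f : half_edge m -> half_edge n) x P y :
  {in P, forall p, f (other_side p) = other_side (f p)} ->
  map (map_wire f) (path_wires x P y) = path_wires (f x) (map f P) (f y).
Proof.
elim: P x => //= p P IH x fP; rewrite IH ?fP ?mem_head // => q qP.
by apply: fP; rewrite inE qP orbT.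
Qed.

Section PermWires.
Variable m : nat.
Implicit Types (s : 'S_m) (k : 'I_m) (c : seq 'I_m).

Definition wire s k : half_edge m * half_edge m := ((k, true), (s k, false)).

Definition wires s : seq (half_edge m * half_edge m) := map (wire s) (enum 'I_m).

Definition cycle_wires c : seq (half_edge m * half_edge m) :=
  if c is k :: P then path_wires (k, true) (word_halves P) (k, false) else [::].

Lemma complete_wires s : complete (wires s).
Proof.
apply: uniq_perm => [||[k b]]; last 1 first.
- rewrite mem_enum inE; apply/flatten_mapP; case: b.
    by exists (wire s k); rewrite ?inE ?eqxx // map_f // mem_enum.
  by exists (wire s (s^-1 k)%g); rewrite ?inE /= ?permKV ?eqxx ?orbT // map_f // mem_enum.
- have: uniq (enum 'I_m) := enum_uniq _; rewrite /wires;
  elim: (enum _) => //= k c IH /andP[kc uc].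
  rewrite !inE xpair_eqE andbF /= IH // andbT; apply/andP; split.
    apply/flatten_mapP=> -[w /mapP[l lc ->]]; rewrite !inE !xpair_eqE andbF orbF andbT => /eqP kl.
    by rewrite kl lc in kc.
  apply/flatten_mapP=> -[w /mapP[l lc ->]]; rewrite !inE !xpair_eqE andbF /= andbT.
  by rewrite (inj_eq perm_inj) => /eqP kl; rewrite kl lc in kc.
exact: enum_uniq.
Qed.

Lemma wire_path s k P l : fpath s k (rcons P l) ->
  [seq wire s i | i <- k :: P] = path_wires (k, true) (word_halves P) (l, false).
Proof.
elim: P k => [|p P IH] k /=; first by rewrite andbT /wire => /eqP->.
by case/andP=> /eqP skp /IH {}IH; rewrite -[LHS]/(_ :: [seq _ | _ <- p :: P]) IH /wire skp.
Qed.

Lemma wire_cycle s c : fcycle s c -> [seq wire s i | i <- c] = cycle_wires c.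
Proof. by case: c => // k P /wire_path. Qed.

Lemma porbit_cycle s c k l : fcycle s c -> k \in c -> (l \in porbit s k) = (l \in c).
Proof.
move=> sc kc; rewrite -(fconnect_cycle sc kc).
apply/porbitP/idP=> [[i ->]|/iter_findex <-]; first by rewrite permX fconnect_iter.
by exists (findex s k l); rewrite permX.
Qed.

End PermWires.

Lemma eq_perm_eq (T : eqType) (xs ys : seq T) : xs = ys -> perm_eq xs ys.
Proof. by move->. Qed.

(** * The wires of a contracted permutation *)

Section Contract.
Variables (n : nat) (r : 'I_n.+1) (s : 'S_n.+2) (P Q : seq 'I_n.+2).
Let r1 := fst_letter r.
Let r2 := snd_letter r.
Let h := emb r.
Let p := map (collapse r) P.
Let q := map (collapse r) Q.
Hypothesis letters_uniq : uniq (r1 :: r2 :: P ++ Q).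
Hypothesis letters_porbit : forall k,
  (k \in porbit s r1) || (k \in porbit s r2) = (k \in r1 :: r2 :: P ++ Q).

Definition rest_wires : seq (half_edge n.+1 * half_edge n.+1) :=
  [seq ((k, true), (collapse r (s (lift r2 k)), false))
     | k <- enum 'I_n.+1 & k \notin r :: p ++ q].

Lemma collapse_words : r :: p ++ q = map (collapse r) (r1 :: P ++ Q).
Proof. by rewrite /= collapse_fst map_cat. Qed.

Lemma letters_snd : r2 \notin r1 :: P ++ Q.
Proof.
by move: letters_uniq; rewrite /= !inE !negb_or eq_sym => /and3P[/andP[-> _] -> _].
Qed.

Lemma neq_snd k : k \in r1 :: P ++ Q -> k != r2.
Proof. by move=> kL; apply: contraNneq letters_snd => <-. Qed.

Lemma mem_letters k : (k \in r1 :: r2 :: P ++ Q) = (k == r2) || (k \in r1 :: P ++ Q).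
Proof. by rewrite !inE orbCA. Qed.

Lemma mem_collapse k : (collapse r k \in r :: p ++ q) = (k \in r1 :: r2 :: P ++ Q).
Proof.
rewrite mem_letters; have [->|kr] /= := eqVneq k r2; first by rewrite collapse_snd mem_head.
rewrite collapse_words; apply/mapP/idP=> [[l lL]|kL]; last by exists k.
by move/(collapse_inj kr (neq_snd lL))->.
Qed.

Lemma uniq_collapse : uniq (r :: p ++ q).
Proof.
rewrite collapse_words map_inj_in_uniq; last first.
  by move=> k l /neq_snd kr /neq_snd lr; apply: collapse_inj.
by move: letters_uniq; rewrite /= !inE !negb_or => /and3P[/andP[_ ->] _ ->].
Qed.

Lemma mem_lift k : (k \in r :: p ++ q) = (lift r2 k \in r1 :: r2 :: P ++ Q).
Proof. by rewrite -mem_collapse collapse_lift. Qed.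

Lemma perm_letters k : (s k \in r1 :: r2 :: P ++ Q) = (k \in r1 :: r2 :: P ++ Q).
Proof.
rewrite -!letters_porbit; have E l : (s k \in porbit s l) = (k \in porbit s l).
  by rewrite -!eq_porbit_mem -(porbit_perm s 1 k) expg1.
by rewrite !E.
Qed.

(** A cycle avoiding [r] and [r + 1] never meets the letters that [collapse] identifies, so [emb]
    undoes the renumbering on it. *)
Lemma rest_emb :
  perm_eq [seq wire s k | k <- enum 'I_n.+2 & k \notin r1 :: r2 :: P ++ Q]
          (map (map_wire h) rest_wires).
Proof.
have E : perm_eq [seq k <- enum 'I_n.+2 | k \notin r1 :: r2 :: P ++ Q]
    (map (lift r2) [seq k <- enum 'I_n.+1 | k \notin r :: p ++ q]).
  apply: uniq_perm => [||k]; first exact/filter_uniq/enum_uniq.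
    by rewrite (map_inj_uniq (@lift_inj _ r2)) filter_uniq ?enum_uniq.
  rewrite mem_filter mem_enum andbT; apply/idP/mapP=> [kL|[l]]; last first.
    by rewrite mem_filter mem_lift => /andP[lL _] ->.
  have kr : k != r2 by apply: contraNneq kL => ->; rewrite !inE eqxx orbT.
  exists (collapse r k); last by rewrite lift_collapse.
  by rewrite mem_filter mem_lift lift_collapse // kL mem_enum.
rewrite (permPl (perm_map _ E)); apply: eq_perm_eq; rewrite /rest_wires -!map_comp.
apply/eq_in_map => k; rewrite mem_filter => /andP[kL _] /=.
have kr : k != r by apply: contraNneq kL => ->; rewrite mem_head.
have skL : s (lift r2 k) \notin r1 :: r2 :: P ++ Q by rewrite perm_letters -mem_lift.
rewrite /map_wire /h /emb /= (negPf kr) /= andbF lift_collapse //.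
by apply: contraNneq skL => ->; rewrite !inE eqxx orbT.
Qed.

(** The words in [cs] may distribute the letters in any order and into any number of cycles; every
    permutation on the right-hand side of (A4) is read off from a matching in this way. *)
Lemma wires_contract cs : perm_eq (flatten cs) (r :: p ++ q) ->
  perm_eq (wires (contract s r cs)) (flatten (map (@cycle_wires _) cs) ++ rest_wires).
Proof.
move=> eq_cs; have ucs : uniq (flatten cs) by rewrite (perm_uniq eq_cs) uniq_collapse.
have uE : contract s r cs =1 contract_fun s r cs.
  by apply: contractE => // k; rewrite (perm_mem eq_cs) mem_collapse letters_porbit.
have E : perm_eq (enum 'I_n.+1) (flatten cs ++ [seq k <- enum 'I_n.+1 | k \notin r :: p ++ q]).
  apply: uniq_perm => [||k]; first exact: enum_uniq.
    rewrite cat_uniq ucs filter_uniq ?enum_uniq // andbT; apply/hasPn=> k.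
    by rewrite mem_filter -(perm_mem eq_cs) => /andP[].
  by rewrite mem_cat [in RHS]mem_filter !mem_enum (perm_mem eq_cs) andbT orbN.
rewrite (permPl (perm_map _ E)) map_cat; apply: eq_perm_eq; congr (_ ++ _).
  rewrite map_flatten; congr flatten; apply/eq_in_map=> c ccs; apply: wire_cycle.
  have uc : uniq c.
    elim: cs ucs ccs {eq_cs uE E} => //= b l IH; rewrite cat_uniq inE.
    by case/and3P=> ub _ ul /predU1P[->|/IH->].
  apply: (sub_in_cycle (P := mem c) _ _ (cycle_next uc)); last exact/allP.
  move=> x y xc _ /= /eqP <-; rewrite uE.
  have xcs : x \in flatten cs by apply/flattenP; exists c.
  have [d [dcs xd ->]] := contract_fun_in s r xcs.
  by rewrite (uniq_flatten_inj ucs ccs dcs xc xd).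
apply/eq_in_map=> k; rewrite mem_filter => /andP[kL _].
by rewrite /wire uE contract_fun_out // (perm_mem eq_cs).
Qed.

End Contract.

Lemma wires_conj n (r : 'I_n.+1) (s : 'S_n.+2) :
  eqw (@hpos _) (wires (s ^ tperm (fst_letter r) (snd_letter r))%g)
    (map (map_wire (swap_blocks r)) (wires s)).
Proof.
set t := tperm _ _; apply: perm_eqw.
have E : perm_eq (enum 'I_n.+2) (map t (enum 'I_n.+2)).
  apply: uniq_perm => [||k]; first exact: enum_uniq.
    by rewrite map_inj_uniq ?enum_uniq //; apply: perm_inj.
  by rewrite mem_enum -(tpermK (fst_letter r) (snd_letter r) k) map_f ?mem_enum.
rewrite (permPl (perm_map _ E)) -!map_comp; apply: eq_perm_eq.
by apply: eq_map => k; rewrite /= /wire /map_wire /swap_blocks /= permJ.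
Qed.

(** * The recurrence rule *)

(** Two concatenations are permutations of each other when every predicate has the same count on
    both, which is linear arithmetic. *)
Ltac perm_lia :=
  apply/seq.permP=> ?; rewrite ?map_cat -?cats1 /= ?(count_cat, map_cat) /= ?count_cat /=; lia.

Section RecurrenceRule.
Variables (I : finType) (bar : I -> I) (eta e : I -> bool).
Hypotheses (barK : involutive bar) (eta_bar : forall a, eta (bar a) = eta a).
Hypothesis e_bar : forall a, e (bar a) = e a (+) eta a.
Variables (U : nzRingType) (Y : I -> I -> U).
Hypothesis Y_skew : skew eta Y.

Notation W := (diagram_sum bar eta e Y).
Notation B := (glued_sum bar eta e Y).

Lemma diagram_sum_eqw m (ws ws' : seq (half_edge m * half_edge m)) :
  complete ws -> eqw (@hpos m) ws ws' -> W ws = W ws'.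
Proof. by move=> ws_c eq_ws; apply: wire_sum_eqw. Qed.

Lemma diagram_sum_eqw_flips m ks (ws ws' : seq (half_edge m * half_edge m)) : uniq ks ->
  complete ws' ->
  eqw (@hpos m) ws (map (map_wire (flips ks)) ws') -> W ws = (-1) ^+ size ks * W ws'.
Proof.
move=> uks ws'_c eq_ws; rewrite -(diagram_sum_flips eta_bar e_bar Y_skew uks ws'_c); apply/esym.
by apply: diagram_sum_eqw; [apply: complete_map ws'_c;
  exact: inv_inj (flipsK ks) | rewrite eqw_sym].
Qed.

Section Glue.
Variables (n : nat) (r : 'I_n.+1).
Let h := emb r.
Let x0 := inner_l r.
Let y0 := inner_r r.
Implicit Types (ws : seq (half_edge n.+2 * half_edge n.+2)) (Z : seq (half_edge n.+1 * half_edge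
  n.+1)).

Lemma emb_other_side x : x.1 != r -> h (other_side x) = other_side (h x).
Proof. by case: x => k b /negPf /= kr; rewrite /h /emb /= kr. Qed.

Lemma map_emb_path_wires x (X : seq (half_edge n.+1)) y : {in X, forall z, z.1 != r} ->
  map (map_wire h) (path_wires x X y) = path_wires (h x) (map h X) (h y).
Proof. by move=> Xr; apply: map_path_wires => z /Xr/emb_other_side. Qed.

(** The two paths may meet the inner half-edges in either order, because reversing both of them
    exchanges [x0] and [y0]. *)
Lemma glued_sum_join ws a b u v (X1 X2 : seq (half_edge n.+1)) Z : complete ws ->
    {in X1, forall z, z.1 != r} -> {in X2, forall z, z.1 != r} ->
    (u, v) = (x0, y0) \/ (u, v) = (y0, x0) ->
    eqw (@hpos _) ws (path_wires (h a) (map h X1) u ++ path_wires v (map h X2) (h b) ++ map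
      (map_wire h) Z) ->
  B r ws = W (path_wires a (X1 ++ X2) b ++ Z).
Proof.
move=> ws_c X1r X2r uv eq_ws.
have [z [f [Z1 [Z2 [E1 E2 E]]]]] := path_wires_join a X1 X2 b.
have F1 w : path_wires (h a) (map h X1) w = rcons (map (map_wire h) Z1) (h z, w).
  have [z' [f' [Z1' [Z2' [E1' _ _]]]]] := path_wires_join (h a) (map h X1) [::] w.
  have := map_emb_path_wires a a X1r; rewrite E1 E1' map_rcons => /rcons_inj[E3 E4].
  by rewrite E1' -E3 -E4.
have F2 w : path_wires w (map h X2) (h b) = (w, h f) :: map (map_wire h) Z2.
  have [z' [f' [Z1' [Z2' [_ E2' _]]]]] := path_wires_join w [::] (map h X2) (h b).
  have := map_emb_path_wires a b X2r; rewrite E2 E2' /= => -[E3 E4].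
  by rewrite E2' -E3 -E4.
have eq1 : eqw (@hpos _) ws
    ((h z, u) :: (v, h f) :: map (map_wire h) (Z1 ++ Z2 ++ Z)).
  apply: eqw_trans eq_ws _; apply: perm_eqw; rewrite F1 F2; perm_lia.
case: uv => [] [uE vE]; subst u v.
  have [-> zf_c] := glued_sum_glue barK eta_bar e_bar Y ws_c eq1.
  apply: diagram_sum_eqw zf_c _; apply: perm_eqw; rewrite E; perm_lia.
(* With the inner half-edges in the other order, reversing both cut wires exchanges the roles of [z]
   and [f]. *)
have eq2 : eqw (@hpos _) ws
    ((h f, x0) :: (y0, h z) :: map (map_wire h) (Z1 ++ Z2 ++ Z)).
  apply: eqw_trans eq1 _; apply: (@eqw_cat _ _ [:: _; _] _ [:: _; _]) (eqw_refl _ _).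
  apply: (@eqw_trans _ _ [:: (h z, y0); (h f, x0)]).
    exact: (@eqw_cat _ _ [:: _] _ [:: _]) (eqw_refl _ _) (eqw_swap (@hpos_inj _) _ _).
  apply: (@eqw_trans _ _ [:: (y0, h z); (h f, x0)]); first exact: eqw_swap (@hpos_inj _) _ _.
  by apply: perm_eqw; perm_lia.
have [-> fz_c] := glued_sum_glue barK eta_bar e_bar Y ws_c eq2.
have eq_fz : eqw (@hpos _) ((f, z) :: Z1 ++ Z2 ++ Z) ((z, f) :: Z1 ++ Z2 ++ Z).
  exact: eqw_swap (@hpos_inj _) _ _.
rewrite (diagram_sum_eqw fz_c eq_fz).
apply: diagram_sum_eqw; first exact: complete_eqw eq_fz fz_c.
apply: perm_eqw; rewrite E; perm_lia.
Qed.

(** A path between the two inner half-edges closes up under gluing. Cut at its first letter, it is a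
    special case of joining two paths, the second of which has no letters. *)
Lemma glued_sum_close ws u v k (X : seq (half_edge n.+1)) Z : complete ws ->
    {in k :: X, forall z, z.1 != r} ->
    (u, v) = (x0, y0) \/ (u, v) = (y0, x0) ->
    eqw (@hpos _) ws (path_wires u (map h (k :: X)) v ++ map (map_wire h) Z) ->
  B r ws = W (path_wires (other_side k) X k ++ Z).
Proof.
move=> ws_c kXr uv eq_ws; rewrite -[X]cats0.
have kr : k.1 != r by apply: kXr; rewrite mem_head.
apply: (@glued_sum_join ws (other_side k) k v u X [::] Z) => // [z zX||].
- by apply: kXr; rewrite inE zX orbT.
- by case: uv => -[-> ->]; [right|left].
apply: eqw_trans eq_ws _; apply: perm_eqw; rewrite /= -emb_other_side //; perm_lia.
Qed.

End Glue.
End RecurrenceRule.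

(** * The four glued diagrams for two adjacent letters *)

Section TwoLetters.
Variables (I : finType) (bar : I -> I) (eta e : I -> bool).
Hypotheses (barK : involutive bar) (eta_bar : forall a, eta (bar a) = eta a).
Hypothesis e_bar : forall a, e (bar a) = e a (+) eta a.
Variables (U : nzRingType) (Y : I -> I -> U).
Hypotheses (Y_skew : skew eta Y) (Y_comm : osp_commutation bar eta e Y).

Notation sgn b := ((-1) ^+ (nat_of_bool b) : U).
Notation W := (diagram_sum bar eta e Y).
Notation B := (glued_sum bar eta e Y).

Variables (n : nat) (r : 'I_n.+1) (s : 'S_n.+2) (P Q : seq 'I_n.+2).
Let r1 := fst_letter r.
Let r2 := snd_letter r.
Let h := emb r.
Let x0 := inner_l r.
Let y0 := inner_r r.
Let p := map (collapse r) P.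
Let q := map (collapse r) Q.
Let vL : half_edge n.+1 := (r, false).
Let vR : half_edge n.+1 := (r, true).
Let wp := word_halves p.
Let wq := word_halves q.
Hypothesis letters_uniq : uniq (r1 :: r2 :: P ++ Q).
Hypothesis letters_porbit : forall k,
  (k \in porbit s r1) || (k \in porbit s r2) = (k \in r1 :: r2 :: P ++ Q).

Notation t k := (map (map_wire (flip k))).
Notation rest := (rest_wires r s P Q).

Lemma emb_vL : h vL = (r1, false).
Proof. by rewrite /h /emb /= eqxx lift_fst. Qed.

Lemma emb_vR : h vR = (r2, true).
Proof. by rewrite /h /emb /= eqxx. Qed.

Let pq_uniq : uniq (r :: p ++ q). Proof. exact: uniq_collapse letters_uniq. Qed.

Lemma V_out_p : r \notin p.
Proof. by move: pq_uniq; rewrite /= mem_cat negb_or => /andP[/andP[]]. Qed.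

Lemma V_out_q : r \notin q.
Proof. by move: pq_uniq; rewrite /= mem_cat negb_or => /andP[/andP[]]. Qed.

Lemma p_out_q : {in p, forall k, k \notin q}.
Proof.
move=> k kp; apply/negP=> kq; move: pq_uniq; rewrite /= cat_uniq => /and4P[_ _ /hasPn/(_ k kq)].
by rewrite /= kp.
Qed.

Lemma word_halves_out ks x : {in x, forall k, k \notin ks} ->
  map (flips ks) (word_halves x) = word_halves x :> seq (half_edge n.+1).
Proof. by move=> xks; apply: flips_out => _ /mapP[k kx ->]; apply: xks. Qed.

Lemma word_halves_in ks x : {subset x <= ks} ->
  map (flips ks) (word_halves x) = map (@other_side _) (word_halves x) :> seq (half_edge n.+1).
Proof. by move=> xks; apply: flips_in => _ /mapP[k kx ->]; apply: xks. Qed.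

Lemma word_neqV x : r \notin x -> {in word_halves x, forall z, z.1 != r}.
Proof. by move=> rx _ /mapP[k kx ->] /=; apply: contraNneq rx => <-. Qed.

Lemma other_side_word_neqV x : r \notin x ->
  {in rev (map (@other_side _) (word_halves x)), forall z, z.1 != r}.
Proof. by move=> rx z; rewrite mem_rev => /mapP[y /(word_neqV rx) yr ->]. Qed.

Lemma rev_other_side_word (x : seq 'I_n.+1) :
  rev (map (@other_side _) (word_halves x)) = map (@other_side _) (word_halves (rev x)).
Proof. by rewrite /word_halves !map_rev. Qed.

Lemma emb_rev_other_side x : r \notin x ->
  rev (map (@other_side _) (map h (word_halves x))) =
    map h (rev (map (@other_side _) (word_halves x))).
Proof.
move=> rx; rewrite map_rev -!map_comp; congr rev; apply/eq_in_map=> k kx /=.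
by rewrite -emb_other_side //=; apply: contraNneq rx => <-.
Qed.

Lemma emb_word_halves X : r1 \notin X -> r2 \notin X ->
  word_halves X = map h (word_halves (map (collapse r) X)).
Proof.
move=> X1 X2; rewrite /word_halves -!map_comp; apply/eq_in_map=> k kX /=.
have k2 : k != r2 by apply: contraNneq X2 => <-.
rewrite /h /emb /= andbF lift_collapse //.
Qed.

Lemma rest_out ks : {subset ks <= r :: p ++ q} -> map (map_wire (flips ks)) rest = rest.
Proof.
move=> ksL; apply: flips_wires_out => z /flatten_mapP[_ /mapP[k + ->]].
rewrite mem_filter => /andP[kL _]; rewrite !inE => /orP[]/eqP-> /=.
  by apply: contra kL => /ksL.
have skL : s (lift r2 k) \notin r1 :: r2 :: P ++ Q.
  by rewrite (perm_letters letters_porbit) -mem_lift.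
by apply: contra skL => /ksL; rewrite mem_collapse.
Qed.

Lemma rest_neqV z : z \in ends rest -> z.1 != r.
Proof.
case/flatten_mapP=> _ /mapP[k + ->].
rewrite mem_filter => /andP[kL _]; rewrite !inE => /orP[]/eqP-> /=.
  by apply: contraNneq kL => ->; rewrite mem_head.
have skL : s (lift r2 k) \notin r1 :: r2 :: P ++ Q.
  by rewrite (perm_letters letters_porbit) -mem_lift.
by apply: contraNneq skL => E; rewrite -mem_collapse // E mem_head.
Qed.

Lemma emb_letter z : z.1 != r -> ((h z).1 != r1) && ((h z).1 != r2).
Proof.
case: z => k b /= kr; rewrite /h /emb /= (negPf kr) /= /r1 -lift_fst (inj_eq lift_inj) kr.
by rewrite eq_sym neq_lift.
Qed.

Lemma flip_rest k : k \in [:: r1; r2] -> t k (map (map_wire h) rest) = map (map_wire h) rest.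
Proof.
move=> kr; rewrite (eq_map (_ : map_wire (flip k) =1 map_wire (flips [:: k]))); last first.
  by move=> w; rewrite /map_wire !flip_flips.
apply: flips_wires_out => z; rewrite ends_map => /mapP[y /rest_neqV/emb_letter yr ->].
by move: kr yr; rewrite !inE => /orP[]/eqP-> /andP[].
Qed.

Lemma flip_word k (X : seq (half_edge n.+1)) : k \in [:: r1; r2] ->
  {in X, forall z, z.1 != r} -> map (flip k) (map h X) = map h X.
Proof.
move=> kr Xr; rewrite (eq_map (flip_flips k));
  apply: flips_out => _ /mapP[y /Xr/emb_letter yr ->].
by move: kr yr; rewrite !inE => /orP[]/eqP-> /andP[].
Qed.

Lemma flip_path k x (X : seq (half_edge n.+1)) y : k \in [:: r1; r2] ->
  {in X, forall z, z.1 != r} ->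
  t k (path_wires x (map h X) y) = path_wires (flip k x) (map h X) (flip k y).
Proof.
move=> kr Xr; rewrite -[in RHS](flip_word kr Xr) (eq_map (flip_flips k)) !flip_flips.
rewrite -map_flips_path_wires; apply: eq_map => w; rewrite /map_wire !flip_flips //.
Qed.

Let r21 : (r2 == r1) = false. Proof. by rewrite eq_sym; apply/negbTE/fst_snd_neq. Qed.
Let r12 : (r1 == r2) = false. Proof. exact/negbTE/fst_snd_neq. Qed.

Lemma flip1E : [/\ flip r1 x0 = h vL, flip r1 (h vL) = x0, flip r1 y0 = y0 & flip r1 (h vR) =
  h vR].
Proof. by rewrite emb_vL emb_vR /flip /x0 /y0 /inner_l /inner_r /= !eqxx r21. Qed.

Lemma flip2E : [/\ flip r2 x0 = x0, flip r2 (h vL) = h vL, flip r2 y0 =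
  h vR & flip r2 (h vR) = y0].
Proof. by rewrite emb_vL emb_vR /flip /x0 /y0 /inner_l /inner_r /= !eqxx r12. Qed.

(** The words [r1 :: P] and [r2 :: Q] are either two cycles of [s] or the two arcs of one cycle, and
    the splitting serves both cases. *)
Lemma wires_split : eqw (@hpos _) (wires s)
  ([seq wire s k | k <- r1 :: P] ++ [seq wire s k | k <- r2 :: Q] ++ map (map_wire h) rest).
Proof.
have rest_e := rest_emb letters_uniq letters_porbit.
apply: perm_eqw; rewrite -(permPr (perm_cat (perm_refl _) (perm_cat (perm_refl _) rest_e))).
rewrite -!map_cat; apply: perm_map.
have E : perm_eq (r1 :: r2 :: P ++ Q) ((r1 :: P) ++ (r2 :: Q)) by perm_lia.
rewrite catA; apply: uniq_perm => [||k]; first exact: enum_uniq.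
  rewrite cat_uniq -(perm_uniq E) letters_uniq filter_uniq ?enum_uniq // andbT.
  by apply/hasPn=> k; rewrite mem_filter -(perm_mem E) => /andP[].
by rewrite mem_cat [in RHS]mem_filter !mem_enum -(perm_mem E) andbT orbN.
Qed.

Lemma one_cycle_complete x : perm_eq (r :: x) (r :: p ++ q) ->
  complete (path_wires vR (word_halves x) vL ++ rest).
Proof.
move=> eq_x; apply: complete_eqw (complete_wires (contract s r [:: r :: x])).
have := wires_contract letters_uniq letters_porbit (cs := [:: r :: x]).
by rewrite /= !cats0 => /(_ eq_x)/perm_eqw.
Qed.

Lemma diagram_sum_one_cycle x : perm_eq (r :: x) (r :: p ++ q) ->
  W (path_wires vR (word_halves x) vL ++ rest) = W (wires (contract s r [:: r :: x])).
Proof.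
move=> eq_x; apply: diagram_sum_eqw => //; first exact: one_cycle_complete.
have := wires_contract letters_uniq letters_porbit (cs := [:: r :: x]).
by rewrite /= !cats0 eqw_sym => /(_ eq_x)/perm_eqw.
Qed.

Lemma flips_path ks a X b : {subset ks <= r :: p ++ q} ->
  map (map_wire (flips ks)) (path_wires a X b ++ rest) =
  path_wires (flips ks a) (map (flips ks) X) (flips ks b) ++ rest.
Proof. by move=> ksL; rewrite map_cat map_flips_path_wires rest_out. Qed.

Let qs_sub : {subset q <= r :: p ++ q}.
Proof. by move=> k kp; rewrite inE mem_cat kp !orbT. Qed.
Let p_neqV := word_neqV V_out_p.
Let q_neqV := word_neqV V_out_q.
Let rp_neqV := other_side_word_neqV V_out_p.
Let rq_neqV := other_side_word_neqV V_out_q.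
Let q_uniq : uniq q.
Proof. by move: pq_uniq; rewrite /= cat_uniq => /and4P[]. Qed.
Let rq_uniq : uniq (r :: q). Proof. by rewrite /= V_out_q. Qed.
Let one_sub : {subset [:: r] <= r :: p ++ q}.
Proof. by move=> k; rewrite !inE => ->. Qed.
Let rq_sub : {subset r :: q <= r :: p ++ q}.
Proof. by move=> k; rewrite !inE mem_cat => /orP[->|->]; rewrite ?orbT. Qed.
Let perm_pq' : perm_eq (r :: q ++ p) (r :: p ++ q). Proof. by perm_lia. Qed.
Let perm_p_q : perm_eq (p ++ r :: q) (r :: p ++ q).
Proof. by rewrite perm_catC /= perm_cons perm_catC. Qed.
Let perm_prq : perm_eq (r :: p ++ rev q) (r :: p ++ q).
Proof. by rewrite perm_cons perm_cat2l perm_rev. Qed.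
Let perm_rqp : perm_eq (r :: rev q ++ p) (r :: p ++ q).
Proof. by rewrite -(permPr perm_pq') perm_cons perm_cat2r perm_rev. Qed.

Let p_out_rq : {in p, forall k, k \notin r :: q}.
Proof. by move=> k kp; rewrite inE negb_or p_out_q // andbT; apply: contraTneq kp => ->;
  exact: V_out_p. Qed.

Lemma flipsV ks : r \in ks -> (flips ks vR = vL) * (flips ks vL = vR).
Proof. by move=> rks; rewrite /flips /= rks. Qed.

Lemma flipsV_out ks : r \notin ks -> (flips ks vR = vR) * (flips ks vL = vL).
Proof. by move=> /negPf rks; rewrite /flips /= rks. Qed.

Let diagram_sum_by_flips ks (ws ws' : seq (half_edge n.+1 * half_edge n.+1)) : uniq ks ->
  complete ws' ->
  eqw (@hpos _) ws (map (map_wire (flips ks)) ws') -> W ws = (-1) ^+ size ks * W ws'.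
Proof. exact: diagram_sum_eqw_flips. Qed.

(** A path that runs through [q] backwards becomes the path of a permutation once each letter of [q]
    is flipped, at the cost of one sign per letter. *)
Lemma diagram_sum_flip_q : W (path_wires vR (rev (map (@other_side _) wq) ++ wp) vL ++ rest) =
  (-1) ^+ size Q * W (wires (contract s r [:: r :: rev q ++ p])).
Proof.
rewrite -diagram_sum_one_cycle // -[size Q](size_map (collapse r)).
apply: (diagram_sum_by_flips (ks := q)) => //; first exact: one_cycle_complete.
rewrite flips_path // !flipsV_out ?V_out_q // [word_halves (_ ++ _)]map_cat map_cat.
rewrite word_halves_in => [|k]; last by rewrite mem_rev.
by rewrite word_halves_out ?rev_other_side_word ?eqw_refl //; exact: p_out_q.
Qed.

(** Here the path also leaves [V] on the left and returns on the right, so [V] is flipped along with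
    [q] and the exponent grows by one. *)
Lemma diagram_sum_flip_Vq : W (path_wires vL (wp ++ rev (map (@other_side _) wq)) vR ++ rest) =
  (-1) ^+ (size Q).+1 * W (wires (contract s r [:: r :: p ++ rev q])).
Proof.
rewrite -diagram_sum_one_cycle // -[size Q](size_map (collapse r)).
apply: (diagram_sum_by_flips (ks := r :: q)) => //; first exact: one_cycle_complete.
rewrite flips_path // !flipsV ?mem_head // [word_halves (_ ++ _)]map_cat map_cat.
rewrite [map _ [seq _ | i <- rev q]]word_halves_in => [|k];
  last by rewrite mem_rev inE orbC => ->.
by rewrite word_halves_out ?rev_other_side_word ?eqw_refl //; exact: p_out_rq.
Qed.

Lemma flip_Vq' : path_wires vL (rev (map (@other_side _) wq) ++ wp) vR ++ rest =
  map (map_wire (flips (r :: q))) (path_wires vR (word_halves (rev q ++ p)) vL ++ rest).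
Proof.
rewrite flips_path // !flipsV ?mem_head // [word_halves (_ ++ _)]map_cat map_cat.
rewrite word_halves_in => [|k]; last by rewrite mem_rev inE orbC => ->.
by rewrite word_halves_out ?rev_other_side_word //; exact: p_out_rq.
Qed.

Lemma diagram_sum_flip_Vq' : W (path_wires vL (rev (map (@other_side _) wq) ++ wp) vR ++ rest) =
  (-1) ^+ (size Q).+1 * W (wires (contract s r [:: r :: rev q ++ p])).
Proof.
rewrite -diagram_sum_one_cycle // -[size Q](size_map (collapse r)).
apply: (diagram_sum_by_flips (ks := r :: q)) => //; first exact: one_cycle_complete.
by rewrite flip_Vq' eqw_refl.
Qed.

Lemma diagram_sum_flip_V x : {in x, forall k, k != r} -> perm_eq (r :: x) (r :: p ++ q) ->
  W (path_wires vL (word_halves x) vR ++ rest) = - W (wires (contract s r [:: r :: x])).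
Proof.
move=> xr eq_x; rewrite -diagram_sum_one_cycle // -mulN1r -[-1]expr1.
apply: (diagram_sum_by_flips (ks := [:: r])) => //; first exact: one_cycle_complete.
rewrite flips_path // !flipsV ?mem_head // word_halves_out ?eqw_refl // => k /xr.
by rewrite inE.
Qed.

Lemma diagram_sum_rec : W (wires s) = W (wires (s ^ tperm r1 r2)%g) +
  (B r (wires s) - B r (t r1 (wires s)) - B r (t r2 (wires s)) + B r (t r1 (t r2 (wires s)))).
Proof.
rewrite -(diagram_sum_recurrence eta_bar e_bar r Y_comm (complete_wires s)).
rewrite (diagram_sum_eqw _ barK eta_bar _ (complete_wires _) (wires_conj r s)).
by rewrite addrC subrK.
Qed.

Let r1in : r1 \in [:: r1; r2]. Proof. exact: mem_head. Qed.
Let r2in : r2 \in [:: r1; r2]. Proof. by rewrite !inE eqxx orbT. Qed.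

Let t_eqw k ws ws' : eqw (@hpos n.+2) ws ws' -> eqw (@hpos _) (t k ws) (t k ws').
Proof. exact: eqw_map (@hpos_inj _). Qed.

Let t_complete k (ws : seq (half_edge n.+2 * half_edge n.+2)) : complete ws -> complete (t k ws).
Proof. by apply: complete_map; exact: inv_inj (flipK k). Qed.

Let glued_sum_joined ws a b u v (X1 X2 : seq (half_edge n.+1)) Z : complete ws ->
    {in X1, forall z, z.1 != r} -> {in X2, forall z, z.1 != r} ->
    (u, v) = (x0, y0) \/ (u, v) = (y0, x0) ->
    eqw (@hpos _) ws (path_wires (h a) (map h X1) u ++ path_wires v (map h X2) (h b) ++ map
      (map_wire h) Z) ->
  B r ws = W (path_wires a (X1 ++ X2) b ++ Z).
Proof. exact: glued_sum_join. Qed.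

Section Distinct.
Hypothesis s_eqw : eqw (@hpos _) (wires s)
  (path_wires x0 (map h wp) (h vL) ++ path_wires (h vR) (map h wq) y0 ++ map (map_wire h) rest).

Lemma diagram_sum_distinct :
  let w_ x := W (wires (contract s r [:: r :: x])) in
  W (wires s) = W (wires (s ^ tperm r1 r2)%g) + w_ (q ++ p) - w_ (p ++ q)
    + (-1) ^+ size Q * (w_ (p ++ rev q) - w_ (rev q ++ p)).
Proof.
move=> w_; have s_c := complete_wires s.
have [f1 f2 f3 f4] := flip1E; have [g1 g2 g3 g4] := flip2E.
(* The end of [q] is glued to the start of [p]. *)
have B0 : B r (wires s) = w_ (q ++ p).
  rewrite /w_ -diagram_sum_one_cycle // [word_halves _]map_cat.
  apply: (@glued_sum_joined _ vR vL y0 x0 wq wp rest s_c q_neqV p_neqV (or_intror erefl)).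
  by apply: eqw_trans s_eqw _; apply: perm_eqw; apply/permPl; exact: perm_catCA.
have s2_eqw : eqw (@hpos _) (t r2 (wires s)) (path_wires x0 (map h wp) (h vL) ++
    path_wires y0 (map h wq) (h vR) ++ map (map_wire h) rest).
  apply: eqw_trans (t_eqw r2 s_eqw) _.
  by rewrite !map_cat !flip_path // flip_rest // g1 g2 g3 g4 eqw_refl.
(* The flip of [r2] puts the inner half-edge at the start of [q], so [q] is read backwards on the
   way from [V] to [p]. *)
have B2 : B r (t r2 (wires s)) = (-1) ^+ size Q * w_ (rev q ++ p).
  rewrite /w_ -diagram_sum_flip_q.
  apply: (@glued_sum_joined _ vR vL y0 x0 (rev (map (@other_side _) wq)) wp rest
    (t_complete _ s_c) rq_neqV p_neqV (or_intror erefl)).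
  apply: eqw_trans s2_eqw _.
  apply: (@eqw_trans _ _ (path_wires y0 (map h wq) (h vR) ++ path_wires x0 (map h wp) (h vL) ++
    map (map_wire h) rest)); first by apply/perm_eqw/permPl; exact: perm_catCA.
  by apply: eqw_cat (eqw_refl _ _); rewrite -emb_rev_other_side ?V_out_q // eqw_path_wires_rev.
have s12_eqw : eqw (@hpos _) (t r1 (t r2 (wires s))) (path_wires (h vL) (map h wp) x0 ++
    path_wires y0 (map h wq) (h vR) ++ map (map_wire h) rest).
  apply: eqw_trans (t_eqw r1 s2_eqw) _.
  by rewrite !map_cat !flip_path // flip_rest // f1 f2 f3 f4 eqw_refl.
(* After both flips the glued path leaves [V] on its left; flipping [V] back gives the minus
   sign. *)
have B12 : B r (t r1 (t r2 (wires s))) = - w_ (p ++ q).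
  rewrite /w_ -diagram_sum_flip_V // => [|k]; last first.
    rewrite mem_cat => /orP[kp|kq].
      by apply: contraTneq kp => ->; exact: V_out_p.
    by apply: contraTneq kq => ->; exact: V_out_q.
  rewrite [word_halves _]map_cat.
  exact: (@glued_sum_joined _ vL vR x0 y0 wp wq rest
    (t_complete _ (t_complete _ s_c)) p_neqV q_neqV (or_introl erefl)).
have s1_eqw : eqw (@hpos _) (t r1 (wires s)) (path_wires (h vL) (map h wp) x0 ++
    path_wires (h vR) (map h wq) y0 ++ map (map_wire h) rest).
  apply: eqw_trans (t_eqw r1 s_eqw) _.
  by rewrite !map_cat !flip_path // flip_rest // f1 f2 f3 f4 eqw_refl.
(* Both [V] and the letters of [q] are traversed in the wrong direction. *)
have B1 : B r (t r1 (wires s)) = (-1) ^+ (size Q).+1 * w_ (p ++ rev q).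
  rewrite /w_ -diagram_sum_flip_Vq.
  apply: (@glued_sum_joined _ vL vR x0 y0 wp (rev (map (@other_side _) wq)) rest
    (t_complete _ s_c) p_neqV rq_neqV (or_introl erefl)).
  apply: eqw_trans s1_eqw _; apply: eqw_cat (eqw_refl _ _) _.
  by apply: eqw_cat (eqw_refl _ _); rewrite -emb_rev_other_side ?V_out_q // eqw_path_wires_rev.
rewrite diagram_sum_rec B0 B1 B2 B12 exprS mulN1r mulNr opprK mulrBr.
by rewrite -!addrA; congr (_ + (_ + _)); rewrite addrA addrC.
Qed.

End Distinct.

Section Same.
Hypothesis s_eqw : eqw (@hpos _) (wires s)
  (path_wires x0 (map h wp) y0 ++ path_wires (h vR) (map h wq) (h vL) ++ map (map_wire h) rest).

Let C0 : U := \sum_l sgn (eta l).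

Let glued_sum_closed ws u v k (X : seq (half_edge n.+1)) Z : complete ws ->
    {in k :: X, forall z, z.1 != r} ->
    (u, v) = (x0, y0) \/ (u, v) = (y0, x0) ->
    eqw (@hpos _) ws (path_wires u (map h (k :: X)) v ++ map (map_wire h) Z) ->
  B r ws = W (path_wires (other_side k) X k ++ Z).
Proof. exact: glued_sum_close. Qed.

Lemma two_cycles_complete c1 c2 : perm_eq (c1 ++ c2) (r :: p ++ q) ->
  complete (cycle_wires c1 ++ cycle_wires c2 ++ rest).
Proof.
move=> eq_c; apply: complete_eqw (complete_wires (contract s r [:: c1; c2])).
have := wires_contract letters_uniq letters_porbit (cs := [:: c1; c2]).
by rewrite /= !cats0 -catA => /(_ eq_c)/perm_eqw.
Qed.

Lemma diagram_sum_two_cycles c1 c2 : perm_eq (c1 ++ c2) (r :: p ++ q) ->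
  W (cycle_wires c1 ++ cycle_wires c2 ++ rest) = W (wires (contract s r [:: c1; c2])).
Proof.
move=> eq_c; apply: diagram_sum_eqw => //; first exact: two_cycles_complete.
have := wires_contract letters_uniq letters_porbit (cs := [:: c1; c2]).
by rewrite /= !cats0 -catA eqw_sym => /(_ eq_c)/perm_eqw.
Qed.

Lemma map_rest_path x (X : seq (half_edge n.+1)) y : {in X, forall z, z.1 != r} ->
  map (map_wire h) (path_wires x X y ++ rest) =
  path_wires (h x) (map h X) (h y) ++ map (map_wire h) rest.
Proof. by move=> Xr; rewrite map_cat map_emb_path_wires. Qed.

(** With no letter between them the inner half-edges are already joined, and gluing closes them into
    a loop: this is the factor C_0 that stands for an empty cycle. *)
Lemma glued_sum_same_nil : P = [::] ->
  B r (wires s) = C0 * W (wires (contract s r [:: r :: q])).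
Proof.
move=> P0; have p0 : p = [::] by rewrite /p P0.
have eqs : eqw (@hpos _) (wires s) ((x0, y0) :: map (map_wire h) (path_wires vR wq vL ++ rest)).
  by rewrite map_rest_path //; move: s_eqw; rewrite /wp p0.
have [-> q_c] := glued_sum_loop barK eta_bar e_bar Y (complete_wires s) eqs.
by rewrite diagram_sum_one_cycle // p0.
Qed.

Lemma glued_sum_same_cons : P != [::] ->
  B r (wires s) = W (wires (contract s r [:: p; r :: q])).
Proof.
move=> P0; have [k [X pE]] : exists k X, p = k :: X.
  by rewrite /p; case: (P) P0 => // k X _; exists (collapse r k), (map (collapse r) X).
have wpE : wp = (k, false) :: word_halves X by rewrite /wp pE.
have kX : {in (k, false) :: word_halves X, forall z : half_edge n.+1, z.1 != r} by rewrite -wpE.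
rewrite (@glued_sum_closed _ x0 y0 (k, false) (word_halves X) (path_wires vR wq vL ++ rest)
  (complete_wires s) kX (or_introl erefl)); last by rewrite map_rest_path // -wpE.
rewrite -[LHS]/(W (cycle_wires (k :: X) ++ cycle_wires (r :: q) ++ rest)) -pE.
exact: (@diagram_sum_two_cycles p (r :: q) perm_p_q).
Qed.

Let p_notV : {in p, forall k, k != r}.
Proof. by move=> k kp; apply: contraTneq kp => ->; exact: V_out_p. Qed.

(* Flipping [V] maps the loop at [V] to itself, so the sum is its own opposite. *)
Lemma glued_sum_same0 : (forall x : U, x = - x -> x = 0) -> Q = [::] -> B r (wires s) = 0.
Proof.
move=> U_char Q0; have q0 : q = [::] by rewrite /q Q0.
have W0 ws Z : complete ws -> eqw (@hpos _) ws ((vR, vL) :: Z) ->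
    {in ends Z, forall z, z.1 \notin [:: r]} -> W ws = 0.
  move=> ws_c eqZ Zr; apply: U_char; rewrite -[RHS]mulN1r -[-1]expr1.
  apply: (diagram_sum_by_flips (ks := [:: r])) => //; apply: eqw_trans (eqZ) _.
  apply: eqw_trans (eqw_map _ (@hpos_inj _) (_ : eqw _ _ ws)); last by rewrite eqw_sym;
    exact: eqZ.
  rewrite /= flips_wires_out // /map_wire !flipsV ?mem_head //.
  exact: eqw_swap (@hpos_inj _) (vR, vL) Z.
have rest_r : {in ends rest, forall z, z.1 \notin [:: r]}.
  by move=> z /rest_neqV; rewrite inE.
case: (eqVneq P [::]) => [P0|P0].
  rewrite glued_sum_same_nil // -diagram_sum_one_cycle //; last by rewrite /p P0.
  rewrite q0 (W0 _ rest) ?mulr0 //; last exact: eqw_refl.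
  by have := @one_cycle_complete [::]; apply; rewrite /p P0 q0.
rewrite glued_sum_same_cons // -(@diagram_sum_two_cycles p (r :: q) perm_p_q) (W0 _ (cycle_wires
  p ++ rest)) //.
- exact: two_cycles_complete perm_p_q.
- by rewrite q0 /=; apply/perm_eqw/permPl; exact: (perm_catCA _ [:: _]).
move=> z; rewrite ends_cat mem_cat => /orP[|/rest_r//].
rewrite inE /cycle_wires; case: p p_notV => // k X kX.
have kr : k != r by apply: kX; rewrite mem_head.
case/mem_ends_path_wires=> [->|->|[y /mapP[l lX ->]]] //.
by case=> -> /=; apply: kX; rewrite inE lX orbT.
Qed.

(** The two flips exchange inner and outer half-edges, so the arc [q] now ends at the inner ones,
    while [p] closes up through [V] in the wrong direction. *)
Lemma glued_sum_t12_eqw : eqw (@hpos _) (t r1 (t r2 (wires s)))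
  (path_wires y0 (map h wq) x0 ++ map (map_wire h) (path_wires vL wp vR ++ rest)).
Proof.
have [f1 f2 f3 f4] := flip1E; have [g1 g2 g3 g4] := flip2E.
rewrite map_rest_path //; apply: eqw_trans (t_eqw r1 (t_eqw r2 s_eqw)) _.
rewrite !map_cat !flip_path // !flip_rest // g1 g2 g3 g4 f1 f2 f3 f4.
by apply/perm_eqw/permPl; exact: perm_catCA.
Qed.

Lemma glued_sum_t12_same_nil : Q = [::] ->
  B r (t r1 (t r2 (wires s))) = - (C0 * W (wires (contract s r [:: r :: p]))).
Proof.
move=> Q0; have q0 : q = [::] by rewrite /q Q0.
have eqs : eqw (@hpos _) (t r1 (t r2 (wires s)))
    ((x0, y0) :: map (map_wire h) (path_wires vL wp vR ++ rest)).
  apply: eqw_trans glued_sum_t12_eqw _; rewrite /wq q0.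
  exact: (eqw_swap (@hpos_inj _) (y0, x0)).
have [-> q_c] := glued_sum_loop barK eta_bar e_bar Y (t_complete _ (t_complete _ (complete_wires
  s))) eqs.
by rewrite diagram_sum_flip_V ?mulrN // q0 cats0.
Qed.

Lemma glued_sum_t12_same_cons : Q != [::] ->
  B r (t r1 (t r2 (wires s))) = - W (wires (contract s r [:: r :: p; q])).
Proof.
move=> Q0; have [k [X qE]] : exists k X, q = k :: X.
  by rewrite /q; case: (Q) Q0 => // k X _; exists (collapse r k), (map (collapse r) X).
have wqE : wq = (k, false) :: word_halves X by rewrite /wq qE.
have kX : {in (k, false) :: word_halves X, forall z : half_edge n.+1, z.1 != r} by rewrite -wqE.
rewrite (@glued_sum_closed _ y0 x0 (k, false) (word_halves X) (path_wires vL wp vR ++ rest)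
  (t_complete _ (t_complete _ (complete_wires s))) kX (or_intror erefl)); last first.
  by rewrite -wqE; exact: glued_sum_t12_eqw.
rewrite -(@diagram_sum_two_cycles (r :: p) q) // -mulN1r -[-1]expr1.
apply: (diagram_sum_by_flips (ks := [:: r])) => //; first exact: two_cycles_complete.
rewrite map_cat map_flips_path_wires !flipsV ?mem_head // map_cat rest_out //.
rewrite word_halves_out => [|l /p_notV]; last by rewrite inE.
rewrite qE /cycle_wires map_flips_path_wires word_halves_out => [|l lX]; last first.
  by rewrite inE; apply: (kX (l, false)); rewrite inE map_f ?orbT.
have kr : k != r by apply: (kX (k, false)); rewrite mem_head.
rewrite /flips /= inE (negPf kr).
by apply/perm_eqw/permPl; exact: perm_catCA.
Qed.

Lemma glued_sum_t2_same : B r (t r2 (wires s)) =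
  (-1) ^+ (size Q).+1 * W (wires (contract s r [:: r :: rev q ++ p])).
Proof.
have s_c := complete_wires s.
have [g1 g2 g3 g4] := flip2E.
have s2_eqw : eqw (@hpos _) (t r2 (wires s)) (path_wires x0 (map h wp) (h vR) ++
    path_wires y0 (map h wq) (h vL) ++ map (map_wire h) rest).
  apply: eqw_trans (t_eqw r2 s_eqw) _.
  by rewrite !map_cat !flip_path // flip_rest // g1 g2 g3 g4 eqw_refl.
rewrite -diagram_sum_flip_Vq'.
rewrite (@glued_sum_joined _ vR vL x0 y0 (rev (map (@other_side _) wp)) wq rest
    (t_complete _ s_c) rp_neqV q_neqV (or_introl erefl)); last first.
  apply: eqw_trans s2_eqw _; apply: eqw_cat.
    by rewrite -emb_rev_other_side ?V_out_p // eqw_path_wires_rev.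
  exact: eqw_refl.
(* Gluing yields the word with [p] reversed. Reading the whole path backwards moves the reversal to
   [q], so that the sign depends on the length of [Q] as in the rule. *)
have E : rev (map (@other_side _) (rev (map (@other_side _) wp) ++ wq)) =
  rev (map (@other_side _) wq) ++ wp.
  by rewrite map_cat rev_cat map_rev revK (mapK (@other_sideK _)).
have eq_rev : eqw (@hpos _) (path_wires vR (rev (map (@other_side _) wp) ++ wq) vL ++ rest)
    (path_wires vL (rev (map (@other_side _) wq) ++ wp) vR ++ rest).
  by rewrite -E; apply: eqw_cat (eqw_refl _ _); exact: eqw_path_wires_rev.
apply/esym; apply: diagram_sum_eqw => //; last by rewrite eqw_sym.
rewrite flip_Vq'; apply: complete_map; first exact: inv_inj (flipsK _).
exact: one_cycle_complete.
Qed.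

Lemma glued_sum_t1_same : B r (t r1 (wires s)) =
  (-1) ^+ (size Q).+1 * W (wires (contract s r [:: r :: p ++ rev q])).
Proof.
have s_c := complete_wires s.
have [f1 f2 f3 f4] := flip1E.
have s1_eqw : eqw (@hpos _) (t r1 (wires s)) (path_wires (h vL) (map h wp) y0 ++
    path_wires (h vR) (map h wq) x0 ++ map (map_wire h) rest).
  apply: eqw_trans (t_eqw r1 s_eqw) _.
  by rewrite !map_cat !flip_path // flip_rest // f1 f2 f3 f4 eqw_refl.
rewrite -diagram_sum_flip_Vq.
apply: (@glued_sum_joined _ vL vR y0 x0 wp (rev (map (@other_side _) wq)) rest
    (t_complete _ s_c) p_neqV rq_neqV (or_intror erefl)).
apply: eqw_trans s1_eqw _; apply: eqw_cat (eqw_refl _ _) _.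
by apply: eqw_cat (eqw_refl _ _); rewrite -emb_rev_other_side ?V_out_q // eqw_path_wires_rev.
Qed.

End Same.

End TwoLetters.

Section Cycles.
Variables (I : finType) (bar : I -> I) (eta e : I -> bool).
Hypotheses (barK : involutive bar) (eta_bar : forall a, eta (bar a) = eta a).
Hypothesis e_bar : forall a, e (bar a) = e a (+) eta a.
Variables (U : nzRingType) (Y : I -> I -> U).
Hypotheses (Y_skew : skew eta Y) (Y_comm : osp_commutation bar eta e Y).
Hypothesis U_char : forall x : U, x = - x -> x = 0.

Notation sgn b := ((-1) ^+ (nat_of_bool b) : U).
Let w m (s : 'S_m) : U := diagram_sum bar eta e Y (wires s).
Let C0 : U := \sum_l sgn (eta l).

Variables (n : nat) (r : 'I_n.+1) (s : 'S_n.+2) (P Q : seq 'I_n.+2).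
Let r1 := fst_letter r.
Let r2 := snd_letter r.
Let p := map (collapse r) P.
Let q := map (collapse r) Q.
Let w_ cs := w (contract s r cs).

Lemma w_rec_distinct : is_cycle s (r1 :: P) -> is_cycle s (r2 :: Q) -> r2 \notin r1 :: P ->
  w s = w (s ^ tperm r1 r2)%g + w_ [:: r :: q ++ p] - w_ [:: r :: p ++ q]
    + (-1) ^+ size Q * (w_ [:: r :: p ++ rev q] - w_ [:: r :: rev q ++ p]).
Proof.
move=> /andP[s1 u1] /andP[s2 u2] r2P.
have disj k : k \in r1 :: P -> k \in r2 :: Q = false.
  move=> k1; apply/negP=> k2; move: r2P.
  by rewrite -(porbit_cycle _ s1 k1) (porbit_cycle _ s2 k2) mem_head.
have uL : uniq (r1 :: r2 :: P ++ Q).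
  have /perm_uniq-> : perm_eq (r1 :: r2 :: P ++ Q) ((r1 :: P) ++ (r2 :: Q)) by perm_lia.
  rewrite cat_uniq u1 u2 andbT; apply/hasPn=> k k2.
  by apply/negP=> /disj; rewrite k2.
have pL k : (k \in porbit s r1) || (k \in porbit s r2) = (k \in r1 :: r2 :: P ++ Q).
  rewrite (porbit_cycle _ s1 (mem_head _ _)) (porbit_cycle _ s2 (mem_head _ _)).
  by rewrite !inE !mem_cat; do 4!case: (_ \in _) || case: (_ == _).
have /= /and3P[] := uL; rewrite inE !mem_cat !negb_or => /and3P[_ r1P r1Q] /andP[r2P' r2Q] _.
apply: (diagram_sum_distinct barK eta_bar e_bar Y_skew Y_comm uL pL).
apply: eqw_trans (wires_split uL pL) _.
rewrite !wire_cycle // /cycle_wires -!emb_word_halves // emb_vL emb_vR eqw_refl //.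
Qed.

Hypothesis s_cycle : is_cycle s (r1 :: P ++ r2 :: Q).

Let uL : uniq (r1 :: r2 :: P ++ Q).
Proof.
have /andP[_ u] := s_cycle.
have /perm_uniq-> // : perm_eq (r1 :: r2 :: P ++ Q) (r1 :: P ++ r2 :: Q) by perm_lia.
Qed.

Let pL k : (k \in porbit s r1) || (k \in porbit s r2) = (k \in r1 :: r2 :: P ++ Q).
Proof.
have /andP[s1 _] := s_cycle.
have r2L : r2 \in r1 :: P ++ r2 :: Q by rewrite inE mem_cat mem_head !orbT.
have E : perm_eq (r1 :: r2 :: P ++ Q) (r1 :: P ++ r2 :: Q) by perm_lia.
by rewrite (porbit_cycle _ s1 (mem_head _ _)) (porbit_cycle _ s1 r2L) orbb (perm_mem E).
Qed.

Let s_eqw : eqw (@hpos _) (wires s)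
  (path_wires (inner_l r) (map (emb r) (word_halves p)) (inner_r r) ++
   path_wires (emb r (r, true)) (map (emb r) (word_halves q)) (emb r (r, false)) ++
   map (map_wire (emb r)) (rest_wires r s P Q)).
Proof.
have /andP[s1 _] := s_cycle.
have /= /and3P[] := uL; rewrite inE !mem_cat !negb_or => /and3P[_ r1P r1Q] /andP[r2P r2Q] _.
apply: eqw_trans (wires_split uL pL) _.
have /andP[sP sQ] : fpath s r1 (rcons P r2) && fpath s r2 (rcons Q r1).
  by move: s1; rewrite /= rcons_cat rcons_cons -cat_rcons cat_path last_rcons.
rewrite -/r1 -/r2 (wire_path sP) (wire_path sQ) -!emb_word_halves // emb_vL emb_vR eqw_refl //.
Qed.

Lemma w_rec_same : Q != [::] ->
  w s = w (s ^ tperm r1 r2)%g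
    + (if P is [::] then C0 * w_ [:: r :: q] else w_ [:: p; r :: q])
    - w_ [:: r :: p; q]
    + (-1) ^+ size Q * (w_ [:: r :: p ++ rev q] + w_ [:: r :: rev q ++ p]).
Proof.
move=> Q0; rewrite /w (diagram_sum_rec barK eta_bar e_bar Y_comm r s).
rewrite (glued_sum_t1_same barK eta_bar e_bar Y_skew uL pL s_eqw).
rewrite (glued_sum_t2_same barK eta_bar e_bar Y_skew uL pL s_eqw).
rewrite (glued_sum_t12_same_cons barK eta_bar e_bar Y_skew uL pL s_eqw Q0).
have -> : glued_sum bar eta e Y r (wires s) =
    if P is [::] then C0 * w_ [:: r :: q] else w_ [:: p; r :: q].
  have := glued_sum_same_nil barK eta_bar e_bar Y uL pL s_eqw.
  have := glued_sum_same_cons barK eta_bar e_bar Y uL pL s_eqw.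
  by rewrite /w_ /p; case: (P) => [_ /(_ erefl)|k X /(_ isT)].
rewrite exprS mulN1r !mulNr !opprK mulrDr -!addrA; congr (_ + (_ + _)).
by rewrite addrA addrC.
Qed.

(** With [Q] empty the terms of the two single flips coincide and give the factor 2, the double flip
    gives - C_0, and the unflipped term is zero. *)
Lemma w_rec_adjacent : Q = [::] ->
  w s = w (s ^ tperm r1 r2)%g + (2%:R - C0) * w_ [:: r :: p].
Proof.
move=> Q0; rewrite /w (diagram_sum_rec barK eta_bar e_bar Y_comm r s).
rewrite (glued_sum_t1_same barK eta_bar e_bar Y_skew uL pL s_eqw).
rewrite (glued_sum_t2_same barK eta_bar e_bar Y_skew uL pL s_eqw).
rewrite (glued_sum_t12_same_nil barK eta_bar e_bar Y_skew uL pL s_eqw Q0).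
rewrite (glued_sum_same0 barK eta_bar e_bar Y_skew uL pL s_eqw U_char Q0).
by rewrite -/p Q0 /= cats0 expr1 !mulN1r !opprK add0r mulrBl mulr_natl mulr2n.
Qed.

End Cycles.

(** * Sums over indices *)

Lemma alt_far m (v w : half_edge m * half_edge m) :
  (hpos v.1 < hpos w.1)%N -> (hpos v.1 < hpos w.2)%N ->
  (hpos v.2 < hpos w.1)%N -> (hpos v.2 < hpos w.2)%N -> alt (@hpos m) v w = false.
Proof. by rewrite /alt => -> -> -> ->. Qed.

(** The exponent f_s modulo 2. The positions 2k and 2k + 1 of the half-edges of [k] are ordered like
    the real numbers k - 1/3 and k + 1/3. *)
Definition chord_sign m (s : 'S_m) (tau : 'I_m -> bool) : bool :=
  \big[addb/false]_(k < m | (k < s k)%N) tau (s k) (+)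
  \big[addb/false]_(k < m) \big[addb/false]_(l < m | (k < l)%N)
    (alt (@hpos m) (wire s k) (wire s l) && (tau (s k) && tau (s l))).

(** All half-edges of the first block precede those of the second, so chords of different blocks do
    not alternate. *)
Lemma chord_sign_concat m n (s : 'S_m) (t : 'S_n) tau :
  chord_sign (concat_perm s t) tau =
    chord_sign s (tau \o lshift n) (+) chord_sign t (tau \o @rshift m n).
Proof.
have El k : concat_perm s t (lshift n k) = lshift n (s k).
  by rewrite permE /concat_fun -[lshift n k]/(unsplit (inl k)) unsplitK.
have Er k : concat_perm s t (rshift m k) = rshift m (t k).
  by rewrite permE /concat_fun -[rshift m k]/(unsplit (inr k)) unsplitK.
rewrite /chord_sign 2!big_split_ord /=.
under eq_bigl => k do rewrite El /=.
under eq_bigr => k _ do rewrite El /=.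
under [X in _ (+) X (+) _]eq_bigl => k do rewrite Er /= ltn_add2l.
under [X in _ (+) X (+) _]eq_bigr => k _ do rewrite Er /=.
set a := \big[_/_]_(_ < m | _) _; set b := \big[_/_]_(_ < n | _) _.
have -> : \big[addb/false]_(k < m) \big[addb/false]_(l < m + n | (lshift n k < l)%N)
    (alt (@hpos _) (wire (concat_perm s t) (lshift n k)) (wire (concat_perm s t) l) &&
      (tau (concat_perm s t (lshift n k)) && tau (concat_perm s t l))) =
  \big[addb/false]_(k < m) \big[addb/false]_(l < m | (k < l)%N)
    (alt (@hpos m) (wire s k) (wire s l) && (tau (lshift n (s k)) && tau (lshift n (s l)))).
  apply: eq_bigr => k _; rewrite big_split_ord /= [X in _ (+) X]big1 ?addbF.
    by apply: eq_bigr => l _; rewrite /wire !El.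
  have k_m := ltn_ord k; have sk_m := ltn_ord (s k).
  by move=> l _; rewrite alt_far // /wire El Er /hpos /=; lia.
have -> : \big[addb/false]_(k < n) \big[addb/false]_(l < m + n | (rshift m k < l)%N)
    (alt (@hpos _) (wire (concat_perm s t) (rshift m k)) (wire (concat_perm s t) l) &&
      (tau (concat_perm s t (rshift m k)) && tau (concat_perm s t l))) =
  \big[addb/false]_(k < n) \big[addb/false]_(l < n | (k < l)%N)
    (alt (@hpos n) (wire t k) (wire t l) && (tau (rshift m (t k)) && tau (rshift m (t l)))).
  apply: eq_bigr => k _; rewrite big_split_ord /= [X in X (+) _]big_pred0; last first.
    by move=> l; have := ltn_ord l; lia.
  rewrite addFb; apply: eq_big => l; first by rewrite ltn_add2l.
  move=> _; rewrite !Er /alt /wire /= !Er /hpos /= !doubleD -!addnA !ltn_add2l.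
  by [].
by rewrite addbACA.
Qed.

Section IndexSums.
Variables (I : finType) (bar : I -> I) (eta e : I -> bool).
Hypotheses (barK : involutive bar) (eta_bar : forall a, eta (bar a) = eta a).
Hypothesis e_bar : forall a, e (bar a) = e a (+) eta a.
Variables (U : nzRingType) (X : I -> I -> U).

Notation sgn b := ((-1) ^+ (nat_of_bool b) : U).

(** The sign is chosen so that the inverse substitution reads X a b = sgn (e b) * Y a (bar b). *)
Definition raised a b : U := sgn (e (bar b)) * X a (bar b).

Definition index_sum m (s : 'S_m) : U :=
  \sum_(i : {ffun 'I_m -> I}) sgn (chord_sign s (eta \o i)) * \prod_(k < m) X (i k) (i (s k)).

Definition index_casimir k : U :=
  if k is 0 then \sum_l sgn (eta l) else
  \sum_(i : {ffun 'I_k -> I}) sgn (\big[addb/false]_(l < k | (0 < l)%N) eta (i l)) *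
    \prod_(l < k) X (i l) (i (ordS l)).

Lemma wires_sign_sorted m (c : half_edge m -> I) (f : 'I_m ->
  half_edge m * half_edge m) (xs : seq 'I_m) :
  sorted ltn (map val xs) ->
  wires_sign eta e (@hpos m) c (map f xs) =
    \big[addb/false]_(k <- xs) wire_sg e (@hpos m) c (f k) (+)
    \big[addb/false]_(k <- xs) \big[addb/false]_(l <- xs | (k < l)%N)
      cross eta (@hpos m) c (f k) (f l).
Proof.
elim: xs => [|x xs IH] /= xs_sorted; first by rewrite !big_nil.
have lt_x : {in xs, forall l : 'I_m, (x < l)%N}.
  move=> l lxs; have := order_path_min ltn_trans xs_sorted.
  by move=> /allP/(_ (val l)); apply; apply: map_f.
rewrite IH; last exact: path_sorted xs_sorted.
rewrite !big_cons ltnn.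
have -> : crosses eta (@hpos m) c (f x) (map f xs) =
    \big[addb/false]_(l <- xs | (x < l)%N) cross eta (@hpos m) c (f x) (f l).
  rewrite /crosses big_map [RHS]big_mkcond; apply: eq_big_seq => l /lt_x.
  by move=> ->.
have -> : \big[addb/false]_(k <- xs) \big[addb/false]_(l <- x :: xs | (k < l)%N)
      cross eta (@hpos m) c (f k) (f l) =
    \big[addb/false]_(k <- xs) \big[addb/false]_(l <- xs | (k < l)%N)
      cross eta (@hpos m) c (f k) (f l).
  by apply: eq_big_seq => k /lt_x xk; rewrite big_cons ltnNge (ltnW xk).
by rewrite addbACA.
Qed.

(** An admissible labelling is determined by the left labels [i k]; the right half-edge of [k] then
    carries [bar (i (s k))]. Raising the index gives the sign [e (i (s k))], which is also the wire
    sign when the left end is that of [s k]. When k < s k the wire is read from its other end, and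
    by [e_bar] the parity of [i (s k)] is left over: this is the sum over P_1. *)
Lemma index_sumE m (s : 'S_m) : index_sum s = diagram_sum bar eta e raised (wires s).
Proof.
pose J (i : {ffun 'I_m -> I}) : {ffun half_edge m -> I} :=
  [ffun z => if z.2 then bar (i (s z.1)) else i z.1].
pose J' (c : {ffun half_edge m -> I}) : {ffun 'I_m -> I} := [ffun k => c (k, false)].
have admissibleP c : admissible bar c (wires s) = [forall k, c (s k, false) == bar (c (k, true))].
  rewrite /admissible all_map; apply/allP/forallP=> okc k; first exact/okc/mem_enum.
  by move=> _; apply: okc.
rewrite /diagram_sum /wire_sum (reindex_onto J J') /=; last first.
  move=> c; rewrite admissibleP => /forallP okc; apply/ffunP=> -[k b]; rewrite !ffunE /=.
  by case: b; rewrite // (eqP (okc k)) barK.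
apply: eq_big => i.
  apply/esym/andP; split; last by apply/eqP/ffunP=> k; rewrite !ffunE.
  by rewrite admissibleP; apply/forallP=> k; rewrite !ffunE /= barK.
move=> _.
have -> : \prod_(k < m) X (i k) (i (s k)) = sgn (\big[addb/false]_(k < m) e (i (s k))) *
    word_prod raised (J i).
  rewrite /word_prod /raised; elim: (index_enum _) => [|k ks IH].
    by rewrite !big_nil mulr1.
  rewrite !big_cons IH !ffunE /= barK !mulrA -signr_addb addbAC addbb addFb.
  by rewrite commr_sign.
rewrite mulrA -signr_addb; congr (sgn _ * _).
rewrite /wires wires_sign_sorted; last by rewrite val_enum_ord iota_ltn_sorted.
rewrite !big_enum /=.
have -> : \big[addb/false]_(k < m) wire_sg e (@hpos m) (J i) (wire s k) =
    \big[addb/false]_(k < m) e (i (s k)) (+)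
    \big[addb/false]_(k < m | (k < s k)%N) eta (i (s k)).
  rewrite [X in _ (+) X]big_mkcond -big_split /=; apply: eq_bigr => k _.
  rewrite (wire_sgE e_bar); last by rewrite /paired !ffunE /= barK.
  rewrite !ffunE /= e_bar eta_bar -addbA; congr (_ (+) _).
  have -> : (hpos (s k, false) < hpos (k, true))%N = ~~ (k < s k)%N.
    by rewrite /hpos /=; lia.
  by case: (k < s k)%N; case: (eta _).
rewrite /chord_sign addbC -!addbA; congr (_ (+) (_ (+) _)).
apply: eq_bigr => k _; rewrite big_enum_cond /=; apply: eq_bigr => l _.
by rewrite /cross !ffunE /= !eta_bar.
Qed.

End IndexSums.

(** * The relations (A1)-(A4) for sums over indices *)

Section Relations.
Variables (I : finType) (bar : I -> I) (eta e : I -> bool).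
Hypotheses (barK : involutive bar) (eta_bar : forall a, eta (bar a) = eta a).
Hypothesis e_bar : forall a, e (bar a) = e a (+) eta a.
Variables (U : nzRingType) (X : I -> I -> U).
Let Y := raised bar e X.
Hypotheses (Y_skew : skew eta Y) (Y_comm : osp_commutation bar eta e Y).
Hypothesis U_char : forall x : U, x = - x -> x = 0.

Notation sgn b := ((-1) ^+ (nat_of_bool b) : U).
Notation index_sum := (index_sum eta X).
Notation W := (diagram_sum bar eta e Y).

Lemma index_sum_empty : index_sum (1%g : 'S_0) = 1.
Proof.
rewrite /index_sum (big_pred1 [ffun k : 'I_0 => match notF (ltn_ord k) with end]).
  by rewrite /chord_sign !big_ord0 mulr1.
by move=> i; apply/esym/eqP/ffunP=> -[].
Qed.

Lemma index_sum_concat m n (s : 'S_m) (t : 'S_n) :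
  index_sum (concat_perm s t) = index_sum s * index_sum t.
Proof.
pose J (ij : {ffun 'I_m -> I} * {ffun 'I_n -> I}) : {ffun 'I_(m + n) -> I} :=
  [ffun k => match split k with inl a => ij.1 a | inr b => ij.2 b end].
have Jl ij k : J ij (lshift n k) = ij.1 k.
  by rewrite ffunE -[lshift n k]/(unsplit (inl k)) unsplitK.
have Jr ij k : J ij (rshift m k) = ij.2 k.
  by rewrite ffunE -[rshift m k]/(unsplit (inr k)) unsplitK.
have El k : concat_perm s t (lshift n k) = lshift n (s k).
  by rewrite permE /concat_fun -[lshift n k]/(unsplit (inl k)) unsplitK.
have Er k : concat_perm s t (rshift m k) = rshift m (t k).
  by rewrite permE /concat_fun -[rshift m k]/(unsplit (inr k)) unsplitK.
have J_bij : bijective J.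
  exists (fun i : {ffun 'I_(m + n) ->
    I} => ([ffun k => i (lshift n k)], [ffun k => i (rshift m k)])).
    by case=> i j; congr pair; apply/ffunP=> k; rewrite ffunE (Jl, Jr).
  by move=> i; apply/ffunP=> k; rewrite -[k]splitK; case: (split k) => a /=;
     rewrite (Jl, Jr) ffunE.
rewrite /index_sum (reindex J) /=; last exact: onW_bij.
rewrite big_distrlr /= pair_bigA /=; apply: eq_bigr => -[i j] _.
rewrite chord_sign_concat signr_addb big_split_ord /=.
under [X in _ * (X * _)]eq_bigr => k _ do rewrite El !Jl.
under [X in _ * (_ * X)]eq_bigr => k _ do rewrite Er !Jr.
rewrite !mulrA; congr (_ * _).
rewrite -!mulrA; congr (sgn _ * _).
  rewrite /chord_sign; congr (_ (+) _); first by apply: eq_bigr => k _; rewrite /= Jl.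
  by do 2!apply: eq_bigr => ? _; rewrite /= !Jl.
rewrite commr_sign; congr (sgn _ * _).
rewrite /chord_sign; congr (_ (+) _); first by apply: eq_bigr => k _; rewrite /= Jr.
by do 2!apply: eq_bigr => ? _; rewrite /= !Jr.
Qed.

Lemma index_sum_invert m (s s' : 'S_m) (a : 'I_m) :
    (forall k, s' k = if k \in porbit s a then (s^-1)%g k else s k) ->
  index_sum s' = (-1) ^+ #|porbit s a| * index_sum s.
Proof.
move=> s'E; rewrite !(index_sumE barK eta_bar e_bar) cardE.
have ks_uniq := enum_uniq (porbit s a).
rewrite -(diagram_sum_flips eta_bar e_bar Y_skew ks_uniq (complete_wires s)).
apply: diagram_sum_eqw => //; first exact: complete_wires.
(* For [k] in the inverted cycle, the wire of [s'] at [k] is the flipped and reversed wire of [s] at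
   the preimage of [k]. *)
pose f (k : 'I_m) := if k \in porbit s a then (s^-1)%g k else k.
have sV k : (s^-1%g k \in porbit s a) = (k \in porbit s a).
  by have := porbit_perm s 1 (s^-1%g k); rewrite expg1 permKV -!eq_porbit_mem => ->.
have f_inj : injective f.
  move=> k l; rewrite /f; case: ifP => kO; case: ifP => lO //.
  - exact: perm_inj.
  - by move=> E; rewrite -E sV kO in lO.
  by move=> E; rewrite E sV lO in kO.
have E : perm_eq (enum 'I_m) (map f (enum 'I_m)).
  apply: uniq_perm => [||k]; first exact: enum_uniq.
    by rewrite map_inj_uniq ?enum_uniq.
  by rewrite mem_enum -(f_finv f_inj k) map_f // mem_enum.
apply: (@eqw_trans _ _ (map (map_wire (flips (enum (porbit s a)))) (map (wire s) (map f (enum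
  'I_m))))); last first.
  by apply: (@eqw_map _ _ (@hpos m)) (@hpos_inj m) _; apply: perm_eqw;
    rewrite perm_map // perm_sym.
rewrite /eqw /wires -!map_comp; apply: eq_perm_eq; apply: eq_map => k /=.
have sP l : (s l \in porbit s a) = (l \in porbit s a) by rewrite -[in RHS](permK s l) sV.
rewrite /wire /map_wire /= s'E /f; case: ifP => kO;
  rewrite /flips !mem_enum ?permKV ?sP ?sV ?kO //=.
exact: (orient_swap (@hpos_inj m) (((s^-1)%g k, false), (k, true))).
Qed.

(** The chords from k to k + 1 are disjoint, and the closing chord from the last letter to the first
    encloses all of them, so nothing alternates. Only the closing chord is missing from P_1, which
    leaves out the index at 0. *)
Lemma chord_sign_std m (tau : 'I_m -> bool) :
  chord_sign (std_cycle m) tau = \big[addb/false]_(l < m | (0 < l)%N) tau l.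
Proof.
rewrite /chord_sign [X in _ (+) X]big1 ?addbF => [|k _].
  rewrite [RHS](reindex_inj (@ordS_inj m)) /=; apply: eq_big => k; rewrite permE //.
  have := ltn_ord k; rewrite leq_eqVlt => /orP[/eqP km|km].
    by rewrite /= (_ : k.+1 %% m = 0)%N // km modnn.
  by rewrite /= modn_small // leqnn.
rewrite big1 // => l kl; suff ->
  : alt (@hpos m) (wire (std_cycle m) k) (wire (std_cycle m) l) = false.
  by [].
rewrite /alt /wire /hpos !permE /ordS /=.
have lm := ltn_ord l; rewrite (modn_small (leq_ltn_trans kl lm)).
have -> : (k.*2 + true < l.*2 + true)%N by lia.
have -> : (k.+1.*2 + false < l.*2 + true)%N by lia.
have [lm'|lm'] := eqVneq l.+1 m; first by rewrite lm' modnn.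
rewrite modn_small; last by rewrite ltn_neqAle lm'.
have -> : (k.*2 + true < l.+1.*2 + false)%N by lia.
by have -> : (k.+1.*2 + false < l.+1.*2 + false)%N by lia.
Qed.

Lemma index_sum_std m : (2 <= m)%N -> index_sum (std_cycle m) = index_casimir eta X m.
Proof.
case: m => // m _; rewrite /index_sum /index_casimir; apply: eq_bigr => i _.
by rewrite chord_sign_std; congr (_ * _); apply: eq_bigr => k _; rewrite permE.
Qed.

Lemma index_so_relations : so_relations index_sum (index_casimir eta X).
Proof.
split.
- exact: index_sum_empty.
- exact: index_sum_concat.
- exact: index_sum_invert.
- by move=> m m2 _; apply: index_sum_std.
- move=> n s r P Q r1 r2 sP sQ r2P p q w_.
  rewrite /w_ !(index_sumE barK eta_bar e_bar).
  exact: (w_rec_distinct barK eta_bar e_bar Y_skew Y_comm).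
- move=> n s r P Q r1 r2 sPQ Q0 p q w_.
  have := w_rec_same barK eta_bar e_bar Y_skew Y_comm sPQ Q0.
  by rewrite -!(index_sumE barK eta_bar e_bar) => ->; congr (_ + _ - _ + _).
move=> n s r P r1 r2 sP p.
rewrite !(index_sumE barK eta_bar e_bar).
exact: (w_rec_adjacent barK eta_bar e_bar Y_skew Y_comm U_char sP).
Qed.

End Relations.

(** * Centrality *)

Section Central.
Variables (I : finType) (bar : I -> I) (eta e : I -> bool).
Hypotheses (barK : involutive bar) (eta_bar : forall a, eta (bar a) = eta a).
Hypothesis e_bar : forall a, e (bar a) = e a (+) eta a.
Variables (U : nzRingType) (Y : I -> I -> U).
Hypotheses (Y_skew : skew eta Y) (Y_comm : osp_commutation bar eta e Y).

Notation sgn b := ((-1) ^+ (nat_of_bool b) : U).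
Notation W := (diagram_sum bar eta e Y).

Variables u v : I.
Let zeta := eta u (+) eta v.

(* The action of [Y u v] on a label: [F l] is the effect of replacing it by [l]. *)
Definition act_label (a : I) (F : I -> U) : U :=
  (if a == bar v then sgn (e a) * F u else 0)
  - sgn (eta u && eta v) * (if a == bar u then sgn (e a) * F v else 0).

(** The commutation relation as a derivation acting on each index. The contractions with [b] leave a
    generator whose indices stand in the wrong order; [Y_skew] exchanges them, and what remains is
    the sign of passing the label [a]. *)
Lemma bracket_act a b :
  Y u v * Y a b = sgn (zeta && (eta a (+) eta b)) * (Y a b * Y u v)
    + act_label a (fun l => Y l b)
    + sgn (zeta && eta a) * act_label b (fun l => Y a l).
Proof.
have := Y_comm u v a b; rewrite -/zeta => /(canRL (subrK _)) ->.
rewrite addrC -!addrA; congr (_ + _); rewrite /contraction /act_label.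
congr (_ + (_ + _)).
have KE x y : sgn (eta a && eta b) * (if b == bar y then sgn (e b) * Y x a else 0) =
    - (if b == bar y then sgn ((eta x (+) eta y) && eta a) * (sgn (e b) * Y a x) else 0).
  case: eqP => [->|_]; last by rewrite mulr0 oppr0.
  rewrite (Y_skew x a) !mulrN !mulrA -!signr_addb eta_bar; congr (- (sgn _ * _)).
  by case: (eta a) (eta x) (eta y) (e (bar y)) => [] [] [] [].
rewrite signr_addb -mulrA !KE opprK mulrBr mulrN [eta v (+) eta u]addbC -/zeta.
congr (_ - _); first by case: eqP => _; rewrite ?mulr0.
case: eqP => _; rewrite ?mulr0 // !mulrA -!signr_addb.
by rewrite (addbC (eta u && eta v)).
Qed.

Variable m : nat.
Implicit Types (c : {ffun half_edge m -> I}) (x y : half_edge m) (ks : seq 'I_m).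

Definition upd c x l : {ffun half_edge m -> I} := [ffun z => if z == x then l else c z].

Definition prod_on ks c : U := \prod_(k <- ks) Y (c (k, false)) (c (k, true)).

(** The parity of the labels that [Y u v] has to pass before it acts on the label at [x]. *)
Definition parity_before ks c x : bool :=
  \big[addb/false]_(k <- ks) ((hpos (k, false) < hpos x)%N && eta (c (k, false)) (+)
                              (hpos (k, true) < hpos x)%N && eta (c (k, true))).

Lemma prod_on_upd ks c x l : x.1 \notin ks -> prod_on ks (upd c x l) = prod_on ks c.
Proof.
move=> xks; apply: eq_big_seq => k kks.
have kx b : ((k, b) == x) = false.
  by apply/negbTE; apply: contraNneq xks => <-.
by rewrite !ffunE !kx.
Qed.

Lemma act_label_mulr a F A : act_label a F * A = act_label a (fun l => F l * A).
Proof.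
rewrite /act_label mulrBl -mulrA; congr (_ - _ * _).
  by case: ifP => _; rewrite ?mul0r ?mulrA.
by case: ifP => _; rewrite ?mul0r ?mulrA.
Qed.

Lemma act_label_mull a F A : A * act_label a F = act_label a (fun l => A * F l).
Proof.
have pull b (z : U) : A * (sgn b * z) = sgn b * (A * z) by rewrite !mulrA commr_sign.
rewrite /act_label mulrBr pull; congr (_ - _ * _).
  by case: ifP => _; rewrite ?mulr0 ?pull.
by case: ifP => _; rewrite ?mulr0 ?pull.
Qed.

Lemma eq_act_label a F G : F =1 G -> act_label a F = act_label a G.
Proof. by move=> FG; rewrite /act_label !FG. Qed.

Lemma prod_on_comm ks c : sorted ltn (map val ks) ->
  Y u v * prod_on ks c =
    sgn (zeta && \big[addb/false]_(k <- ks) (eta (c (k, false)) (+) eta (c (k, true))))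
      * (prod_on ks c * Y u v)
    + \sum_(k <- ks) \sum_(b : bool) sgn (zeta && parity_before ks c (k, b))
        * act_label (c (k, b)) (fun l => prod_on ks (upd c (k, b) l)).
Proof.
elim: ks => [|k ks IH] /= ks_sorted.
  by rewrite /prod_on !big_nil andbF addr0 mulr1 !mul1r.
have k_lt : {in ks, forall j : 'I_m, (k < j)%N}.
  move=> j jks; have := order_path_min ltn_trans ks_sorted.
  by move=> /allP/(_ (val j)); apply; apply: map_f.
have kks : k \notin ks by apply/negP=> /k_lt; rewrite ltnn.
have before0 b : parity_before ks c (k, b) = false.
  rewrite /parity_before big1_seq // => j /andP[_ /k_lt kj].
  have jk d : (hpos (j, d) < hpos (k, b))%N = false by rewrite /hpos /=; case: b d => [] []; lia.
  by rewrite !jk.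
have prodE c' : prod_on (k :: ks) c' = Y (c' (k, false)) (c' (k, true)) * prod_on ks c'.
  by rewrite /prod_on big_cons.
have beforeE x : parity_before (k :: ks) c x =
    ((hpos (k, false) < hpos x)%N && eta (c (k, false)) (+)
      (hpos (k, true) < hpos x)%N && eta (c (k, true))) (+) parity_before ks c x.
  by rewrite /parity_before big_cons.
have pull b (A z : U) : A * (sgn b * z) = sgn b * (A * z) by rewrite !mulrA commr_sign.
set P := prod_on ks c; set Yk := Y (c (k, false)) (c (k, true)).
rewrite prodE -/Yk -/P mulrA bracket_act [LHS]mulrDl [X in X + _]mulrDl -/Yk.
have -> (x : bool) : sgn x * (Yk * Y u v) * P = sgn x * (Yk * (Y u v * P)) by rewrite !mulrA.
rewrite {1}/P {}IH; last exact: path_sorted ks_sorted.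
rewrite !big_cons big_bool /= andb_addr.
set s := eta (c (k, false)) (+) eta (c (k, true)).
set s' := \big[addb/false]_(j <- ks) _.
have -> : \sum_(j <- ks) \sum_(b : bool) sgn (zeta && parity_before (k :: ks) c (j, b))
        * act_label (c (j, b)) (fun l => prod_on (k :: ks) (upd c (j, b) l)) =
    sgn (zeta && s) * (Y (c (k, false)) (c (k, true)) *
    \sum_(j <- ks) \sum_(b : bool) sgn (zeta && parity_before ks c (j, b))
        * act_label (c (j, b)) (fun l => prod_on ks (upd c (j, b) l))).
  rewrite !mulr_sumr; apply: eq_big_seq => j jks; rewrite !mulr_sumr.
  apply: eq_bigr => b _; rewrite beforeE.
  have kj := k_lt j jks.
  have -> : (hpos (k, false) < hpos (j, b))%N by rewrite /hpos /=; lia.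
  have -> : (hpos (k, true) < hpos (j, b))%N by rewrite /hpos /=; lia.
  rewrite /= -/s andb_addr signr_addb -mulrA (pull _ Yk); congr (_ * (_ * _)).
  rewrite act_label_mull.
  apply: eq_act_label => l; rewrite prodE !ffunE.
  have -> b' : ((k, b') == (j, b)) = false by rewrite xpair_eqE; case: eqP kj => // ->;
    rewrite ltnn.
  by have -> b' : ((k, b') == (j, b)) = false by rewrite xpair_eqE; case: eqP kj => // ->;
    rewrite ltnn.
have updF l : prod_on (k :: ks) (upd c (k, false) l) = Y l (c (k, true)) * P.
  by rewrite prodE prod_on_upd // !ffunE eqxx xpair_eqE andbF.
have updT l : prod_on (k :: ks) (upd c (k, true) l) = Y (c (k, false)) l * P.
  by rewrite prodE prod_on_upd // !ffunE eqxx xpair_eqE andbF.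
rewrite (eq_act_label _ updF) (eq_act_label _ updT).
rewrite act_label_mulr -[_ * _ * P]mulrA act_label_mulr.
have -> : parity_before (k :: ks) c (k, false) = false.
  by rewrite beforeE before0 !ltnNge /hpos /= !addn0 leqnn leq_addr.
have -> : parity_before (k :: ks) c (k, true) = eta (c (k, false)).
  by rewrite beforeE before0 ltnn /hpos /= addn0 addn1 ltnSn addbF addbF.
move: (act_label (c (k, false)) _) (act_label (c (k, true)) _) => A1 A2.
set A3 := \sum_(j <- ks) _.
rewrite andbF mul1r -andb_addr -/s [Yk * (_ + _)]mulrDr mulrDr (pull _ Yk) !mulrA.
rewrite -signr_addb -andb_addr -/Yk -!addrA; congr (_ + _).
by rewrite addrA addrC [X in _ = _ + X]addrC.
Qed.

Notation ok := (admissible bar).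
Notation sg := (wires_sign eta e (@hpos m)).
Notation Yprod := (word_prod Y).

Lemma big_half_edge (R : Type) (idx : R) (op : Monoid.com_law idx) (F : half_edge m -> R) :
  \big[op/idx]_(z : half_edge m) F z = \big[op/idx]_(k < m) \big[op/idx]_(b : bool) F (k, b).
Proof. by rewrite pair_bigA; apply: eq_bigr => -[]. Qed.

Definition before c x : bool :=
  \big[addb/false]_(z : half_edge m) ((hpos z < hpos x)%N && eta (c z)).

Lemma before_enum c x : parity_before (enum 'I_m) c x = before c x.
Proof.
rewrite /parity_before /before big_enum /=; under eq_bigr do rewrite addbC.
rewrite big_half_edge; by apply: eq_bigr => k _; rewrite big_bool.
Qed.

Lemma before_upd c x l : before (upd c x l) x = before c x.
Proof.
apply: eq_bigr => z _; rewrite ffunE; case: eqP => // ->.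
by rewrite ltnn.
Qed.

Lemma word_prod_comm c : Y u v * Yprod c =
  sgn (zeta && \big[addb/false]_(z : half_edge m) eta (c z)) * (Yprod c * Y u v)
  + \sum_x sgn (zeta && before c x) * act_label (c x) (fun l => Yprod (upd c x l)).
Proof.
have E c' : Yprod c' = prod_on (enum 'I_m) c'.
  by rewrite /prod_on enumT /word_prod [index_enum _]unlock.
rewrite E prod_on_comm; last by rewrite val_enum_ord iota_ltn_sorted.
rewrite !big_enum /=; congr (sgn (_ && _) * _ + _).
  by rewrite big_half_edge; apply: eq_bigr => k _; rewrite big_bool /= addbC.
rewrite [RHS]big_half_edge; apply: eq_bigr => k _; apply: eq_bigr => b _; rewrite before_enum.
by congr (_ * _); apply: eq_act_label => l; rewrite E.
Qed.

(* The part of [[Y u v, W ws]] in which the label of the half-edge [x] is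
   changed from [bar be] to [al]. *)
Definition relabelled ws x al be : U := \sum_(c : {ffun half_edge m -> I} | ok c ws)
  sgn (sg c ws) * (sgn (zeta && before c x) *
    (if c x == bar be then sgn (e (c x)) * Yprod (upd c x al) else 0)).

(** Expressed through the labelling after the replacement, the sum runs over labellings with [al]
    and [be] at the two ends of the wire. This condition does not distinguish the end that was
    changed, so the contributions of the two ends can be compared sign by sign. *)
Lemma relabelledE ws x y Z al be : complete ws -> eqw (@hpos m) ws ((x, y) :: Z) ->
  relabelled ws x al be =
  \sum_(c : {ffun half_edge m -> I} | [&& c x == al, c y == be & ok c Z])
    sgn ((hpos y < hpos x)%N && eta be (+)
         (eta be && \big[addb/false]_(w <- Z) (alt (@hpos m) (x, y) w && eta (c w.1))) (+)
         sg c Z (+) (zeta && before c x)) * Yprod c.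
Proof.
move=> ws_c eq_ws; have /complete_uniq /= := complete_eqw eq_ws ws_c.
rewrite !inE negb_or => /and3P[/andP[xy xZ] yZ _].
transitivity (\sum_(c : {ffun half_edge m -> I} | ok c ((x, y) :: Z) && (c x == bar be))
   sgn (sg c ((x, y) :: Z) (+) (zeta && before c x) (+) e (c x)) * Yprod (upd c x al)).
  rewrite [RHS]big_mkcondr; apply: eq_big => c; first exact: admissible_eqw eq_ws.
  move=> okc; rewrite (wires_sign_eqw e barK eta_bar (@hpos_inj m) (complete_uniq ws_c) okc
    eq_ws).
  case: eqP => _; last by rewrite !mulr0.
  by rewrite !mulrA -!signr_addb.
(* The new summation variable is the labelling after the replacement; the old one is recovered by
   putting [bar be] back at [x]. *)
rewrite (reindex_onto (fun c => upd c x (bar be)) (fun c => upd c x al)) /=; last first.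
  move=> c /andP[_ /eqP cx]; apply/ffunP=> z; rewrite !ffunE.
  by case: eqP => // ->; rewrite cx.
have updZ c : {in ends Z, upd c x (bar be) =1 c}.
  by move=> z zZ; rewrite ffunE; case: eqP => // zx; rewrite -zx zZ in xZ.
have upd2 c : (upd (upd c x (bar be)) x al == c) = (c x == al).
  apply/eqP/eqP=> [<-|cx]; first by rewrite ffunE eqxx.
  by apply/ffunP=> z; rewrite !ffunE; case: eqP => // ->.
have updx c : upd c x (bar be) x = bar be by rewrite ffunE eqxx.
have updy c : upd c x (bar be) y = c y by rewrite ffunE eq_sym (negPf xy).
apply: eq_big => c.
  rewrite upd2 /paired /= updx updy barK eqxx andbT (eq_admissible bar (updZ c)).
  by rewrite andbC.
case/andP=> /andP[/andP[cxy okZ] _] /eqP upd_c; rewrite upd_c; congr (sgn _ * _).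
rewrite (wire_sgE e_bar _ cxy) /= updx before_upd (eq_wires_sign eta e (@hpos m) (updZ c)).
have -> : crosses eta (@hpos m) (upd c x (bar be)) (x, y) Z =
    eta be && \big[addb/false]_(w <- Z) (alt (@hpos m) (x, y) w && eta (c w.1)).
  rewrite big_distrr /=; apply: eq_big_seq => w wZ; rewrite /cross /= updx eta_bar.
  rewrite updZ; first by rewrite andbCA.
  by apply/flatten_mapP; exists w; rewrite // inE eqxx.
rewrite eta_bar; move: (_ && \big[_/_]_(_ <- _) _) (_ && eta be) (e _) (sg _ _) (_ && before _ _).
by do 5!case.
Qed.

(** The sign of reaching [x] and that of reaching [y] differ by the labels between them. A wire with
    both ends in between contributes twice, so only the odd wires crossing [(x, y)] remain. The
    crossings of [(x, y)] itself are weighted by the parity of [be] on one side and of [al] on the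
    other, and since these parities add up to [zeta] the two effects cancel. *)
Lemma relabelled_swap ws x y Z al be : eta al (+) eta be = zeta ->
    complete ws -> eqw (@hpos m) ws ((x, y) :: Z) ->
  relabelled ws x al be = sgn (eta al && eta be) * relabelled ws y be al.
Proof.
move=> zE ws_c eq_ws.
have eq_ws' : eqw (@hpos m) ws ((y, x) :: Z).
  exact: eqw_trans eq_ws (eqw_swap (@hpos_inj m) _ _).
have ws'_c := complete_eqw eq_ws ws_c; have := complete_uniq ws'_c.
rewrite /= !inE negb_or => /and3P[/andP[xy xZ] yZ _].
rewrite (relabelledE _ _ ws_c eq_ws) (relabelledE _ _ ws_c eq_ws') mulr_sumr.
apply: eq_big => c; first by rewrite andbCA.
case/and3P=> /eqP cx /eqP cy okZ; rewrite mulrA -signr_addb; congr (sgn _ * _).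
have altC w : alt (@hpos m) (y, x) w = alt (@hpos m) (x, y) w by rewrite /alt /= addbC.
under [in RHS]eq_bigr do rewrite altC.
set q := \big[_/_]_(w <- Z) _.
have beforeE : before c x (+) before c y =
    (hpos x < hpos y)%N && eta al (+) (hpos y < hpos x)%N && eta be (+) q.
  have Zlt w z : z \in [:: x; y] -> w \in Z ->
      ((hpos w.1 < hpos z)%N = ~~ (hpos z < hpos w.1)%N) *
      ((hpos w.2 < hpos z)%N = ~~ (hpos z < hpos w.2)%N).
    move=> zxy wZ; have neg a : a \in ends Z -> (hpos a < hpos z)%N = ~~ (hpos z < hpos a)%N.
      move=> aZ; rewrite -leqNgt ltn_neqAle (inj_eq (@hpos_inj m)).
      have -> // : a != z.
      by apply/eqP=> az; move: zxy; rewrite -az !inE => /orP[]/eqP E;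
        rewrite E ?(negPf xZ) ?(negPf yZ) in aZ.
    by split; apply: neg; apply/flatten_mapP; exists w; rewrite // !inE eqxx ?orbT.
  have sumE G : \big[addb/false]_(z : half_edge m) G z =
      G x (+) G y (+) \big[addb/false]_(w <- Z) (G w.1 (+) G w.2).
    rewrite -big_enum -(perm_big _ ws'_c) /= !big_cons addbA; congr (_ (+) _).
    elim: (Z) => [|w Z' IH]; first by rewrite !big_nil.
    by rewrite /= !big_cons IH addbA.
  rewrite /before !sumE !ltnn cx cy /=.
  have -> : q = \big[addb/false]_(w <- Z) ((hpos w.1 < hpos x)%N && eta (c w.1) (+)
    (hpos w.2 < hpos x)%N && eta (c w.2))
      (+) \big[addb/false]_(w <- Z) ((hpos w.1 < hpos y)%N && eta (c w.1) (+)
        (hpos w.2 < hpos y)%N && eta (c w.2)).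
    rewrite -big_split /=; apply: eq_big_seq => w wZ.
    rewrite (paired_eta eta_bar (allP okZ _ wZ)) !(Zlt w x) ?(Zlt w y) ?inE ?eqxx ?orbT // /alt
      /=.
    by case: (eta _); rewrite ?andbF // !andbT; do 4!case: (_ < _)%N.
  move: (\big[_/_]_(w <- Z) _) (\big[_/_]_(w <- Z) _).
  case: (_ && _) => [] [] []; case: (_ && _) => //.
have yx : (hpos y < hpos x)%N = ~~ (hpos x < hpos y)%N.
  by rewrite -leqNgt ltn_neqAle (inj_eq (@hpos_inj m)) eq_sym xy.
have -> : before c y = before c x (+) (before c x (+) before c y) by rewrite addbA addbb.
rewrite {}beforeE yx -zE.
move: q (hpos x < hpos y)%N (eta al) (eta be) (sg c Z) (before c x).
by do 6!case.
Qed.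

Lemma diagram_sum_central (ws : seq (half_edge m * half_edge m)) : complete ws ->
  Y u v * W ws = W ws * Y u v.
Proof.
move=> ws_c; rewrite /W /wire_sum mulr_sumr mulr_suml.
transitivity (\sum_(c : {ffun half_edge m -> I} | ok c ws)
    (sgn (sg c ws) * Yprod c * Y u v + sgn (sg c ws) *
     \sum_x sgn (zeta && before c x) * act_label (c x) (fun l => Yprod (upd c x l)))).
  apply: eq_bigr => c okc; rewrite mulrA (commr_sign (Y u v)) -!mulrA word_prod_comm.
  (* Matched labels have equal parity, so the word as a whole is even and [Y u v] passes it without
     a sign. *)
  rewrite (_ : \big[addb/false]_z eta (c z) = false) ?andbF ?mul1r ?mulrDr ?mulrA //.
  rewrite -big_enum -(perm_big _ ws_c) /=; move: okc; elim: (ws) => [|w ws' IH].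
    by rewrite big_nil.
  case/andP=> /(paired_eta eta_bar) cw /IH IH'; rewrite !big_cons -[X in _ (+) (_ (+) X)]/(_) IH'.
  by rewrite cw addbF addbb.
rewrite big_split /= -[RHS]addr0; congr (_ + _).
under eq_bigr do rewrite mulr_sumr.
rewrite exchange_big /=.
transitivity (\sum_x (relabelled ws x u v - sgn (eta u && eta v) * relabelled ws x v u)).
  apply: eq_bigr => x _; rewrite /relabelled mulr_sumr -sumrB; apply: eq_bigr => c _.
  rewrite /act_label !mulrBr; congr (_ - _).
  have sC b (z : U) : z * sgn b = sgn b * z by rewrite commr_sign.
  by rewrite !mulrA; congr (_ * _); rewrite -!signr_addb addbC addbA.
rewrite sumrB -mulr_sumr.
have sumE (G : half_edge m -> U) : \sum_x G x = \sum_(w <- ws) (G w.1 + G w.2).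
  rewrite -big_enum -(perm_big _ ws_c) /=; elim: (ws) => [|w ws' IH]; first by rewrite !big_nil.
  by rewrite /= !big_cons IH addrA.
rewrite !sumE mulr_sumr -sumrB big1_seq // => -[x y] /= w_ws.
have eq_ws : eqw (@hpos m) ws ((x, y) :: rem (x, y) ws) by exact/perm_eqw/perm_to_rem.
have eq_ws' : eqw (@hpos m) ws ((y, x) :: rem (x, y) ws).
  exact: eqw_trans eq_ws (eqw_swap (@hpos_inj m) _ _).
(* The change of [x] to [u] cancels the change of [y] to [v], and likewise with [u] and [v]
   exchanged. *)
rewrite (@relabelled_swap ws x y _ u v erefl ws_c eq_ws).
rewrite (@relabelled_swap ws y x _ u v erefl ws_c eq_ws').
by rewrite mulrDr [X in X - _]addrC subrr.
Qed.

End Central.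

(** * Crossing signs and inversions *)

Import Order.TTheory Num.Theory.

Section Inversions.
Variables (m : nat) (s : 'S_m).

(* Both sides compare the Vandermonde determinant of [0, ..., m - 1] with the
   one of [s 0, ..., s (m - 1)]. *)
Lemma odd_perm_inversions :
  \big[addb/false]_(k < m) \big[addb/false]_(l < m | (k < l)%N) ~~ (s k < s l)%N = s.
Proof.
pose V (f : 'I_m -> 'I_m) : int := \prod_(k < m) \prod_(l < m | (k < l)%N) ((f l)%:Z - (f k)%:Z).
have VE f : V f = \det (Vandermonde m (\row_j (f j)%:Z)).
  rewrite det_Vandermonde; apply: eq_bigr => k _; apply: eq_bigr => l _.
  by rewrite !mxE.
have V_id : V s = V id * (-1) ^+ s.
  rewrite !VE -[in RHS]odd_permV -det_perm -det_mulmx -col_permE; congr (\det _).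
  by apply/matrixP=> i j; rewrite !mxE.
have V_pos : 0 < V id.
  by apply: prodr_gt0 => k _; apply: prodr_gt0 => l kl; rewrite subr_gt0 ltz_nat.
have V_sgn : V s = (-1) ^+ (\big[addb/false]_(k < m)
    \big[addb/false]_(l < m | (k < l)%N) ~~ (s k < s l)%N) * `|V s|.
  have signr_sum (J : finType) (P : pred J) (B : J -> bool) :
      (-1) ^+ (\big[addb/false]_(j | P j) B j) = \prod_(j | P j) (-1) ^+ B j :> int.
    by apply: (big_morph (fun b : bool => (-1) ^+ b)) => [x y|]; rewrite ?signr_addb.
  rewrite signr_sum /V normr_prod -big_split; apply: eq_bigr => k _ /=.
  rewrite signr_sum normr_prod -big_split; apply: eq_bigr => l kl /=.
  have skl : s k != s l by rewrite (inj_eq perm_inj); apply: contraTneq kl => ->; rewrite ltnn.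
  case: ltnP => /= [lt_s|le_s].
    by rewrite mul1r ger0_norm // subr_ge0 lez_nat ltnW.
  by rewrite mulN1r ler0_norm ?opprK // subr_le0 lez_nat.
have V_norm : `|V s| = V id by rewrite V_id normrM normr_sign mulr1 gtr0_norm.
move: V_sgn; rewrite V_norm V_id mulrC => /(mulIf (lt0r_neq0 V_pos)) E.
by apply/esym/eqP; rewrite -(inj_eq (@signr_inj int)) E.
Qed.

Lemma big_addb_sym (G : 'I_m -> 'I_m -> bool) :
  \big[addb/false]_(k < m) \big[addb/false]_(l < m) G k l =
    \big[addb/false]_(k < m) G k k (+)
    \big[addb/false]_(k < m) \big[addb/false]_(l < m | (k < l)%N) (G k l (+) G l k).
Proof.
have E k : \big[addb/false]_(l < m) G k l =
    G k k (+) \big[addb/false]_(l < m | (k < l)%N) G k l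
    (+) \big[addb/false]_(l < m | (l < k)%N) G k l.
  rewrite (bigD1 k) //= -addbA; congr (_ (+) _).
  rewrite (bigID (fun l : 'I_m => (k < l)%N)) /=; congr (_ (+) _).
    by apply: eq_bigl => l; rewrite -val_eqE /=; lia.
  by apply: eq_bigl => l; rewrite -val_eqE /=; lia.
rewrite (eq_bigr _ (fun k _ => E k)) !big_split /= -addbA; congr (_ (+) _).
under [in RHS]eq_bigr do rewrite big_split /=.
rewrite big_split /=; congr (_ (+) _).
by rewrite (exchange_big_dep xpredT).
Qed.

(** For k < l, alternation is the sum of the comparisons k < s l, l < s k and s k < s l. The first
    two, together with the terms k < s k of P_1 as the diagonal, sum k < s l over all pairs.
    Substituting along [s] turns this into the number of pairs k < l, and adding the third
    comparison leaves the inversions. *)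
Lemma chord_sign_odd : chord_sign s (fun=> true) = s.
Proof.
rewrite -odd_perm_inversions /chord_sign.
have altE (k l : 'I_m) : (k < l)%N -> alt (@hpos m) (wire s k) (wire s l) =
    (k < s l)%N (+) (l < s k)%N (+) (s k < s l)%N.
  move=> kl; rewrite /alt /wire /hpos /=.
  have -> : (k.*2 + true < l.*2 + true)%N by lia.
  have -> : (k.*2 + true < (s l).*2 + false)%N = (k < s l)%N by lia.
  have -> : ((s k).*2 + false < l.*2 + true)%N = ~~ (l < s k)%N by lia.
  have -> : ((s k).*2 + false < (s l).*2 + false)%N = (s k < s l)%N by lia.
  by do 3!case: (_ < _)%N.
rewrite [X in _ (+) X](eq_bigr (fun k : 'I_m =>
    \big[addb/false]_(l < m | (k < l)%N) ((k < s l)%N (+) (l < s k)%N) (+)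
    \big[addb/false]_(l < m | (k < l)%N) (s k < s l)%N)); last first.
  by move=> k _; rewrite -big_split /=; apply: eq_bigr => l kl; rewrite andbT altE.
rewrite big_split /= addbA big_mkcond /=.
have -> : \big[addb/false]_(k < m) (if (k < s k)%N then true else false) (+)
    \big[addb/false]_(k < m) \big[addb/false]_(l < m | (k < l)%N) ((k < s l)%N (+) (l < s k)%N) =
    \big[addb/false]_(k < m) \big[addb/false]_(l < m) (k < s l)%N.
  rewrite [RHS](big_addb_sym (fun k l => (k < s l)%N)); congr (_ (+) _).
  by apply: eq_bigr => k _; case: ifP.
rewrite -big_split; apply: eq_bigr => k _ /=.
have -> : \big[addb/false]_(l < m) (k < s l)%N = \big[addb/false]_(l < m | (k < l)%N) true.
  rewrite [RHS]big_mkcond [RHS](reindex_inj (@perm_inj _ s)) /=.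
  by apply: eq_bigr => l _; case: ifP.
rewrite -big_split /=; apply: eq_bigr => l _.
by case: (_ < _)%N.
Qed.

End Inversions.

(** * The exponent f_s modulo 2 *)

Section SignExp.
Variables (m : nat) (s : 'S_m).

(** A point other than the two ends lies between them when it is to the right of exactly one; this
    brings alternation into the additive form of [alt]. *)
Lemma strictly_betweenE (a b x : rat) : x != a -> x != b ->
  strictly_between (a, b) x = (a < x) (+) (b < x).
Proof.
move=> xa xb; rewrite /strictly_between /= gt_min lt_max.
by rewrite !(lt_neqAle x) xa xb /= !leNgt; do 2!case: (_ < _).
Qed.

Lemma ltr_chord (k l : nat) :
  ((k%:R + 1 / 3%:R < l%:R + 1 / 3%:R :> rat) = (k < l)%N) *
  ((k%:R + 1 / 3%:R < l%:R - 1 / 3%:R :> rat) = (k < l)%N) *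
  ((k%:R - 1 / 3%:R < l%:R + 1 / 3%:R :> rat) = (k <= l)%N) *
  ((k%:R - 1 / 3%:R < l%:R - 1 / 3%:R :> rat) = (k < l)%N).
Proof.
have [kl|lk|->] := ltngtP k l.
- have : k%:R + 1 <= l%:R :> rat by rewrite natr1 ler_nat.
  by move=> H; do !split; lra.
- have : l%:R + 1 <= k%:R :> rat by rewrite natr1 ler_nat.
  by move=> H; do !split; apply/negbTE; rewrite -leNgt; lra.
by do !split; lra.
Qed.

Lemma alternate_chord (k l : 'I_m) : (k < l)%N ->
  alternate (chord s k) (chord s l) = alt (@hpos m) (wire s k) (wire s l).
Proof.
move=> kl; rewrite /alternate /chord.
have skl : s k != s l :> nat by rewrite val_eqE (inj_eq perm_inj); apply: contraTneq kl => ->;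
  rewrite ltnn.
have neq_lt (x y : rat) : (x < y) || (y < x) -> x != y.
  by case/orP=> [/lt_eqF->|/gt_eqF->].
rewrite !strictly_betweenE; try by apply: neq_lt; rewrite !ltr_chord; lia.
rewrite !ltr_chord /alt /wire /hpos /=.
have -> : (k.*2 + true < l.*2 + true)%N = (k < l)%N by lia.
have -> : (k.*2 + true < (s l).*2 + false)%N = (k < s l)%N by lia.
have -> : ((s k).*2 + false < l.*2 + true)%N = (s k <= l)%N by lia.
have -> : ((s k).*2 + false < (s l).*2 + false)%N = (s k < s l)%N by lia.
by rewrite addbACA.
Qed.

Lemma odd_sign_exp (tau : 'I_m -> bool) :
  odd (sign_exp s (fun k => tau k : nat)) = chord_sign s tau.
Proof.
rewrite /sign_exp /chord_sign oddD; congr (_ (+) _).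
  rewrite (big_morph odd oddD (erefl : odd 0 = false)); apply: eq_bigr => k _.
  by rewrite oddb.
rewrite (big_morph odd oddD (erefl : odd 0 = false)) pair_big_dep /=.
rewrite big_mkcondr [RHS]big_mkcond /= big_mkcond /=; apply: eq_bigr => -[k l] _ /=.
case: ifP => // kl; rewrite alternate_chord //.
by case: ifP => //= _; case: (tau _) (tau _) => [] [].
Qed.

End SignExp.

(** * Generators of the enveloping algebra *)

Section Uea.
Variables (F : fieldType) (n : nat) (eta0 : 'I_n -> bool) (g : {vspace 'M[F]_n}).
Let U : algType F := uea eta0 g.

Lemma uea_gen_linear a (x y : subvs_of g) :
  uea_gen eta0 (a *: x + y) = a *: uea_gen eta0 x + uea_gen eta0 y :> U.
Proof.
rewrite -[RHS]/(uea_scale a (uea_pi eta0 (free_gen x)) + uea_pi eta0 (free_gen y)).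
rewrite -uea_piZ -uea_piD; apply/uea_piE.
exact: UeaLin.
Qed.

Lemma uea_genD (x y : subvs_of g) :
  uea_gen eta0 (x + y) = uea_gen eta0 x + uea_gen eta0 y :> U.
Proof. by have := uea_gen_linear 1 x y; rewrite !scale1r. Qed.

Lemma uea_gen0 : uea_gen eta0 (0 : subvs_of g) = 0 :> U.
Proof. by apply: (addrI (uea_gen eta0 (0 : subvs_of g) : U)); rewrite -uea_genD !addr0. Qed.

Lemma uea_genZ a (x : subvs_of g) : uea_gen eta0 (a *: x) = a *: uea_gen eta0 x :> U.
Proof. by rewrite -[a *: x]addr0 uea_gen_linear uea_gen0 addr0. Qed.

Lemma uea_genN (x : subvs_of g) : uea_gen eta0 (- x) = - uea_gen eta0 x :> U.
Proof. by rewrite -scaleN1r uea_genZ scaleN1r. Qed.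

Lemma uea_gen_bracket p q (x y z : subvs_of g) :
    mx_parity eta0 p (vsval x) -> mx_parity eta0 q (vsval y) ->
    vsval z = supercomm p q (vsval x) (vsval y) ->
  uea_gen eta0 x * uea_gen eta0 y
    - (-1) ^+ (p && q) * (uea_gen eta0 y * uea_gen eta0 x) = uea_gen eta0 z :> U.
Proof.
move=> xp yq zE; have signE (b : bool) : (-1) ^+ b =
  uea_pi eta0 ((-1) ^+ b : {malg F[{fmonom (subvs_of g)}]}) :> U.
  case: b; rewrite ?expr1 // /uea_pi; apply/esym.
  by rewrite [LHS]raddfN.
rewrite /uea_gen signE -![_ * _]/(uea_mul _ _) -!uea_piM.
have -> u v : (uea_pi eta0 u : U) - (uea_pi eta0 v : U) = uea_pi eta0 (u - v) :> U.
  by rewrite /uea_pi [RHS]raddfB.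
by apply/uea_piE; exact: UeaBracket xp yq zE.
Qed.

Lemma malg_words (P : {malg F[{fmonom (subvs_of g)}]} -> Prop) :
    P 1 -> (forall x u, P u -> P (free_gen x * u)) ->
    (forall a u, P u -> P (a *: u)) -> (forall u v, P u -> P v -> P (u + v)) ->
  forall u, P u.
Proof.
move=> P1 Pgen PZ PD u; rewrite [u]monalgE.
have P0 : P 0 by rewrite -(scale0r 1); apply: PZ.
apply: big_ind => // k _.
have -> : << u@_k *g k >> = u@_k *: << k >> :> {malg F[{fmonom (subvs_of g)}]}.
  by rewrite -mul_malgC malgM_def fgmulUU mulr1 mul1m.
apply: PZ; case: k => s; elim: s => [|x s IH].
  suff -> : << FMonom [::] >> = 1 :> {malg F[{fmonom (subvs_of g)}]} by [].
  by rewrite -fmoneE.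
suff -> : << FMonom (x :: s) >> = free_gen x * << FMonom s >> by exact: Pgen.
rewrite /free_gen malgM_def fgmulUU mulr1; congr (<< _ >>).
by apply/eqP; rewrite fmP fmM fmU.
Qed.

Lemma commr_scale (A : algType F) a (x y : A) : GRing.comm x y -> GRing.comm x (a *: y).
Proof. by move=> xy; rewrite /GRing.comm -scalerAr xy scalerAl. Qed.

Lemma uea_centralP (z : U) :
  (forall x, z * uea_gen eta0 x = uea_gen eta0 x * z) -> central z.
Proof.
move=> zC x; elim/uea_ind: x; elim/malg_words => [|x u IH|a u IH|u v IHu IHv].
- exact: (commr1 z : z * 1 = 1 * z).
- have -> : uea_pi eta0 (free_gen x * u) = (uea_gen eta0 x : U) * (uea_pi eta0 u : U).
    exact: uea_piM.
  exact: (@commrM U _ _ _ (zC x) IH).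
- have -> : uea_pi eta0 (a *: u) = a *: (uea_pi eta0 u : U) by exact: uea_piZ.
  exact: commr_scale.
have -> : uea_pi eta0 (u + v) = (uea_pi eta0 u : U) + (uea_pi eta0 v : U).
  exact: uea_piD.
exact: (@commrD U _ _ _ IHu IHv).
Qed.

Lemma uea_char (u : U) : 2%:R != 0 :> F -> u = - u -> u = 0.
Proof.
move: u; move: (U) => A u F2 uN; have u2 : (2%:R : F) *: u = 0.
  by rewrite scaler_nat mulr2n {2}uN subrr.
by rewrite -[u](scalerK F2) u2 scaler0.
Qed.

Lemma uea_parity_sum (J : finType) p (f : J -> U) :
  (forall j, uea_parity p (f j)) -> uea_parity p (\sum_j f j).
Proof.
move=> fP; apply: (big_ind (fun u : U => uea_parity p u)) => // [|u v]; last exact: UeaParityD.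
have -> : 0 = uea_gen eta0 (0 : subvs_of g) :> U by rewrite uea_gen0.
by apply: UeaParityGen => i j; rewrite linear0 mxE eqxx.
Qed.

Lemma uea_parity_sign p k (u : U) : uea_parity p u -> uea_parity p ((-1) ^+ k * u).
Proof.
have -> : (-1) ^+ k * u = ((-1) ^+ k : F) *: u.
  move: u; move: (U) => A u.
  by rewrite -signr_odd -[in RHS]signr_odd; case: (odd k);
    rewrite ?expr1 ?mulN1r ?scaleN1r // mul1r scale1r.
exact: UeaParityZ.
Qed.

Lemma uea_parity_prod (J : Type) (r : seq J) (p : J -> bool) (f : J -> U) :
    (forall j, uea_parity (p j) (f j)) ->
  uea_parity (\big[addb/false]_(j <- r) p j) (\prod_(j <- r) f j).
Proof.
move=> fP; elim: r => [|j r IH]; first by rewrite !big_nil; exact: UeaParity1.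
by rewrite !big_cons; apply: UeaParityM.
Qed.

End Uea.

(** * The orthosymplectic family *)

Section OspFamily.
Variables (F : fieldType) (n : nat) (X : 'I_n -> 'I_n -> 'M[F]_n).
Variables (eta0 eta e : 'I_n -> bool).
Notation bar := (@rev_ord n).
Notation sgn b := ((-1) ^+ (nat_of_bool b)).
Hypotheses (eta_bar : forall a, eta (bar a) = eta a).
Hypothesis e_bar : forall a, e (bar a) = e a (+) eta a.
(* [eta0] is the grading of the algebra and [eta] governs the signs; they differ
   for [sp], where the algebra is purely even but every index counts as odd. *)
Hypothesis eta0E : forall a b, eta0 a (+) eta0 b = eta a (+) eta b.
Hypothesis XE : forall i j, X i j = delta_mx i j -
  (sgn (eta i && eta j) * sgn (e (bar i)) * sgn (e j)) *: delta_mx (bar j) (bar i).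

Let U : algType F := uea eta0 (mx_span X).
Let barK : involutive bar := @rev_ordK n.

Definition family_gen i j : U := uea_gen eta0 (span_gen X i j).
Notation Y := (raised bar e family_gen).

Definition raised_mx a b : subvs_of (mx_span X) := (sgn (e (bar b)) : F) *: span_gen X a (bar b).

(** Matrix units with the second index raised: their products reproduce [contraction], and
    [raised_mx] is their super-antisymmetrisation. *)
Definition unit_mx_raised a b : 'M[F]_n := (sgn (e (bar b)) : F) *: delta_mx a (bar b).

Lemma vsvalN (x : subvs_of (mx_span X)) : vsval (- x) = - vsval x.
Proof. exact: linearN. Qed.

Lemma vsvalD (x y : subvs_of (mx_span X)) : vsval (x + y) = vsval x + vsval y.
Proof. exact: linearD. Qed.

Lemma vsvalZ a (x : subvs_of (mx_span X)) : vsval (a *: x) = a *: vsval x.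
Proof. exact: linearZ. Qed.

Lemma raised_mxE a b :
  vsval (raised_mx a b) = unit_mx_raised a b - (sgn (eta a && eta b) : F) *: unit_mx_raised b a.
Proof.
rewrite /raised_mx linearZ /= XE scalerBr barK eta_bar /unit_mx_raised !scalerA;
  congr (_ - _ *: _).
by rewrite -!signr_addb; congr (sgn _); case: (_ && _) (e _) (e _) => [] [] [].
Qed.

Lemma unit_mx_raised_mul a b c d : unit_mx_raised a b *m unit_mx_raised c d =
  (if c == bar b then (sgn (e c) : F) else 0) *: unit_mx_raised a d.
Proof.
rewrite /unit_mx_raised -scalemxAl -scalemxAr mul_delta_mx_cond [bar b == c]eq_sym.
by case: eqP => [->|_]; rewrite ?mulr1n // mulr0n !scaler0 scale0r.
Qed.

Lemma sign_scale (A : algType F) (b : bool) (x : A) : sgn b * x = (sgn b : F) *: x.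
Proof. by case: b; rewrite ?expr1 ?mulN1r ?scaleN1r // mul1r scale1r. Qed.

Lemma raisedE a b : Y a b = uea_gen eta0 (raised_mx a b).
Proof. by rewrite /raised sign_scale /raised_mx uea_genZ. Qed.

Lemma raised_skew : skew eta Y.
Proof.
move=> a b; rewrite !raisedE sign_scale -uea_genZ -uea_genN; congr (uea_gen _ _).
apply: subvs_inj; rewrite vsvalN vsvalZ !raised_mxE scalerBr scalerA opprB.
by rewrite scalerA [eta b && eta a]andbC -expr2 sqrr_sign scale1r.
Qed.

Lemma raised_parity a b : mx_parity eta0 (eta a (+) eta b) (vsval (raised_mx a b)).
Proof.
move=> i j; rewrite raised_mxE /unit_mx_raised !mxE eta0E.
case: (boolP ((i == a) && (j == bar b))) => [/andP[/eqP-> /eqP->] _|_].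
  by rewrite eta_bar.
case: (boolP ((i == b) && (j == bar a))) => [/andP[/eqP-> /eqP->] _|_].
  by rewrite eta_bar addbC.
by rewrite !mulr0 subr0 eqxx.
Qed.

Lemma raised_supercomm a b c d :
  let k x y : F := if y == bar x then sgn (e y) else 0 in
  supercomm (eta a (+) eta b) (eta c (+) eta d) (vsval (raised_mx a b)) (vsval (raised_mx c d)) =
    k b c *: vsval (raised_mx a d) - (sgn (eta a && eta b) * k a c) *: vsval (raised_mx b d)
    - (sgn (eta c && eta d) * k b d) *: vsval (raised_mx a c)
    + (sgn ((eta a && eta b) (+) (eta c && eta d)) * k a d) *: vsval (raised_mx b c).
Proof.
move=> k; rewrite /supercomm !raised_mxE.
(* The form is symmetric up to the parity of its label. Hence the terms of the reversed product are
   exactly the antisymmetric partners of those of the direct product. *)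
have kE x y z t : sgn ((eta x (+) eta y) && (eta z (+) eta t)) * sgn (eta x && eta y)
    * sgn (eta z && eta t) * k z y = sgn (eta x && eta t) * k y z :> F.
  rewrite /k; have -> : (y == bar z) = (z == bar y) by apply/eqP/eqP=> ->; rewrite barK.
  case: eqP => [->|_]; last by rewrite !mulr0.
  rewrite e_bar eta_bar -!signr_addb; congr (sgn _).
  by case: (eta x) (eta y) (eta t) (e y) => [] [] [] [].
have kE1 := kE a b c d; have kE2 := kE b a c d; have kE3 := kE a b d c; have kE4 := kE b a d c.
move: unit_mx_raised unit_mx_raised_mul => G GM.
rewrite !mulmxBl !mulmxBr -!scalemxAl -!scalemxAr !GM -!/(k _ _).
apply/matrixP=> i j; rewrite !mxE.
rewrite [eta b (+) eta a]addbC [eta d (+) eta c]addbC [eta b && eta a]andbC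
  [eta d && eta c]andbC in kE2 kE3 kE4.
rewrite signr_addb.
have qq : sgn (eta a && eta b) * sgn (eta a && eta b) = 1 :> F by rewrite -expr2 sqrr_sign.
have ww : sgn (eta c && eta d) * sgn (eta c && eta d) = 1 :> F by rewrite -expr2 sqrr_sign.
move: (sgn ((eta a (+) eta b) && (eta c (+) eta d))) (sgn (eta a && eta b)) (sgn (eta c && eta d))
  qq ww kE1 kE2 kE3 kE4 => s q w qq ww kE1 kE2 kE3 kE4.
have {}kE2 : s * w * k c a = q * (sgn (eta b && eta d) * k a c).
  by rewrite -kE2 -[LHS]mul1r -qq; ring.
have {}kE3 : s * q * k d b = w * (sgn (eta a && eta c) * k b d).
  by rewrite -kE3 -[LHS]mul1r -ww; ring.
have {}kE4 : s * k d a = q * w * (sgn (eta b && eta c) * k a d).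
  by rewrite -kE4 -[LHS]mul1r -[1]mulr1 -{1}qq -ww; ring.
transitivity (k b c * G a d i j - w * k b d * G a c i j - q * k a c * G b d i j
  + q * w * k a d * G b c i j - (s * k d a) * G c b i j + (s * q * k d b) * G c a i j
  + (s * w * k c a) * G d b i j - (s * q * w * k c b) * G d a i j); first by ring.
by rewrite kE1 kE2 kE3 kE4; ring.
Qed.

Lemma raised_commutation : osp_commutation bar eta e Y.
Proof.
move=> a b c d.
pose k x y : F := if y == bar x then sgn (e y) else 0.
have contractionE x y z t : contraction bar e Y x y z t = k y z *: uea_gen eta0 (raised_mx x t).
  by rewrite /contraction raisedE /k; case: ifP; rewrite ?scale0r // sign_scale.
rewrite !contractionE !raisedE.
rewrite (uea_gen_bracket (z := k b c *: raised_mx a d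
    - (sgn (eta a && eta b) * k a c) *: raised_mx b d
    - (sgn (eta c && eta d) * k b d) *: raised_mx a c
    + (sgn ((eta a && eta b) (+) (eta c && eta d)) * k a d) *: raised_mx b c)); first last.
- by rewrite raised_supercomm !(vsvalD, vsvalN, vsvalZ).
- exact: raised_parity.
- exact: raised_parity.
by rewrite !(uea_genD, uea_genN, uea_genZ) !sign_scale !scalerA.
Qed.

Lemma family_gen_central (z : U) :
  (forall i j, z * family_gen i j = family_gen i j * z) -> central z.
Proof.
move=> zC; apply: uea_centralP => x.
have /coord_span xE := valP x.
have -> : x = \sum_i coord (codom_tuple (fun ij => X ij.1 ij.2)) i (vsval x)
      *: span_gen X (enum_val i).1 (enum_val i).2.
  apply: subvs_inj; rewrite [LHS]xE linear_sum; apply: eq_bigr => i _.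
  rewrite -[RHS]/(vsval _) vsvalZ; congr (_ *: _).
  by rewrite -[RHS](nth_image 0 (fun ij => X ij.1 ij.2)).
apply: (big_ind (fun y => GRing.comm z (uea_gen eta0 y : U))) => [|y t yC tC|i _].
- by rewrite uea_gen0; exact: commr0.
- by rewrite uea_genD; exact: commrD.
by rewrite uea_genZ; apply: commr_scale; exact: zC.
Qed.

Lemma family_central m (s : 'S_m) : central (index_sum eta family_gen s : U).
Proof.
apply: family_gen_central => i j.
rewrite (index_sumE barK eta_bar e_bar).
have XY : family_gen i j = sgn (e j) * Y i (bar j).
  by rewrite /raised barK mulrA -signr_addb addbb mul1r.
have YC : GRing.comm (diagram_sum bar eta e Y (wires s)) (Y i (bar j)).
  apply/esym; apply: (diagram_sum_central barK eta_bar e_bar raised_skew raised_commutation).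
  exact: complete_wires.
by rewrite XY; apply: commrM YC; exact: commr_sign.
Qed.

Lemma family_so_relations : 2%:R != 0 :> F ->
  so_relations (index_sum eta family_gen : forall m, 'S_m -> U) (index_casimir eta family_gen).
Proof.
move=> F2; apply: (index_so_relations barK eta_bar e_bar raised_skew raised_commutation).
by move=> x; apply: uea_char.
Qed.

(** Every index occurs once in a first and once in a second position, so its parity cancels from the
    total. As the values are even, commuting and supercommuting with the algebra mean the same for
    them. *)
Lemma family_parity m (s : 'S_m) : uea_parity false (index_sum eta family_gen s : U).
Proof.
apply: uea_parity_sum => i; apply: uea_parity_sign.
have -> : false = \big[addb/false]_(k < m) (eta (i k) (+) eta (i (s k))).
  rewrite big_split /= (reindex_inj (h := s)) /=; last exact: perm_inj.
  by rewrite addbb.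
apply: uea_parity_prod => k; apply: UeaParityGen.
have := @raised_parity (i k) (bar (i (s k))); rewrite eta_bar.
move=> H a b ab; apply: H; rewrite /raised_mx vsvalZ /= mxE barK mulf_neq0 //.
by rewrite signr_eq0.
Qed.

End OspFamily.

Lemma so_relations_eq (R : nzRingType) (w w' : forall m, 'S_m -> R) (C C' : nat -> R) :
    (forall m (s : 'S_m), w m s = w' m s) -> (forall k, C k = C' k) ->
  so_relations w C -> so_relations w' C'.
Proof.
move=> eq_w eq_C; suff [-> ->] : w = w' /\ C = C' by [].
split; last exact: functional_extensionality_dep.
apply: functional_extensionality_dep => m; exact: functional_extensionality_dep.
Qed.

Section SignCases.
Variables (U : nzRingType) (I : finType) (X : I -> I -> U).

Lemma index_sum_even m (s : 'S_m) : index_sum (fun=> false) X s =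
  \sum_(i : {ffun 'I_m -> I}) \prod_(k < m) X (i k) (i (s k)).
Proof.
apply: eq_bigr => i _; rewrite /chord_sign big1 // big1 ?mul1r // => k _.
by rewrite big1 // => l _; rewrite andbF.
Qed.

Lemma index_casimir_even k : index_casimir (fun=> false) X k =
  if k is 0 then #|I|%:R else
  \sum_(i : {ffun 'I_k -> I}) \prod_(l < k) X (i l) (i (ordS l)).
Proof.
case: k => [|k]; first by rewrite /= sumr_const cardT.
by apply: eq_bigr => i _; rewrite big1 ?mul1r.
Qed.

Lemma index_sum_odd m (s : 'S_m) : index_sum (fun=> true) X s =
  (-1) ^+ (m + #|porbits s|) *
  \sum_(i : {ffun 'I_m -> I}) \prod_(k < m) X (i k) (i (s k)).
Proof.
rewrite mulr_sumr; apply: eq_bigr => i _; congr (_ * _).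
by rewrite chord_sign_odd -[RHS]signr_odd oddD /odd_perm card_ord.
Qed.

Lemma index_casimir_odd k : index_casimir (fun=> true) X k =
  if k is 0 then - #|I|%:R else
  (-1) ^+ k.+1 * \sum_(i : {ffun 'I_k -> I}) \prod_(l < k) X (i l) (i (ordS l)).
Proof.
case: k => [|k]; first by rewrite /= sumr_const cardT expr1 mulNrn.
rewrite mulr_sumr; apply: eq_bigr => i _; congr (_ * _).
(* Of the [k.+1] indices only the first is left out, and the exponents k and k + 2 give the same
   sign. *)
rewrite big_mkcond big_ord_recl /= !exprS mulN1r mulN1r opprK.
rewrite -[RHS]signr_odd; congr ((-1) ^+ (nat_of_bool _)).
elim: k {i} => [|k IH]; first by rewrite big_ord0.
by rewrite big_ord_recr /= IH addbT.
Qed.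

Lemma index_sum_exp (eta : I -> bool) m (s : 'S_m) : index_sum eta X s =
  \sum_(i : {ffun 'I_m -> I}) (-1) ^+ sign_exp s (fun k => eta (i k)) *
    \prod_(k < m) X (i k) (i (s k)).
Proof.
apply: eq_bigr => i _; congr (_ * _).
by rewrite -[RHS]signr_odd (odd_sign_exp s (eta \o i)).
Qed.

Lemma index_casimir_exp (eta : I -> bool) k : (0 < k)%N -> index_casimir eta X k =
  \sum_(i : {ffun 'I_k -> I}) (-1) ^+ (\sum_(l < k | 0 < l) eta (i l))%N *
    \prod_(l < k) X (i l) (i (ordS l)).
Proof.
case: k => // k _; apply: eq_bigr => i _; congr (_ * _).
rewrite -[RHS]signr_odd (big_morph odd oddD (erefl : odd 0 = false)).
by congr ((-1) ^+ (nat_of_bool _)); apply: eq_bigr => l _; rewrite oddb.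
Qed.

End SignCases.

Lemma superdim (U : nzRingType) N M :
  \sum_(l < N + 2 * M) (-1) ^+ osp_eta l = N%:R - (2 * M)%:R :> U.
Proof.
pose f l : U := (-1) ^+ ~~ ((M <= l) && (l < M + N))%N.
transitivity (\sum_(0 <= l < N + 2 * M) f l); first by rewrite big_mkord.
(* The even indices form the middle block of length N, between two odd blocks of length M. *)
rewrite (@big_cat_nat _ _ _ M) /=; [|lia|lia].
rewrite (@big_cat_nat _ _ _ (M + N) M) /=; [|lia|lia].
rewrite (eq_big_nat _ _ (F2 := fun=> -1)) => [|l Hl]; last first.
  by rewrite /f leqNgt; move: Hl => /andP[_ ->].
rewrite [X in _ + (X + _)](eq_big_nat _ _ (F2 := fun=> 1)) => [|l Hl]; last first.
  by rewrite /f Hl.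
rewrite [X in _ + (_ + X)](eq_big_nat _ _ (F2 := fun=> -1)) => [|l Hl]; last first.
  by rewrite /f ltnNge; move: Hl => /andP[-> _]; rewrite andbF.
have -> : (2 * M = M + M)%N by lia.
have NM : (N + (M + M) - (M + N) = M)%N by lia.
by rewrite !sumr_const_nat subn0 addKn NM !mulNrn addrCA natrD opprD.
Qed.

(** * The three families of Lie (super)algebras *)

Section Instances.
Variable F : fieldType.
Hypothesis F2 : 2%:R != 0 :> F.

Section So.
Variable N : nat.

Let so_mxE (i j : 'I_N) : so_mx F i j = delta_mx i j -
  ((-1) ^+ (false && false) * (-1) ^+ false * (-1) ^+ false) *: delta_mx (rev_ord j) (rev_ord i).
Proof. by rewrite !mulr1 scale1r. Qed.

Lemma w_so_central m (s : 'S_m) : central (w_so F N s).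
Proof.
have := @family_central F N (@so_mx F N) (@so_eta N) (fun=> false) (fun=> false)
  (fun=> erefl) (fun=> erefl) (fun _ _ => erefl) so_mxE m s.
by rewrite index_sum_even.
Qed.

Lemma w_so_relations : so_relations (w_so F N) (casimir_so F N).
Proof.
have := @family_so_relations F N (@so_mx F N) (@so_eta N) (fun=> false) (fun=> false)
  (fun=> erefl) (fun=> erefl) (fun _ _ => erefl) so_mxE F2.
apply: so_relations_eq => [m s|k]; first exact: index_sum_even.
apply: etrans (index_casimir_even _ _) _; case: k => //.
by rewrite card_ord.
Qed.

End So.

Section Sp.
Variable M : nat.

(** The signs of the symplectic form change under [rev_ord] at every index; in [e_bar] this amounts
    to declaring all indices odd. *)
Definition sp_sign (i : 'I_(2 * M)) : bool := ~~ (i < M)%N.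

Let sp_sign_rev i : sp_sign (rev_ord i) = sp_sign i (+) true.
Proof. by rewrite /sp_sign /= addbT negbK; have := ltn_ord i; lia. Qed.

Let sp_epsE i : sp_eps F i = (-1) ^+ sp_sign i.
Proof. by rewrite /sp_eps /sp_sign; case: ifP; rewrite ?expr1. Qed.

Let sp_mxE (i j : 'I_(2 * M)) : sp_mx F i j = delta_mx i j -
  ((-1) ^+ (true && true) * (-1) ^+ sp_sign (rev_ord i) * (-1) ^+ sp_sign j)
  *: delta_mx (rev_ord j) (rev_ord i).
Proof. by rewrite /sp_mx !sp_epsE sp_sign_rev addbC signr_addb mulrA -expr2 sqrr_sign mul1r. Qed.

Lemma w_sp_central m (s : 'S_m) : central (w_sp F M s).
Proof.
have := @family_central F (2 * M) (@sp_mx F M) (@sp_eta M) (fun=> true) sp_sign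
  (fun=> erefl) sp_sign_rev (fun _ _ => erefl) sp_mxE m s.
by rewrite index_sum_odd.
Qed.

Lemma w_sp_relations : so_relations (w_sp F M) (casimir_sp F M).
Proof.
have := @family_so_relations F (2 * M) (@sp_mx F M) (@sp_eta M) (fun=> true) sp_sign
  (fun=> erefl) sp_sign_rev (fun _ _ => erefl) sp_mxE F2.
apply: so_relations_eq => [m s|k]; first exact: index_sum_odd.
apply: etrans (index_casimir_odd _ _) _; case: k => //.
by rewrite card_ord.
Qed.

End Sp.

Section Osp.
Variables N M : nat.

(** The involution exchanges the two outer blocks, on which this sign differs, and preserves the
    middle block, on which it is constant; so it changes exactly at the odd indices. *)
Definition osp_sign (i : 'I_(N + 2 * M)) : bool := ~~ (i < M + N)%N.

Let osp_eta_rev (i : 'I_(N + 2 * M)) : osp_eta (rev_ord i) = osp_eta i.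
Proof. by rewrite /osp_eta /=; have := ltn_ord i; lia. Qed.

Let osp_sign_rev (i : 'I_(N + 2 * M)) : osp_sign (rev_ord i) = osp_sign i (+) osp_eta i.
Proof.
rewrite /osp_sign /osp_eta /=; have := ltn_ord i; set j := nat_of_ord i => jn.
by case: (ltnP j (M + N)) => j1; case: (leqP M j) => j2 /=; lia.
Qed.

Let osp_epsE i : osp_eps F i = (-1) ^+ osp_sign i.
Proof. by rewrite /osp_eps /osp_sign; case: ifP; rewrite ?expr1. Qed.

Let osp_mxE (i j : 'I_(N + 2 * M)) : osp_mx F i j = delta_mx i j -
  ((-1) ^+ (osp_eta i && osp_eta j) * (-1) ^+ osp_sign (rev_ord i) * (-1) ^+ osp_sign j)
  *: delta_mx (rev_ord j) (rev_ord i).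
Proof. by rewrite /osp_mx !osp_epsE mulnb. Qed.

Lemma w_ospE m (s : 'S_m) : index_sum (@osp_eta N M) (@osp_gen F N M) s = w_osp F N M s.
Proof. exact: index_sum_exp. Qed.

Lemma w_osp_central m (s : 'S_m) : central (w_osp F N M s).
Proof.
rewrite -w_ospE.
exact: (@family_central F (N + 2 * M) (@osp_mx F N M) (@osp_eta N M) (@osp_eta N M) osp_sign
  osp_eta_rev osp_sign_rev (fun _ _ => erefl) osp_mxE).
Qed.

Lemma w_osp_parity m (s : 'S_m) : uea_parity false (w_osp F N M s).
Proof.
rewrite -w_ospE.
exact: (@family_parity F (N + 2 * M) (@osp_mx F N M) (@osp_eta N M) (@osp_eta N M) osp_sign
  osp_eta_rev (fun _ _ => erefl) osp_mxE).
Qed.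

Lemma w_osp_relations : so_relations (w_osp F N M) (casimir_osp F N M).
Proof.
have := @family_so_relations F (N + 2 * M) (@osp_mx F N M) (@osp_eta N M) (@osp_eta N M) osp_sign
  osp_eta_rev osp_sign_rev (fun _ _ => erefl) osp_mxE F2.
apply: so_relations_eq => [m s|[|k]]; first exact: w_ospE.
  exact: superdim.
exact: index_casimir_exp.
Qed.

End Osp.
End Instances.

Theorem theorem3p1 (R : realType) (N M : nat) :
  [/\ (forall m (s : 'S_m), central (w_so R[i] N s)) /\
        so_relations (w_so R[i] N) (casimir_so R[i] N),
      (forall m (s : 'S_m), central (w_sp R[i] M s)) /\
        so_relations (w_sp R[i] M) (casimir_sp R[i] M)
    & (forall m (s : 'S_m), central (w_osp R[i] N M s) /\
         uea_parity false (w_osp R[i] N M s)) /\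
        so_relations (w_osp R[i] N M) (casimir_osp R[i] N M)].
Proof.
have C2 : 2%:R != 0 :> R[i] by rewrite pnatr_eq0.
split; split.
- by move=> m s; apply: w_so_central.
- exact: w_so_relations.
- by move=> m s; apply: w_sp_central.
- exact: w_sp_relations.
- by move=> m s; split; [apply: w_osp_central | apply: w_osp_parity].
exact: w_osp_relations.
Qed.
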